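(* Let $(G,u)$ be a compact matrix quantum group. Assume that the (equivalence classes of) irreducible representations of $(G,u)$ can be labelled by $\mathbb N*\mathbb N$, as $\{r_x\}_{x\in\mathbb N*\mathbb N}$ (distinct classes for distinct $x$), with $r_e=1$, $r_\alpha=u$, $r_\beta=\bar u$ and $$r_x\otimes r_y=\sum_{\{a,b,g\in\mathbb N*\mathbb N\,|\,x=ag,\ y=\bar gb\}}r_{ab}\qquad\forall x,y\in\mathbb N*\mathbb N.$$ Then there exist $n\in\mathbb N$ and $F\in GL(n,\mathbb C)$ such that $G_{full}\sim_{sim}A_u(F)$.
   Context: A compact matrix quantum group (Woronowicz) is a pair $(G,u)$ with $G$ a unital $C^*$-algebra and $u\in M_n(G)$ such that: the coefficients of $u$ generate a dense $*$-subalgebra $G_s\subset G$; there is a $C^*$-morphism $\delta:G\to G\otimes_{min}G$ with $\delta(u_{ij})=\sum_k u_{ik}\otimes u_{kj}$; there is a linear antimultiplicative map $\kappa:G_s\to G_s$ with $\kappa(\kappa(a^* )^* )=a$ for $a\in G_s$ and $(Id\otimes\kappa)u=u^{-1}$. A representation of $(G,u)$ is an invertible matrix $r\in M_k(G)$ with $\delta(r_{ij})=\sum_l r_{il}\otimes r_{lj}$; $\bar r=(r_{ij}^* )$; $r\otimes s=\sum e_{ij}\otimes e_{kl}\otimes r_{ij}s_{kl}$; $r+s=diag(r,s)$. Equalities between representations are up to equivalence. $G_{full}$ is the enveloping $C^*$-algebra of $G_s$; it is a compact matrix quantum group with the same fundamental matrix $u$. Two compact matrix quantum groups $(G,u)$,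 $(H,v)$ with $u\in M_n(G)$, $v\in M_m(H)$ are similar, $G\sim_{sim}H$, if $n=m$ and there exist $Q\in GL(n,\mathbb C)$ and a $C^*$-isomorphism $f:G\to H$ with $(Id\otimes f)u=QvQ^{-1}$. For $F\in GL(n,\mathbb C)$, $A_u(F)$ is the universal $C^*$-algebra generated by variables $u_{ij}$ ($1\le i,j\le n$) with the relations making unitary both matrices $u=(u_{ij})$ and $F\bar uF^{-1}$, where $\bar u=(u_{ij}^* )$; $(A_u(F),u)$ is a compact matrix quantum group. $\mathbb N*\mathbb N$ is the free monoid on two generators $\alpha,\beta$, with unit $e$ and with the antimultiplicative involution $x\mapsto\bar x$ given by $\bar e=e$, $\bar\alpha=\beta$, $\bar\beta=\alpha$. *)

(* Defs.v *)
From HB Require Import structures.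
From mathcomp Require Import all_boot all_order all_algebra.
From mathcomp Require Import all_classical all_reals all_analysis.
From mathcomp Require Import complex mxtens.

Set Implicit Arguments.
Unset Strict Implicit.
Unset Printing Implicit Defensive.

Import Order.TTheory GRing.Theory Num.Theory numFieldNormedType.Exports.

Local Open Scope classical_set_scope.
Local Open Scope ring_scope.

(* Unital C*-algebras over R[i].  The norm is a field of the structure, with
   real values: HB rejects a join of GRing.Algebra with the normed modules of
   MathComp-Analysis.  As an algType, the algebra is nonzero. *)
HB.mixin Record isCstar (R : realType) A of GRing.Algebra R[i] A := {
  star : A -> A;
  cnorm : A -> R;
  starD : forall a b, star (a + b) = star a + star b;
  starZ : forall (c : R[i]) a, star (c *: a) = Num.conj c *: star a;
  starM : forall a b, star (a * b) = star b * star a;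
  starK : involutive star;
  cnorm0_eq0 : forall a, cnorm a = 0 -> a = 0;
  cnormD : forall a b, cnorm (a + b) <= cnorm a + cnorm b;
  cnormZ : forall (c : R[i]) a, cnorm (c *: a) = Normc.normc c * cnorm a;
  cnormM : forall a b, cnorm (a * b) <= cnorm a * cnorm b;
  cnorm_star : forall a, cnorm (star a * a) = cnorm a ^+ 2;
  cnorm_complete : forall x : nat -> A,
    (forall e, 0 < e -> exists N : nat, forall m n,
       (N <= m)%N -> (N <= n)%N -> cnorm (x m - x n) < e) ->
    exists l, (fun n => cnorm (x n - l)) @ \oo --> (0 : R)
}.

#[short(type="cstarType")]
HB.structure Definition Cstar (R : realType) :=
  {A of isCstar R A & GRing.Algebra R[i] A}.

(* Hilbert spaces over R[i]; ip is linear in its first argument. *)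
HB.mixin Record isHilbert (R : realType) H of CompleteNormedModule R[i] H := {
  ip : H -> H -> R[i];
  ip_linearl : forall (c : R[i]) x y z, ip (c *: x + y) z = c * ip x z + ip y z;
  ip_conj : forall x y, ip y x = Num.conj (ip x y);
  ip_norm : forall x, ip x x = `|x| ^+ 2
}.

#[short(type="hilbertType")]
HB.structure Definition Hilbert (R : realType) :=
  {H of isHilbert R H & CompleteNormedModule R[i] H}.

Section CstarAlgebras.
Context {R : realType}.
Implicit Types A B D T : cstarType R.

Definition star_subalg A (S : set A) : Prop :=
  [/\ S 1,
      forall (c : R[i]) a b, S a -> S b -> S (c *: a + b),
      forall a b, S a -> S b -> S (a * b) &
      forall a, S a -> S (star a)].

Definition gen_star_alg A (X : set A) : set A := smallest (@star_subalg A) X.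

Definition cdense A (S : set A) : Prop :=
  forall (a : A) (e : R), 0 < e -> exists2 s, S s & cnorm (a - s) < e.

(* Unital *-morphisms on a *-subalgebra S, given by functions whose values
   off S are irrelevant. *)
Definition star_hom_on A B (S : set A) (f : A -> B) : Prop :=
  [/\ f 1 = 1,
      forall (c : R[i]) a b, S a -> S b -> f (c *: a + b) = c *: f a + f b,
      forall a b, S a -> S b -> f (a * b) = f a * f b &
      forall a, S a -> f (star a) = star (f a)].

Definition star_hom A B (f : A -> B) : Prop := star_hom_on setT f.

Definition faithful_rep A (H : hilbertType R) (p : A -> H -> H) : Prop :=
  [/\ [/\ forall a (c : R[i]) x y, p a (c *: x + y) = c *: p a x + p a y &
          forall a, exists M : R[i], forall x, `|p a x| <= M * `|x|],
      [/\ forall x, p 1 x = x,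
          forall (c : R[i]) a b x, p (c *: a + b) x = c *: p a x + p b x,
          forall a b x, p (a * b) x = p a (p b x) &
          forall a x y, ip (p a x) y = ip x (p (star a) y)] &
      forall a, (forall x, p a x = 0) -> a = 0].

(* L is the Hilbert tensor product of H and K, with elementary tensors t x y.
   The inner product formula forces t to be bilinear. *)
Definition hilbert_tensor (H K L : hilbertType R) (t : H -> K -> L) : Prop :=
  (forall x x' y y', ip (t x y) (t x' y') = ip x x' * ip y y') /\
  (forall (z : L) (e : R[i]), 0 < e ->
     exists s : seq (H * K), `|z - \sum_(q <- s) t q.1 q.2| < e).

(* T is the minimal (spatial) tensor product of A and B, with elementary
   tensors t a b: for faithful representations of A on H and of B on K, T is
   the closed linear span of the operators pA a (x) pB b on the Hilbert tensor
   product of H and K.  The choice of pA and pB does not matter. *)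
Definition min_tensor A B T (t : A -> B -> T) : Prop :=
  (exists (H K L : hilbertType R) (tH : H -> K -> L)
          (pA : A -> H -> H) (pB : B -> K -> K) (pT : T -> L -> L),
     [/\ hilbert_tensor tH,
         faithful_rep pA, faithful_rep pB, faithful_rep pT &
         forall a b x y, pT (t a b) (tH x y) = tH (pA a x) (pB b y)]) /\
  (forall (z : T) (e : R), 0 < e ->
     exists s : seq (A * B), cnorm (z - \sum_(q <- s) t q.1 q.2) < e).

Definition entries A n (u : 'M[A]_n) : set A := [set a | exists i j, a = u i j].

Definition scmx A m n (Q : 'M[R[i]]_(m, n)) : 'M[A]_(m, n) :=
  map_mx (in_alg A) Q.

Definition barmx A n (u : 'M[A]_n) : 'M[A]_n := map_mx star u.

Definition unitary_matrix A n (u : 'M[A]_n) : Prop :=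
  u *m (barmx u)^T = 1%:M /\ (barmx u)^T *m u = 1%:M.

(* (B, iota) is the enveloping C*-algebra of the *-subalgebra S of A. *)
Definition is_enveloping A (S : set A) B (iota : A -> B) : Prop :=
  [/\ star_hom_on S iota,
      cdense (iota @` S) &
      forall D (phi : A -> D), star_hom_on S phi ->
        exists2 psi : B -> D, star_hom psi &
          forall a, S a -> psi (iota a) = phi a].

Definition Au_relations n (F : 'M[R[i]]_n) A (u : 'M[A]_n) : Prop :=
  unitary_matrix u /\ unitary_matrix (scmx A F *m barmx u *m scmx A (invmx F)).

(* (A, u) is the universal C*-algebra A_u(F) with its matrix of generators. *)
Definition is_Au n (F : 'M[R[i]]_n) A (u : 'M[A]_n) : Prop :=
  [/\ Au_relations F u,
      cdense (gen_star_alg (entries u)) &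
      forall D (w : 'M[D]_n), Au_relations F w ->
        exists2 psi : A -> D, star_hom psi & map_mx psi u = w].

Definition qg_similar A n (u : 'M[A]_n) B m (v : 'M[B]_m) : Prop :=
  exists (e : n = m) (Q : 'M[R[i]]_m) (f : A -> B),
    [/\ Q \in unitmx, star_hom f, bijective f &
        castmx (e, e) (map_mx f u) = scmx B Q *m v *m scmx B (invmx Q)].

End CstarAlgebras.

Section QuantumGroups.
Variable R : realType.

(* Compact matrix quantum groups.  delta and kappa are determined by u; the
   values of kappa outside G_s are irrelevant. *)
Record cmqg := Cmqg {
  qalg : cstarType R;
  qdim : nat;
  qmx : 'M[qalg]_qdim;
  qtens : cstarType R;
  qtimes : qalg -> qalg -> qtens;
  qdelta : qalg -> qtens;
  qkappa : qalg -> qalg;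
  coef_alg : set qalg := gen_star_alg (entries qmx);
  coef_alg_dense : cdense coef_alg;
  qtimes_min : min_tensor qtimes;
  qdelta_hom : star_hom qdelta;
  qdelta_mx : forall i j,
    qdelta (qmx i j) = \sum_k qtimes (qmx i k) (qmx k j);
  qkappa_coef : forall a, coef_alg a -> coef_alg (qkappa a);
  qkappa_linear : forall (c : R[i]) a b, coef_alg a -> coef_alg b ->
    qkappa (c *: a + b) = c *: qkappa a + qkappa b;
  qkappa_anti : forall a b, coef_alg a -> coef_alg b ->
    qkappa (a * b) = qkappa b * qkappa a;
  qkappa_star : forall a, coef_alg a -> qkappa (star (qkappa (star a))) = a;
  qkappa_mx : qmx *m map_mx qkappa qmx = 1%:M /\
              map_mx qkappa qmx *m qmx = 1%:M
}.

Variable G : cmqg.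

(* Square matrices over G of arbitrary size. *)
Record sqmx := Sqmx { sqdim : nat; sqval :> 'M[qalg G]_sqdim }.
Implicit Types r s : sqmx.

Definition is_rep r : Prop :=
  (exists r' : 'M[qalg G]_(sqdim r), r *m r' = 1%:M /\ r' *m r = 1%:M) /\
  forall i j, qdelta (r i j) = \sum_l qtimes (r i l) (r l j).

Definition rep_equiv r s : Prop :=
  exists (T : 'M[R[i]]_(sqdim r, sqdim s)) (T' : 'M[R[i]]_(sqdim s, sqdim r)),
    [/\ T *m T' = 1%:M, T' *m T = 1%:M & r *m scmx _ T = scmx _ T *m s].

(* There is no nontrivial invariant subspace.  A subspace V of C^k is given by
   an idempotent P with image V, and r maps V into V (x) G if and only if
   P r P = r P. *)
Definition rep_irreducible r : Prop :=
  [/\ is_rep r, (0 < sqdim r)%N &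
      forall P : 'M[R[i]]_(sqdim r), P *m P = P ->
        scmx _ P *m (r *m scmx _ P) = r *m scmx _ P -> P = 0 \/ P = 1%:M].

Definition rep_one : sqmx := Sqmx (1%:M : 'M[qalg G]_1).
Definition rep_fund : sqmx := Sqmx (qmx G).
Definition rep_bar r : sqmx := Sqmx (barmx r).
Definition rep_tensor r s : sqmx := Sqmx (r *t s).
Definition rep_add r s : sqmx := Sqmx (block_mx r 0 0 s).

Definition rep_sum (rs : seq sqmx) : sqmx :=
  foldr rep_add (Sqmx (0 : 'M[qalg G]_0)) rs.

End QuantumGroups.

Arguments coef_alg {R} _ _.

(* The free monoid N * N, as words in alpha = true and beta = false. *)
Notation NN := (seq bool).

Definition word_e : NN := [::].
Definition word_alpha : NN := [:: true].
Definition word_beta : NN := [:: false].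
Definition word_mul (x y : NN) : NN := x ++ y.
Definition word_bar (x : NN) : NN := rev (map negb x).

(* The triples ((a, b), g) with x = a g and y = \bar g b. *)
Definition fusion (x y : NN) : seq (NN * NN * NN) :=
  [seq t <- [seq (take i x, drop j y, drop i x)
               | i <- iota 0 (size x).+1, j <- iota 0 (size y).+1]
     | y == word_mul (word_bar t.2) t.1.2].

Lemma mem_fusion (x y a b g : NN) :
  ((a, b, g) \in fusion x y) =
  (x == word_mul a g) && (y == word_mul (word_bar g) b).
Proof.
rewrite mem_filter andbC.
have [yE|_] := eqVneq y (word_mul (word_bar g) b); last by rewrite !andbF.
rewrite !andbT; apply/allpairsP/eqP => [[[i j] [_ _ [-> _ ->]]]|xE].
  by rewrite /word_mul cat_take_drop.
exists (size a, size (word_bar g)); split.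
- by rewrite mem_iota xE /word_mul size_cat add0n ltnS; exact: leq_addr.
- by rewrite mem_iota {1}yE /word_mul size_cat add0n ltnS; exact: leq_addr.
- by rewrite xE {1}yE /word_mul take_size_cat // !drop_size_cat.
Qed.

Lemma fusion_uniq (x y : NN) : uniq (fusion x y).
Proof.
apply/filter_uniq/allpairs_uniq; try exact: iota_uniq.
move=> [i j] [i' j'] /allpairsP[[k l] [hk hl [-> ->]]].
move=> /allpairsP[[k' l'] [hk' hl' [-> ->]]] [/(congr1 size)].
move: hk hl hk' hl'; rewrite !mem_iota !add0n !ltnS /= => hk hl hk' hl'.
rewrite !size_takel // => -> /(congr1 size); rewrite !size_drop => E _.
by congr (_, _); rewrite -(subKn hl) E subKn.
Qed.

(* Main.v *)
Require Import Defs.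
From HB Require Import structures.
From mathcomp Require Import all_boot all_order all_algebra.
From mathcomp Require Import all_classical all_reals all_analysis.
From mathcomp Require Import complex mxtens.
From mathcomp Require Import ring lra.

(* A_u(F) is realized as Gfull itself, with generators v = Q u Q^-1 for which v
   and F \bar v F^-1 are unitary.

   Unitarization, without Haar state: for a vector state phi faithful on the
   finitely many elements involved, Y |-> phi(u^* Y u) has on 1 an orbit that is
   bounded above and below, because delta is a *-morphism into a spatial tensor
   product; averaging gives a positive definite B with phi(u^* B u) = B.  The
   fusion rule of \bar u (x) u (the trivial representation plus an irreducible
   one) then forces u^* B u = B.

   Universality: given w over a C*-algebra D satisfying the relations of A_u(F),
   one builds matrices over D, indexed by the words, obeying the same fusion
   rules with the same scalar intertwiners as the r_x.  The relations provide
   the duality morphisms of \bar u (x) u and u (x) \bar u, and by Frobenius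
   reciprocity these produce all the intertwiners needed for tensoring with a
   letter.  As the coefficients of the r_x are independent, the relation
   generated by the pairs (v_ij, w_ij) is the graph of a *-morphism on G_s, which
   extends to Gfull. *)

Set Implicit Arguments.
Unset Strict Implicit.
Unset Printing Implicit Defensive.

Import Order.TTheory GRing.Theory Num.Theory numFieldNormedType.Exports.

Local Open Scope ring_scope.

(** * C*-algebras and positivity *)

(** Positivity has two faces here. The algebraic one, a = s^* s, is transported by a *-morphism such
    as delta; the spatial one, <p(a) x, x> >= 0 for all x, is what can be checked after slicing
    delta by vectors. Each averaging step needs the way back from the second to the first, and this
    is why square roots are constructed in an algebra given by axioms only.

    Invariant complements are likewise found without an averaged inner product: in a direct sum of
    the given irreducible representations, an invariant subspace is split off by induction on the
    summands.

    Two invariant forms are needed, Q^* Q for u and Q2^* Q2 for \bar u, and F compares them: F = Q2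
    conj(Q)^-1.

    The full envelope is the natural target because the morphism v -> w is built on the coefficients
    in G_s with no norm estimate; the universal property of the envelope then extends it. *)

Section CstarTheory.
Variables (R : realType) (A : cstarType R).
Implicit Types (a b : A) (c : R[i]).

Lemma star_is_zmod_morphism : zmod_morphism (@star R A).
Proof. by move=> a b; rewrite starD -scaleN1r starZ rmorphN1 scaleN1r. Qed.
HB.instance Definition _ := GRing.isZmodMorphism.Build A A (@star R A) star_is_zmod_morphism.

Lemma star1 : star (1 : A) = 1.
Proof. by rewrite -[LHS]mulr1 -{2}(starK 1) -starM mulr1 starK. Qed.

Lemma normc_real (c : R[i]) : (Normc.normc c)%:C%C = `|c|.
Proof. by rewrite normc_def; case: c. Qed.

Lemma conj_real (t : R) : Num.conj (t%:C%C) = t%:C%C.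
Proof. exact: conjc_real. Qed.

Lemma cnorm0 : cnorm (0 : A) = 0.
Proof. by rewrite -(scale0r (0 : A)) cnormZ Normc.normc0 mul0r. Qed.

Lemma cnormN a : cnorm (- a) = cnorm a.
Proof. by rewrite -scaleN1r cnormZ normcN Normc.normc1 mul1r. Qed.

Lemma cnormB a b : cnorm (a - b) <= cnorm a + cnorm b.
Proof. by rewrite (le_trans (cnormD _ _)) // cnormN. Qed.

Lemma cnorm_ge0 a : 0 <= cnorm a.
Proof. by have := cnormB a a; rewrite subrr cnorm0; lra. Qed.

Lemma cnorm1 : cnorm (1 : A) = 1.
Proof.
have := cnorm_star (1 : A); rewrite star1 mulr1 expr2 => h.
have h1 : cnorm (1 : A) != 0.
  by apply/eqP => /cnorm0_eq0/eqP; rewrite oner_eq0.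
by apply: (mulIf h1); rewrite mul1r.
Qed.

Lemma cnormJ a : cnorm (star a) = cnorm a.
Proof.
have le1 b : cnorm b <= cnorm (star b).
  have := cnormM (star b) b; rewrite cnorm_star expr2.
  have := cnorm_ge0 b; rewrite le0r => /predU1P[->|b0]; first by rewrite cnorm_ge0.
  by rewrite ler_pM2r.
by apply/eqP; rewrite eq_le le1 -{2}(starK a) le1.
Qed.

Lemma cnormZr (t : R) a : 0 <= t -> cnorm (t%:C%C *: a) = t * cnorm a.
Proof.
move=> t0; rewrite cnormZ; congr (_ * _).
by apply: complexI; rewrite normc_real normc_def /= expr0n addr0 sqrtr_sqr ger0_norm.
Qed.

Lemma cnorm_small0 a : (forall e : R, 0 < e -> cnorm a <= e) -> a = 0.
Proof.
move=> h; apply: cnorm0_eq0; apply/eqP; rewrite eq_le cnorm_ge0 andbT.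
by apply/ler_addgt0Pr => e e0; rewrite add0r h.
Qed.

Section Sqrt.
Variable x : A.
Hypotheses (xs : star x = x) (x1 : cnorm x <= 1).

(** Iterating z -> (x + z^2)/2 from 0 aims at a solution of 2l = x + l^2, that is, (1 - l)^2 = 1 -
    x. The scalar sequence [t], the case x = 1, dominates the norms and the increments of [y]; being
    monotone and bounded by 1, it makes [y] a Cauchy sequence. *)
Let y n := iter n (fun z : A => (2^-1 : R)%:C%C *: (x + z * z)) 0.
Let t n : R := iter n (fun z : R => 2^-1 * (1 + z * z)) 0.

Let yS n : y n.+1 = (2^-1 : R)%:C%C *: (x + y n * y n). Proof. by []. Qed.
Let tS n : t n.+1 = 2^-1 * (1 + t n * t n). Proof. by []. Qed.

Let t_bound n : 0 <= t n <= 1.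
Proof. elim: n => [|n]; rewrite ?tS /t /= ?lexx ?ler01 //; nra. Qed.

Let t_mono n : t n <= t n.+1.
Proof. by have := t_bound n; rewrite tS; nra. Qed.

Let y_star n : star (y n) = y n.
Proof.
elim: n => [|n IH]; first by rewrite /y /= raddf0.
by rewrite yS starZ conj_real starD starM IH xs.
Qed.

Let y_comm b n : b * x = x * b -> b * y n = y n * b.
Proof.
move=> bx; elim: n => [|n IH]; first by rewrite /y /= mulr0 mul0r.
by rewrite yS -scalerAr -scalerAl mulrDr mulrDl bx mulrA IH -!mulrA IH.
Qed.

Let y_norm n : cnorm (y n) <= t n.
Proof.
elim: n => [|n IH]; first by rewrite /y /= cnorm0.
rewrite yS tS cnormZr ?invr_ge0 //; apply: ler_wpM2l; first by rewrite invr_ge0.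
apply: (le_trans (cnormD _ _)); apply: lerD => //.
by apply: (le_trans (cnormM _ _)); apply: ler_pM => //; exact: cnorm_ge0.
Qed.

Let y_step n : cnorm (y n.+1 - y n) <= t n.+1 - t n.
Proof.
elim: n => [|n IH].
  rewrite subr0 [t 0]/(0 : R) subr0; exact: y_norm.
have c1 : y n.+1 * y n = y n * y n.+1.
  by apply: y_comm; rewrite (@y_comm x).
have -> : y n.+2 - y n.+1 = (2^-1 : R)%:C%C *: ((y n.+1 + y n) * (y n.+1 - y n)).
  rewrite [y n.+2]yS [X in _ - X]yS -scalerBr; congr (_ *: _).
  by rewrite mulrDl !mulrBr c1 addrA addrNK opprD addrACA subrr add0r.
have -> : t n.+2 - t n.+1 = 2^-1 * ((t n.+1 + t n) * (t n.+1 - t n)).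
  rewrite [t n.+2]tS [X in _ - X]tS; ring.
rewrite cnormZr ?invr_ge0 //; apply: ler_wpM2l; first by rewrite invr_ge0.
apply: (le_trans (cnormM _ _)); apply: ler_pM => //; try exact: cnorm_ge0.
by apply: (le_trans (cnormD _ _)); apply: lerD.
Qed.

Let y_dist m n : (m <= n)%N -> cnorm (y n - y m) <= t n - t m.
Proof.
move=> /subnK <-; elim: (n - m)%N => [|k IH]; first by rewrite !subrr cnorm0.
rewrite addSn -(subrKA (y (k + m))) (le_trans (cnormD _ _)) //.
by apply: (le_trans (lerD (y_step _) IH)); rewrite addrA subrK.
Qed.

(** The last clause comes from the iterates being polynomials in x; in [rep_positive] it makes the
    roots commute with a. *)
Lemma sqrt_one_sub : exists l : A, [/\ star l = l, cnorm l <= 1,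
  (1 - l) * (1 - l) = 1 - x & forall b, b * x = x * b -> b * l = l * b].
Proof.
have tcv : cvgn t.
  apply: nondecreasing_is_cvgn; first by apply/nondecreasing_seqP.
  by exists 1 => _ [n _ <-]; have /andP[] := t_bound n.
have [|l yl] := @cnorm_complete R A y.
  move=> e e0; have e2 : 0 < e / 2 by rewrite divr_gt0.
  have /cvgrPdist_lt/(_ _ e2)[N _ hN] := tcv.
  exists N => m n Nm Nn; wlog mn : m n Nm Nn / (m <= n)%N.
    move=> h; have [/h|/ltnW/h] := leqP m n; first exact.
    by rewrite -cnormN opprB; apply.
  rewrite -cnormN opprB (le_lt_trans (y_dist mn)) //.
  have /= := hN _ Nm; have /= := hN _ Nn; rewrite !ltr_norml; lra.
have {}yl (e : R) : 0 < e -> exists2 N : nat, cnorm (y N - l) <= e & cnorm (y N.+1 - l) <= e.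
  move=> e0; have /cvgrPdist_lt/(_ _ e0)[N _ hN] := yl.
  have hN' n : (N <= n)%N -> cnorm (y n - l) <= e.
    by move=> /hN /=; rewrite sub0r normrN ger0_norm ?cnorm_ge0 // => /ltW.
  by exists N; apply: hN'; rewrite ?leqW.
have l1 : cnorm l <= 1.
  apply/ler_addgt0Pr => e /yl[N hN _]; rewrite -(subrK (y N) l) addrC.
  apply: (le_trans (cnormD _ _)); apply: lerD; last by rewrite -cnormN opprB.
  by apply: (le_trans (y_norm N)); have /andP[] := t_bound N.
have ls : star l = l.
  apply/eqP; rewrite -subr_eq0; apply/eqP/cnorm_small0 => e e0.
  have [|N hN _] := yl (e / 2); first by rewrite divr_gt0.
  have -> : star l - l = (y N - l) - star (y N - l).
    by rewrite raddfB /= y_star opprB [RHS]addrC subrKA.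
  by apply: (le_trans (cnormB _ _)); rewrite cnormJ; lra.
have lx : l - (2^-1 : R)%:C%C *: (x + l * l) = 0.
  apply: cnorm_small0 => e e0.
  have [|N hN hN'] := yl (e / 2); first by rewrite divr_gt0.
  have -> : l - (2^-1 : R)%:C%C *: (x + l * l) = - (y N.+1 - l) +
     (2^-1 : R)%:C%C *: (y N * (y N - l) + (y N - l) * l).
    rewrite mulrBr mulrBl subrKA opprB yS -addrA; congr (_ + _).
    by rewrite -!scalerN -scalerDr !opprD subrKA.
  apply: (le_trans (cnormD _ _)); rewrite cnormN.
  rewrite cnormZr ?invr_ge0 //.
  have y1 := le_trans (y_norm N) (proj2 (andP (t_bound N))).
  have h1 := le_trans (cnormM (y N) (y N - l))
    (ler_pM (cnorm_ge0 _) (cnorm_ge0 _) y1 hN).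
  have h2 := le_trans (cnormM (y N - l) l) (ler_pM (cnorm_ge0 _) (cnorm_ge0 _) hN l1).
  have h3 := cnormD (y N * (y N - l)) ((y N - l) * l).
  lra.
exists l; split => //.
  have h : l + l = x + l * l.
    move/eqP: lx; rewrite subr_eq0 => /eqP {1 2}->.
    rewrite -scalerDl -[X in _ = X]scale1r; congr (_ *: _).
    by rewrite -raddfD /= -[X in X + X]mul1r -splitr.
  have -> : x = l + l - l * l by rewrite h addrK.
  by rewrite mulrBl mul1r mulrBr mulr1 !opprB opprD -addrA; congr (1 + _); rewrite addrCA.
move=> b bx; apply/eqP; rewrite -subr_eq0; apply/eqP/cnorm_small0 => e e0.
have b0 := cnorm_ge0 b.
have [|N hN _] := yl (e / (2 * (cnorm b + 1))); first by rewrite divr_gt0 // mulr_gt0 // ltr_pwDr.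
have -> : b * l - l * b = (y N - l) * b - b * (y N - l).
  by rewrite mulrBl mulrBr y_comm // opprB [RHS]addrC subrKA.
apply: (le_trans (cnormB _ _)).
have h1 := cnormM (y N - l) b; have h2 := cnormM b (y N - l).
have h3 : cnorm (y N - l) * (2 * (cnorm b + 1)) <= e.
  by rewrite -ler_pdivlMr // mulr_gt0 // ltr_pwDr.
have := cnorm_ge0 (y N - l); nra.
Qed.
End Sqrt.
End CstarTheory.

(** * Inner products and polarization *)

Section HilbertTheory.
Variables (R : realType) (H : hilbertType R).
Implicit Types (x y z : H) (c : R[i]).

Lemma ipDl x y z : ip (x + y) z = ip x z + ip y z.
Proof. by rewrite -[x in LHS]scale1r ip_linearl mul1r. Qed.

Lemma ip0l z : ip 0 z = 0.
Proof. by apply: (addrI (ip 0 z)); rewrite -ipDl !addr0. Qed.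

Lemma ipZl c x z : ip (c *: x) z = c * ip x z.
Proof. by rewrite -[c *: x]addr0 ip_linearl ip0l addr0. Qed.

Lemma ip_suml I (r : seq I) (P : pred I) (F : I -> H) z :
  ip (\sum_(i <- r | P i) F i) z = \sum_(i <- r | P i) ip (F i) z.
Proof. by apply: (big_morph (fun x => ip x z)) => [x y|]; rewrite ?ipDl ?ip0l. Qed.

Lemma ip_sumr I (r : seq I) (P : pred I) (F : I -> H) z :
  ip z (\sum_(i <- r | P i) F i) = \sum_(i <- r | P i) ip z (F i).
Proof.
by rewrite ip_conj ip_suml rmorph_sum; apply: eq_bigr => i _; rewrite [RHS]ip_conj.
Qed.

Lemma ipDr x y z : ip z (x + y) = ip z x + ip z y.
Proof. by rewrite [ip z x]ip_conj [ip z y]ip_conj ip_conj ipDl rmorphD. Qed.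

Lemma ipZr c x z : ip z (c *: x) = Num.conj c * ip z x.
Proof. by rewrite [ip z x]ip_conj ip_conj ipZl rmorphM. Qed.

Lemma ipNl x z : ip (- x) z = - ip x z.
Proof. by rewrite -scaleN1r ipZl mulN1r. Qed.

Lemma ipBl x y z : ip (x - y) z = ip x z - ip y z.
Proof. by rewrite ipDl ipNl. Qed.

Lemma ipBr x y z : ip z (x - y) = ip z x - ip z y.
Proof. by rewrite -scaleN1r ipDr ipZr rmorphN1 mulN1r. Qed.

Lemma ip_ge0 x : 0 <= ip x x.
Proof. by rewrite ip_norm exprn_ge0. Qed.

Lemma ip_eq0 x : ip x x = 0 -> x = 0.
Proof. by rewrite ip_norm => /eqP; rewrite expf_eq0 /= normr_eq0 => /eqP. Qed.

Lemma ip_sep x y : (forall z, ip x z = ip y z) -> x = y.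
Proof.
move=> h; apply/eqP; rewrite -subr_eq0; apply/eqP/ip_eq0.
by rewrite ipBl h subrr.
Qed.

(** Polarization, special to complex scalars: the values c = 1 and c = i in the expansion at c x + y
    isolate <T x, y>. *)
Lemma quad_eq0 (T : H -> H) :
  (forall c x y, T (c *: x + y) = c *: T x + T y) ->
  (forall x, ip (T x) x = 0) -> forall x, T x = 0.
Proof.
move=> Tl T0 x; apply: ip_eq0.
have hp c y z : c * ip (T y) z + Num.conj c * ip (T z) y = 0.
  have := T0 (c *: y + z).
  by rewrite Tl ipDl !ipDr !ipZl !ipZr T0 mulr0 mulr0 add0r T0 addr0.
have h1 := hp 1 x (T x); have h2 := hp 'i x (T x).
rewrite rmorph1 !mul1r in h1; rewrite conjCi mulNr -mulrBr in h2.
move/eqP: h2; rewrite mulf_eq0 (negPf (neq0Ci _)) /= subr_eq0 => /eqP h2.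
move/eqP: h1; rewrite -h2 -mulr2n mulrn_eq0 /= => /eqP; exact.
Qed.
End HilbertTheory.

(** * Faithful representations and positive elements *)

Section FaithfulRep.
Variables (R : realType) (A : cstarType R) (H : hilbertType R) (p : A -> H -> H).
Hypothesis pf : faithful_rep p.
Implicit Types (a b : A) (x y : H) (c : R[i]).

Lemma rep_linv a c x y : p a (c *: x + y) = c *: p a x + p a y.
Proof. by case: pf => [[h _] _ _]; apply: h. Qed.

Lemma rep_bound a : exists M : R[i], forall x, `|p a x| <= M * `|x|.
Proof. by case: pf => [[_ h] _ _]; apply: h. Qed.

Lemma rep1 x : p 1 x = x.
Proof. by case: pf => [_ [h _ _ _] _]; apply: h. Qed.

Lemma rep_lin c a b x : p (c *: a + b) x = c *: p a x + p b x.
Proof. by case: pf => [_ [_ h _ _] _]; apply: h. Qed.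

Lemma repM a b x : p (a * b) x = p a (p b x).
Proof. by case: pf => [_ [_ _ h _] _]; apply: h. Qed.

Lemma rep_star a x y : ip (p a x) y = ip x (p (star a) y).
Proof. by case: pf => [_ [_ _ _ h] _]; apply: h. Qed.

Lemma rep_inj a b : (forall x, p a x = p b x) -> a = b.
Proof.
move=> h; apply/eqP; rewrite -subr_eq0; apply/eqP.
have [_ _] := pf; apply=> x.
by rewrite -scaleN1r addrC rep_lin h scaleN1r addNr.
Qed.

Lemma repD a b x : p (a + b) x = p a x + p b x.
Proof. by rewrite -[a in LHS]scale1r rep_lin scale1r. Qed.

Lemma rep0 x : p 0 x = 0.
Proof. by apply: (addrI (p 0 x)); rewrite -repD !addr0. Qed.

Lemma repZ c a x : p (c *: a) x = c *: p a x.
Proof. by rewrite -[c *: a]addr0 rep_lin rep0 addr0. Qed.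

Lemma repN a x : p (- a) x = - p a x.
Proof. by rewrite -scaleN1r repZ scaleN1r. Qed.

Lemma rep_bigsum I (r : seq I) (P : pred I) (F : I -> A) x :
  p (\sum_(i <- r | P i) F i) x = \sum_(i <- r | P i) p (F i) x.
Proof. by apply: (big_morph (fun a => p a x)) => [a b|]; rewrite ?repD ?rep0. Qed.

Lemma repDv a x y : p a (x + y) = p a x + p a y.
Proof. by rewrite -[x in LHS]scale1r rep_linv scale1r. Qed.

Lemma rep0v a : p a 0 = 0.
Proof. by apply: (addrI (p a 0)); rewrite -repDv !addr0. Qed.

Lemma repZv c a x : p a (c *: x) = c *: p a x.
Proof. by rewrite -[c *: x]addr0 rep_linv rep0v addr0. Qed.

(** The algebraic form is chosen because every *-morphism preserves it. *)
Definition positive a := exists s : A, a = star s * s.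

Lemma positive_rep a : positive a -> forall x, 0 <= ip (p a x) x.
Proof.
by move=> [s ->] x; rewrite repM rep_star starK ip_ge0.
Qed.

Lemma rep_selfadjoint a : (forall x, 0 <= ip (p a x) x) -> star a = a.
Proof.
move=> a0; apply: rep_inj => x; apply/eqP; rewrite -subr_eq0; apply/eqP.
rewrite -repN -repD; move: x.
apply: quad_eq0 => [c x y|x]; first exact: rep_linv.
rewrite repD repN ipBl rep_star starK.
have /ger0_real/CrealP := a0 x.
by rewrite -[in X in X -> _]ip_conj => ->; rewrite subrr.
Qed.

(* The negative part n/2 of a is annihilated: with m = |a| = s s one has
   n a n = - n m n, so positivity of p a forces s n = 0. *)
Lemma rep_positive a : (forall x, 0 <= ip (p a x) x) -> positive a.
Proof.
(* [sqrt_one_sub] requires norm at most 1; the general case follows by rescaling. *)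
have half : forall a, cnorm a <= 1 -> (forall x, 0 <= ip (p a x) x) -> positive a.
  move=> {}a a1 a0; have sa := rep_selfadjoint a0.
  have saa : star (a * a) = a * a by rewrite starM sa.
  have aa1 : cnorm (a * a) <= 1.
    by rewrite (le_trans (cnormM _ _)) // -[leRHS]mulr1 ler_pM ?cnorm_ge0.
  have [y [sy y1 y2 yc]] := sqrt_one_sub saa aa1.
  set b := 1 - y in y2.
  have sb : star b = b by rewrite raddfB /= star1 sy.
  have ab : a * b = b * a by rewrite mulrBr mulrBl mulr1 mul1r yc ?mulrA.
  (* With b^2 = 1 - a^2, the element c = a + i b satisfies c^* c = 1. Hence its imaginary part b has
     norm at most 1, and so has 1 - a^2 = b^2. This replaces spectral theory in justifying the next
     square root. *)
  pose c := a + 'i *: b.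
  have sc : star c = a - 'i *: b.
    by rewrite raddfD /= starZ sa sb conjCi scaleNr.
  have cc : star c * c = 1.
    rewrite sc mulrDr !mulrBl -!scalerAl -!scalerAr scalerA -['i * 'i]expr2 sqrCi ab.
    by rewrite scaleN1r opprK subrKA y2 addrC subrK.
  have c1 : cnorm c <= 1.
    have := cnorm_star c; rewrite cc cnorm1 => h.
    by rewrite -(ler_pXn2r (n := 2)) ?nnegrE ?cnorm_ge0 // -h expr1n.
  have b1 : cnorm b <= 1.
    have -> : b = - ((2^-1 : R)%:C%C *: ('i *: (c - star c))).
      have -> : c - star c = ('i + 'i) *: b.
        by rewrite sc opprB /c addrC addrA subrK scalerDl.
      rewrite !scalerA -scaleNr -[LHS]scale1r; congr (_ *: _).
      rewrite mulrDr -mulrA -expr2 sqrCi mulrN1 -opprD opprK.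
      by apply/eqP; rewrite eq_complex /= ; apply/andP; split; apply/eqP; field.
    have e0 : 0 <= 2^-1 :> R by rewrite invr_ge0.
    rewrite cnormN cnormZr // cnormZ.
    have -> : Normc.normc ('i : R[i]) = 1.
      by apply: complexI; rewrite normc_real normCi.
    have := cnormB c (star c); rewrite cnormJ; lra.
  have b2 : cnorm (1 - a * a) <= 1.
    rewrite -y2 -{1}sb cnorm_star -[leRHS](expr1n _ 2).
    by rewrite ler_pXn2r ?nnegrE ?cnorm_ge0.
  have s2 : star (1 - a * a) = 1 - a * a by rewrite raddfB /= star1 saa.
  (* The square root of 1 - (1 - a^2) is m = |a|; as m is again of the form 1 - y' with y' of norm
     at most 1, it has a square root s. *)
  have [y' [sy' y1' y2' yc']] := sqrt_one_sub s2 b2.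
  have [y'' [sy'' y1'' y2'' yc'']] := sqrt_one_sub sy' y1'.
  set m := 1 - y' in y2' y2''; set s := 1 - y'' in y2''.
  have sm : star m = m by rewrite raddfB /= star1 sy'.
  have ss : star s = s by rewrite raddfB /= star1 sy''.
  have ay' : a * y' = y' * a by apply: yc'; rewrite mulrBr mulrBl mulr1 mul1r mulrA.
  have am : a * m = m * a by rewrite mulrBr mulrBl mulr1 mul1r ay'.
  rewrite subKr in y2'.
  pose n := m - a.
  have sn : star n = n by rewrite raddfB /= sm sa.
  have an : a * n = - (m * n) by rewrite /n [a * _]mulrBr [m * (_ - a)]mulrBr y2' opprB am.
  have sn0 : s * n = 0.
    apply: rep_inj => x; rewrite rep0; apply: ip_eq0.
    apply/eqP; rewrite eq_le ip_ge0 andbT.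
    have := a0 (p n x); rewrite -repM an repN ipNl oppr_ge0.
    by rewrite -y2'' -mulrA (repM s) rep_star ss -repM.
  have mn : m * n = 0 by rewrite -y2'' -mulrA sn0 mulr0.
  have n0 : n = 0.
    apply: cnorm0_eq0; apply/eqP; rewrite -[_ == 0]/(true && _) -[true]/(0 < 2)%N.
    rewrite -expf_eq0 -cnorm_star sn.
    by rewrite {1}/n [(m - a) * n]mulrBl an mn !oppr0 addr0 cnorm0.
  exists s; rewrite ss y2''; apply/eqP.
  by rewrite eq_sym -subr_eq0 -/n n0.
move=> a0; pose k := (cnorm a + 1)^-1.
have k0 : 0 < k by rewrite invr_gt0 ltr_wpDl ?cnorm_ge0.
have kC : 0 <= k%:C%C by rewrite lecR ltW.
have [||s hs] := half (k%:C%C *: a).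
- rewrite (cnormZr _ (ltW k0)) /k ler_pdivrMl ?mulr1 ?lerDl //.
  by rewrite ltr_wpDl ?cnorm_ge0.
- by move=> x; rewrite repZ ipZl mulr_ge0.
pose q := Num.sqrt (k^-1); exists (q%:C%C *: s).
rewrite starZ conj_real -scalerAl -scalerAr -hs !scalerA.
rewrite -!rmorphM /= -expr2 sqr_sqrtr; last by rewrite invr_ge0 (ltW k0).
by rewrite mulVf ?gt_eqF // scale1r.
Qed.
End FaithfulRep.

(** * Bounded orbits and fixed points *)

Section Averaging.
Variable R : realType.
Local Notation C := R[i].

Lemma natmul_bounded_eq0 (w K : C) : (forall k, k%:R * `|w| <= K) -> w = 0.
Proof.
move=> h; apply/eqP; apply: contraT => w0.
have K0 : 0 <= K by have := h 0%N; rewrite mul0r.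
have KE : K = (complex.Re K)%:C%C.
  by move: K0; case: (K) => a b; rewrite lecE /= => /andP[/eqP -> _].
have a0 : 0 < Normc.normc w by rewrite -ltcR normc_real normr_gt0.
have ub k : k%:R * Normc.normc w <= complex.Re K.
  by rewrite -lecR rmorphM /= normc_real -KE rmorph_nat.
have K1 : 0 <= complex.Re K / Normc.normc w.
  by rewrite divr_ge0 ?(ltW a0) // -lecR -KE.
have := truncnS_gt (complex.Re K / Normc.normc w).
by rewrite ltr_pdivrMr // ltNge ub.
Qed.

Lemma norm_real (t : R) : `|t%:C%C| = `|t|%:C%C.
Proof. by rewrite normc_def /= expr0n addr0 sqrtr_sqr. Qed.

(** A limit-free form of the Cesaro argument: dividing by N, d is a nonnegative number up to an
    error K/N. The order on C also demands that d be real, so the imaginary and real parts are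
    treated in turn. *)
Lemma natmul_nonneg_bounded (d K : C) :
  (forall N, exists p e, [/\ N%:R * d = p + e, 0 <= p & `|e| <= K]) -> 0 <= d.
Proof.
move=> h.
have ImM N (z : C) : complex.Im (N%:R * z) = N%:R * complex.Im z.
  by rewrite !mulr_natl raddfMn.
have ReM N (z : C) : complex.Re (N%:R * z) = N%:R * complex.Re z.
  by rewrite !mulr_natl raddfMn.
have im0 : (complex.Im d)%:C%C = 0 :> C.
  apply: (@natmul_bounded_eq0 _ K) => N; have [p [e [Ne p0 eK]]] := h N.
  apply: le_trans eK; have := congr1 (@complex.Im R) Ne.
  have -> : complex.Im (p + e) = complex.Im e.
    by move: p0; rewrite lecE raddfD /= => /andP[/eqP -> _]; rewrite add0r.
  rewrite ImM norm_real => hN.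
  rewrite -(rmorph_nat (real_complex R)) -rmorphM /= normc_def lecR.
  rewrite -[N%:R]normr_nat -normrM hN -sqrtr_sqr.
  by rewrite ler_wsqrtr // lerDr sqr_ge0.
suff : 0 <= complex.Re d by case: d im0 {h} => d1 d2 [/= ->]; rewrite lecR.
rewrite leNgt; apply/negP => d0.
suff /eqP : (complex.Re d)%:C%C = 0 :> C.
  by rewrite eq_complex /= (lt_eqF d0).
apply: (@natmul_bounded_eq0 _ K) => N; have [p [e [Ne p0 eK]]] := h N.
apply: le_trans eK; have := congr1 (@complex.Re R) Ne; rewrite raddfD /= ReM => hN.
apply: le_trans (normc_ge_Re e).
rewrite norm_real -(rmorph_nat (real_complex R)) -rmorphM lecR.
have p1 : 0 <= complex.Re p by move: p0; rewrite lecE => /andP[].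
by rewrite ltr0_norm // mulrN; have := ler_norm (- complex.Re e); rewrite normrN; lra.
Qed.

Section Ergodic.
Variables (N : nat) (M : 'M[C]_N.+1) (I : Type) (f : I -> 'cV[C]_N.+1).
Hypothesis sep : forall z : 'rV[C]_N.+1, (forall i, z *m f i = 0) -> z = 0.
Variables (y : 'rV[C]_N.+1) (lo hi : I -> C).
Hypothesis y_bound : forall k i, lo i <= (y *m M ^+ k *m f i) 0 0 <= hi i.

(** Boundedness is tested against the functionals [f i] only, with a bound depending on i. *)
Let bounded (z : 'rV[C]_N.+1) := forall i, exists K : C, forall k,
  `|(z *m M ^+ k *m f i) 0 0| <= K.

Let y_bounded : bounded y.
Proof.
move=> i; exists (`|lo i| + `|hi i - lo i|) => k.
have /andP[h1 h2] := y_bound k i; rewrite -[X in `|X|](subrK (lo i)) addrC.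
apply: (le_trans (ler_normD _ _)); rewrite lerD2l.
rewrite !ger0_norm ?subr_ge0 // ?lerB //; exact: le_trans h2.
Qed.

Let bounded_poly z (p : {poly C}) : bounded z -> bounded (z *m horner_mx M p).
Proof.
move=> bz; elim/poly_ind: p => [|p c IH] i.
  by exists 0 => k; rewrite rmorph0 mulmx0 !mul0mx mxE normr0.
have [K1 h1] := IH i; have [K2 h2] := bz i.
exists (K1 + `|c| * K2) => k.
rewrite rmorphD rmorphM /= horner_mx_X horner_mx_C -mulmxE.
rewrite mulmxDr !mulmxDl mxE; apply: (le_trans (ler_normD _ _)); apply: lerD.
  by rewrite -[M in X in X <= _](expr1) !mulmxA -(mulmxA _ (M ^+ 1)) mulmxE -exprD.
by rewrite mul_mx_scalar -!scalemxAl mxE normrM ler_wpM2l.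
Qed.

(** A bounded orbit excludes a Jordan block at the eigenvalue 1: on a block of size two the orbit is
    z + k z (M - 1), which grows linearly in k. *)
Let nilpotent_fixed m z : bounded z -> z *m (M - 1) ^+ m.+1 = 0 -> z *m (M - 1) = 0.
Proof.
elim: m z => [|m IH] z bz; first by rewrite expr1.
rewrite exprS -mulmxE mulmxA => /IH h.
have bz' : bounded (z *m (M - 1)).
  have := bounded_poly ('X - 1) bz.
  by rewrite rmorphB rmorph1 /= horner_mx_X.
have {h}h : z *m (M - 1) *m M = z *m (M - 1).
  by have := h bz'; rewrite mulmxBr mulmx1 => /eqP; rewrite subr_eq0 => /eqP.
have zk k : z *m M ^+ k = z + k%:R *: (z *m (M - 1)).
  elim: k => [|k IHk]; first by rewrite expr0 mulmx1 scale0r addr0.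
  rewrite exprSr -mulmxE mulmxA IHk mulmxDl -scalemxAl h -natr1 scalerDl scale1r.
  have -> : z *m M = z + z *m (M - 1) by rewrite mulmxBr mulmx1 addrC subrK.
  by rewrite -addrA [z *m (M - 1) + _]addrC.
apply: sep => i; have [K hK] := bz i.
apply/matrixP => a b; rewrite !ord1 [RHS]mxE.
apply: (@natmul_bounded_eq0 _ (K + `|(z *m f i) 0 0|)) => k.
have -> : k%:R * `|(z *m (M - 1) *m f i) 0 0| =
          `|(z *m M ^+ k *m f i) 0 0 - (z *m f i) 0 0|.
  rewrite zk mulmxDl.
  have -> A B : (A + B : 'M[C]_1) 0 0 = A 0 0 + B 0 0 by rewrite mxE.
  rewrite [X in _ = `|X - _|]addrC addrK -scalemxAl.
  have -> t A : (t *: A : 'M[C]_1) 0 0 = t * A 0 0 by rewrite mxE.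
  by rewrite normrM normr_nat.
by apply: (le_trans (ler_normB _ _)); rewrite lerD2r.
Qed.

(* Splitting off the eigenvalue 1 in the characteristic polynomial gives
   y = b - z (M - 1) with b fixed by M; the Cesaro means of the orbit of y
   converge to b, which keeps the lower bounds. *)
Lemma fixed_point_of_bounded_orbit_subproof : exists b : 'rV[C]_N.+1,
  b *m M = b /\ forall i, lo i <= (b *m f i) 0 0.
Proof.
have [m [nu]] := multiplicity_XsubC (char_poly M) 1.
rewrite monic_neq0 ?char_poly_monic //= => nu1 chE.
pose c := nu.[1]; have c0 : c != 0 by [].
(* Since nu - nu(1) is divisible by X - 1, y nu(M) = nu(1) y + y eta(M) (M - 1); dividing by nu(1),
   which is nonzero, gives the splitting of y. *)
have [eta etaE] : exists eta, nu - c%:P = eta * ('X - 1%:P).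
  by apply/factor_theorem; rewrite rootE !hornerE subrr.
pose b0 := y *m horner_mx M nu; pose b := c^-1 *: b0.
pose z := c^-1 *: (y *m horner_mx M eta).
have b0M : b0 *m (M - 1) = 0.
  (* By Cayley-Hamilton, (M - 1)^m already kills b0; one more factor gives the positive exponent
     wanted here, also when m = 0. *)
  apply: (nilpotent_fixed (m := m)); first exact: bounded_poly.
  apply/eqP; rewrite exprSr -mulmxE mulmxA; apply/eqP.
  suff -> : b0 *m (M - 1) ^+ m = 0 by rewrite mul0mx.
  rewrite /b0 -mulmxA -[RHS](mulmx0 _ y) -[in RHS](Cayley_Hamilton M) chE.
  by rewrite rmorphM rmorphXn rmorphB /= horner_mx_X horner_mx_C.
have yE : y = b - z *m (M - 1).
  have /(congr1 (fun p => y *m horner_mx M p)) := etaE.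
  rewrite rmorphB rmorphM rmorphB /= horner_mx_X !horner_mx_C -mulmxE.
  rewrite mulmxBr mul_mx_scalar mulmxA -/b0 => h.
  by rewrite /b /z -scalemxAl -h scalerBr subKr scalerA mulVf // scale1r.
have bM : b *m M = b.
  by apply/eqP; rewrite -scalemxAl -subr_eq0 -scalerBr -{2}[b0]mulmx1 -mulmxBr b0M scaler0.
exists b; split=> // i.
have [K hK] : exists K : C, forall k, `|(z *m M ^+ k *m f i) 0 0| <= K.
  have [K hK] := bounded_poly eta y_bounded i; exists (`|c^-1| * K) => k.
  by rewrite -!scalemxAl mxE normrM ler_wpM2l.
rewrite -subr_ge0; apply: (@natmul_nonneg_bounded _ (K + K)) => n.
(* Telescoping along the orbit: up to pairing with [f i], n (b - lo) is the sum of the nonnegative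
   terms y M^k - lo plus the bounded boundary term z M^n - z. *)
exists (\sum_(k < n) ((y *m M ^+ k *m f i) 0 0 - lo i)).
exists ((z *m M ^+ n *m f i) 0 0 - (z *m M ^+ 0 *m f i) 0 0); split.
- elim: n => [|n IH]; first by rewrite big_ord0 subrr addr0 mul0r.
  rewrite big_ord_recr /= -natr1 mulrDl mul1r IH.
  have -> : y *m M ^+ n = b - z *m M ^+ n.+1 + z *m M ^+ n.
    have bn : b *m M ^+ n = b.
      elim: (n) => [|j IHj]; first by rewrite expr0 mulmx1.
      by rewrite exprS -mulmxE mulmxA bM.
    rewrite yE mulmxBl bn mulmxBr mulmx1 mulmxBl -mulmxA mulmxE -exprS.
    by rewrite opprB addrA addrAC.
  rewrite !mulmxDl mulNmx.
  have -> A B : (A + B : 'M[C]_1) 0 0 = A 0 0 + B 0 0 by rewrite mxE.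
  have -> A B : (A + B : 'M[C]_1) 0 0 = A 0 0 + B 0 0 by rewrite mxE.
  have -> A : (- A : 'M[C]_1) 0 0 = - A 0 0 by rewrite mxE.
  ring.
- by apply: sumr_ge0 => k _; rewrite subr_ge0; case/andP: (y_bound k i).
- by apply: (le_trans (ler_normB _ _)); apply: lerD.
Qed.
End Ergodic.

Lemma fixed_point_of_bounded_orbit N (M : 'M[C]_N) I (f : I -> 'cV[C]_N)
    (y : 'rV[C]_N) (lo hi : I -> C) :
  (forall z : 'rV[C]_N, (forall i, z *m f i = 0) -> z = 0) ->
  (forall k i, lo i <= (y *m M ^+ k *m f i) 0 0 <= hi i) ->
  exists b : 'rV[C]_N, b *m M = b /\ forall i, lo i <= (b *m f i) 0 0.
Proof.
case: N M f y => [|N] M f y sep h; last exact: fixed_point_of_bounded_orbit_subproof h.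
exists y; split=> [|i]; first by rewrite [LHS]thinmx0 [RHS]thinmx0.
by have /andP[+ _] := h 0%N i; rewrite expr0 mulmx1.
Qed.
End Averaging.

(** * Scalar matrices inside matrices over the algebra *)

Section ScalarMatrices.
Variables (R : realType) (A : cstarType R).
Local Notation C := R[i].

Definition adjmx m n (M : 'M[C]_(m, n)) : 'M[C]_(n, m) := (map_mx Num.conj M)^T.
Definition dagmx m n (w : 'M[A]_(m, n)) : 'M[A]_(n, m) := (map_mx star w)^T.

Lemma adjmxM m n k (M : 'M[C]_(m, n)) (N : 'M[C]_(n, k)) :
  adjmx (M *m N) = adjmx N *m adjmx M.
Proof. by rewrite /adjmx map_mxM trmx_mul. Qed.

Lemma adjmxK m n (M : 'M[C]_(m, n)) : adjmx (adjmx M) = M.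
Proof. by apply/matrixP=> i j; rewrite !mxE conjCK. Qed.

Lemma adjmxD m n (M N : 'M[C]_(m, n)) : adjmx (M + N) = adjmx M + adjmx N.
Proof. by rewrite /adjmx map_mxD linearD. Qed.

Lemma adjmxZ m n c (M : 'M[C]_(m, n)) : adjmx (c *: M) = Num.conj c *: adjmx M.
Proof. by rewrite /adjmx map_mxZ linearZ. Qed.

Lemma adjmx1 n : adjmx (1%:M : 'M[C]_n) = 1%:M.
Proof. by rewrite /adjmx map_mx1 trmx1. Qed.

Lemma dagmxM m n k (M : 'M[A]_(m, n)) (N : 'M[A]_(n, k)) :
  dagmx (M *m N) = dagmx N *m dagmx M.
Proof.
apply/matrixP=> i j; rewrite !mxE raddf_sum; apply: eq_bigr => l _.
by rewrite !mxE /= starM.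
Qed.

Lemma dagmxB m n (M N : 'M[A]_(m, n)) : dagmx (M - N) = dagmx M - dagmx N.
Proof. by apply/matrixP=> i j; rewrite !mxE raddfB. Qed.

Lemma dagmx_sc m n (M : 'M[C]_(m, n)) : dagmx (scmx A M) = scmx A (adjmx M).
Proof. by apply/matrixP=> i j; rewrite !mxE /= starZ star1. Qed.

Lemma scmxM m n k (M : 'M[C]_(m, n)) (N : 'M[C]_(n, k)) :
  scmx A (M *m N) = scmx A M *m scmx A N.
Proof. exact: map_mxM. Qed.

Lemma scmx1 n : scmx A (1%:M : 'M[C]_n) = 1%:M.
Proof. exact: map_mx1. Qed.

Lemma scmx0 m n : scmx A (0 : 'M[C]_(m, n)) = 0.
Proof. exact: map_mx0. Qed.

Lemma scmxD m n (M N : 'M[C]_(m, n)) : scmx A (M + N) = scmx A M + scmx A N.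
Proof. exact: map_mxD. Qed.

Lemma scmxB m n (M N : 'M[C]_(m, n)) : scmx A (M - N) = scmx A M - scmx A N.
Proof. exact: map_mxB. Qed.

Lemma scmx_inj m n : injective (@scmx R A m n).
Proof.
move=> M N /matrixP h; apply/matrixP => i j; have := h i j.
rewrite !mxE => /eqP; rewrite -subr_eq0 -scalerBl scaler_eq0 oner_eq0 orbF.
by rewrite subr_eq0 => /eqP.
Qed.
End ScalarMatrices.

(** * Hermitian forms *)

Section QuadraticForms.
Variable R : realType.
Local Notation C := R[i].

Lemma adj_quad_eq0 n (Z : 'M[C]_n) :
  (forall v : 'cV_n, adjmx v *m Z *m v = 0) -> Z = 0.
Proof.
move=> Z0.
have hp c (v w : 'cV_n) :
    Num.conj c *: (adjmx v *m Z *m w) + c *: (adjmx w *m Z *m v) = 0.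
  have := Z0 (c *: v + w).
  rewrite adjmxD adjmxZ !mulmxDl !mulmxDr -!scalemxAl -!scalemxAr.
  by rewrite !Z0 !scaler0 add0r addr0.
apply/matrixP => i j; rewrite mxE.
pose v : 'cV[C]_n := delta_mx i 0; pose w : 'cV[C]_n := delta_mx j 0.
have h1 := hp 1 v w; have h2 := hp 'i v w.
rewrite rmorph1 !scale1r in h1.
have {}h2 : adjmx w *m Z *m v = adjmx v *m Z *m w.
  move/eqP: h2; rewrite conjCi scaleNr addrC -scalerBr scaler_eq0 (negPf (neq0Ci _)) /=.
  by rewrite subr_eq0 => /eqP.
have /matrixP/(_ 0 0) : adjmx v *m Z *m w = 0.
  by move/eqP: h1; rewrite h2 -mulr2n -scaler_nat scaler_eq0 pnatr_eq0 => /eqP.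
have -> : adjmx v = delta_mx 0 i.
  by rewrite /adjmx /v map_delta_mx trmx_delta.
by rewrite -rowE -colE !mxE.
Qed.

(** A form with real values is Hermitian by polarization; it is diagonalized, and the square roots
    of its eigenvalues are absorbed into Q. *)
Lemma posdef_factor n (B : 'M[C]_n) :
  (forall v : 'cV_n, v != 0 -> 0 < (adjmx v *m B *m v) 0 0) ->
  exists2 Q : 'M[C]_n, Q \in unitmx & B = adjmx Q *m Q.
Proof.
move=> Bpos.
have Bherm : adjmx B = B.
  apply/eqP; rewrite -subr_eq0; apply/eqP/adj_quad_eq0 => v.
  have [->|v0] := eqVneq v 0; first by rewrite mulmx0.
  have qE : adjmx v *m adjmx B *m v = adjmx (adjmx v *m B *m v).
    by rewrite !adjmxM adjmxK mulmxA.
  have /ltW/ger0_real/CrealP q0 := Bpos _ v0.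
  rewrite mulmxBr mulmxBl qE; apply/eqP; rewrite subr_eq0; apply/eqP/matrixP => i j.
  by rewrite !ord1 [LHS]mxE [LHS]mxE q0.
have Bn : B \is normalmx.
  apply/normalmxP.
  by rewrite (_ : map_mx _ _ = B) // -[RHS]Bherm /adjmx map_trmx.
have /orthomx_spectralP BE := Bn.
set P := spectralmx B in BE; set sp := spectral_diag B in BE.
have Pu : P \in unitmx := spectral_unit B.
have Pinv : invmx P = adjmx P.
  by rewrite invmx_unitary ?spectral_unitarymx // /adjmx map_trmx.
have sp0 i : 0 < sp 0 i.
  pose v : 'cV[C]_n := invmx P *m delta_mx i 0.
  have v0 : v != 0.
    apply/eqP => /(congr1 (mulmx P)); rewrite mulKVmx // mulmx0.
    by move/matrixP/(_ i 0); rewrite !mxE !eqxx => /eqP; rewrite oner_eq0.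
  have := Bpos v v0.
  rewrite /v adjmxM Pinv adjmxK -Pinv {1}BE !mulmxA !(mulmxK Pu).
  have -> : adjmx (delta_mx i 0 : 'cV[C]_n) = delta_mx 0 i.
    by rewrite /adjmx map_delta_mx trmx_delta.
  by rewrite -rowE -colE !mxE eqxx.
pose d : 'rV[C]_n := map_mx sqrtC sp.
exists (diag_mx d *m P).
  rewrite unitmx_mul Pu andbT unitmxE det_diag unitfE.
  by apply/prodf_neq0 => i _; rewrite mxE sqrtC_eq0 gt_eqF.
rewrite adjmxM mulmxA -(mulmxA (adjmx P)).
have -> : adjmx (diag_mx d) *m diag_mx d = diag_mx sp; last by rewrite -Pinv.
rewrite /adjmx map_diag_mx tr_diag_mx mulmx_diag; congr diag_mx.
apply/rowP => i; rewrite !mxE -normCKC.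
by rewrite ger0_norm ?sqrtC_ge0 ?(ltW (sp0 i)) // sqrtCK.
Qed.
End QuadraticForms.

(** * States and unitarization *)

Section VectorStates.
Variables (R : realType) (A : cstarType R) (H : hilbertType R) (p : A -> H -> H).
Hypothesis pf : faithful_rep p.
Local Notation C := R[i].
Variable xs : seq H.

(** Several vectors are summed because a single one need not separate a given finite-dimensional
    space of elements. *)
Definition vstate (a : A) : C := \sum_(x <- xs) ip (p a x) x.

Lemma vstateD a b : vstate (a + b) = vstate a + vstate b.
Proof. by rewrite -big_split; apply: eq_bigr => x _; rewrite (repD pf) ipDl. Qed.

Lemma vstateZ c a : vstate (c *: a) = c * vstate a.
Proof. by rewrite mulr_sumr; apply: eq_bigr => x _; rewrite (repZ pf) ipZl. Qed.

Lemma vstate0 : vstate 0 = 0.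
Proof. by rewrite -(scale0r 0) vstateZ mul0r. Qed.

Lemma vstate_sum I (r : seq I) (P : pred I) (F : I -> A) :
  vstate (\sum_(i <- r | P i) F i) = \sum_(i <- r | P i) vstate (F i).
Proof. by apply: (big_morph vstate) => [a b|]; rewrite ?vstateD ?vstate0. Qed.

Lemma vstate_starM a b : vstate (star a * b) = \sum_(x <- xs) ip (p b x) (p a x).
Proof. by apply: eq_bigr => x _; rewrite (repM pf) (rep_star pf) starK. Qed.

Lemma vstate_ge0 a : positive a -> 0 <= vstate a.
Proof. by move=> a0; apply: sumr_ge0 => x _; apply: positive_rep. Qed.

Lemma vstate_star a : vstate (star a) = Num.conj (vstate a).
Proof.
rewrite rmorph_sum; apply: eq_bigr => x _.
by rewrite (rep_star pf) starK ip_conj.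
Qed.

Lemma vstate_mulmxr m n k (M : 'M[A]_(m, n)) (X : 'M[C]_(n, k)) :
  map_mx vstate (M *m scmx A X) = map_mx vstate M *m X.
Proof.
apply/matrixP=> i j; rewrite !mxE vstate_sum; apply: eq_bigr => l _.
by rewrite !mxE /= -scalerAr mulr1 vstateZ mulrC.
Qed.

Lemma vstate_mulmxl m n k (X : 'M[C]_(m, n)) (M : 'M[A]_(n, k)) :
  map_mx vstate (scmx A X *m M) = X *m map_mx vstate M.
Proof.
apply/matrixP=> i j; rewrite !mxE vstate_sum; apply: eq_bigr => l _.
by rewrite !mxE /= -scalerAl mul1r vstateZ.
Qed.

Lemma vstate_scmx m n (X : 'M[C]_(m, n)) :
  map_mx vstate (scmx A X) = vstate 1 *: X.
Proof. by apply/matrixP=> i j; rewrite !mxE /= vstateZ mulrC. Qed.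

Lemma vstate_dagmx m n (M : 'M[A]_(m, n)) :
  map_mx vstate (dagmx M) = adjmx (map_mx vstate M).
Proof. by apply/matrixP=> i j; rewrite !mxE vstate_star. Qed.

Lemma vstateD_mx m n (M N : 'M[A]_(m, n)) :
  map_mx vstate (M + N) = map_mx vstate M + map_mx vstate N.
Proof. by apply/matrixP=> i j; rewrite !mxE vstateD. Qed.

Lemma vstateN_mx m n (M : 'M[A]_(m, n)) :
  map_mx vstate (- M) = - map_mx vstate M.
Proof. by apply/matrixP=> i j; rewrite !mxE -scaleN1r vstateZ mulN1r. Qed.

(** As delta(u) multiplies the two legs like matrices, the iterates of this map are the same means
    taken for the convolution powers of the state. *)
Definition avg n (u : 'M[A]_n) (Y : 'M[C]_n) : 'M[C]_n :=
  map_mx vstate (dagmx u *m scmx A Y *m u).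

Lemma avg_linear n (u : 'M[A]_n) : linear (avg u).
Proof.
move=> c Y Z; apply/matrixP=> i j.
rewrite /avg !mxE -vstateZ -vstateD; congr vstate.
rewrite scaler_sumr -big_split; apply: eq_bigr => l _.
rewrite /= !mxE scalerAl -mulrDl; congr (_ * _).
rewrite scaler_sumr -big_split; apply: eq_bigr => k _.
by rewrite /= !mxE /= scalerAr -mulrDr scalerA scalerDl.
Qed.
End VectorStates.

(** * Slices of the comultiplication *)

Section Slices.
Variables (R : realType) (A T : cstarType R) (t : A -> A -> T).
Variables (H K L : hilbertType R) (tH : H -> K -> L).
Variables (pA : A -> H -> H) (pB : A -> K -> K) (pT : T -> L -> L).
Hypotheses (tHP : hilbert_tensor tH).
Hypotheses (fA : faithful_rep pA) (fB : faithful_rep pB) (fT : faithful_rep pT).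
Hypothesis pTt : forall a b x y, pT (t a b) (tH x y) = tH (pA a x) (pB b y).
Local Notation C := R[i].

(** Only inner products of elementary tensors are given. The difference of the two sides is
    orthogonal to all elementary tensors, hence to itself, being a combination of such. *)
Lemma tH_linr c x y y' : tH x (c *: y + y') = c *: tH x y + tH x y'.
Proof.
have [ipE _] := tHP.
apply/eqP; rewrite -subr_eq0; apply/eqP.
set z := tH x (c *: y + y') - _.
have h a b : ip z (tH a b) = 0.
  by rewrite ipBl ipDl ipZl !ipE ipDl ipZl; ring.
apply: ip_eq0; rewrite {2}/z ip_conj ipBl ipDl ipZl.
by rewrite ![ip _ z]ip_conj !h !rmorph0 mulr0 addr0 subrr rmorph0.
Qed.

Lemma tH_sumr x m (c : 'I_m -> C) (y : 'I_m -> K) :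
  tH x (\sum_j c j *: y j) = \sum_j c j *: tH x (y j).
Proof.
have t0 : tH x 0 = 0.
  have := tH_linr (-1) x 0 0.
  by rewrite scaler0 addr0 scaleN1r addNr.
elim/big_rec2: _ => [|j z1 z2 _ <-]; first by rewrite t0.
by rewrite tH_linr.
Qed.

Variables (delta : A -> T) (deltaP : star_hom delta).

Let deltaM a b : delta (a * b) = delta a * delta b.
Proof. by have [_ _ h _] := deltaP; apply: h. Qed.
Let delta_lin c a b : delta (c *: a + b) = c *: delta a + delta b.
Proof. by have [_ h _ _] := deltaP; apply: h. Qed.
Let delta_star a : delta (star a) = star (delta a).
Proof. by have [_ _ _ h] := deltaP; apply: h. Qed.
Let delta1 : delta 1 = 1.
Proof. by have [h _ _ _] := deltaP; apply: h. Qed.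
Let delta0 : delta 0 = 0.
Proof.
by have := delta_lin (-1) 0 0; rewrite scaler0 addr0 scaleN1r addNr.
Qed.
Let deltaD a b : delta (a + b) = delta a + delta b.
Proof. by rewrite -[a in LHS]scale1r delta_lin scale1r. Qed.
Let deltaZ c a : delta (c *: a) = c *: delta a.
Proof. by rewrite -[c *: a]addr0 delta_lin delta0 addr0. Qed.
Let delta_sum I (r : seq I) (P : pred I) (F : I -> A) :
  delta (\sum_(i <- r | P i) F i) = \sum_(i <- r | P i) delta (F i).
Proof. by apply: (big_morph delta) => [a b|]; rewrite ?deltaD ?delta0. Qed.

Variables (n : nat) (u : 'M[A]_n).
Hypothesis delta_u : forall i j, delta (u i j) = \sum_k t (u i k) (u k j).

Definition qform (Y : 'M[C]_n) (v : 'cV[C]_n) : A :=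
  (dagmx (u *m scmx A v) *m scmx A Y *m (u *m scmx A v)) 0 0.

Lemma qformE Y v : let w := u *m scmx A v in
  qform Y v = \sum_i \sum_j Y i j *: (star (w i 0) * w j 0).
Proof.
move=> w; rewrite /qform -/w !mxE exchange_big; apply: eq_bigr => j _.
rewrite mxE mulr_suml; apply: eq_bigr => i _.
by rewrite !mxE /= -scalerAr mulr1 -scalerAl.
Qed.

(** This reads u^* Y u >= -c, tested on scalar vectors. Used for Y with c = -lo and for -Y with c =
    hi, it gives both bounds on the orbit. *)
Definition bounded_form Y c :=
  forall v : 'cV[C]_n, positive (qform Y v + (c * (adjmx v *m v) 0 0) *: 1).

Variable xs : seq H.
Hypothesis xs1 : vstate pA xs 1 = 1.

Lemma avg_quad Y v :
  (adjmx v *m avg pA xs u Y *m v) 0 0 = vstate pA xs (qform Y v).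
Proof.
transitivity ((map_mx (vstate pA xs)
  (dagmx (u *m scmx A v) *m scmx A Y *m (u *m scmx A v))) 0 0).
  by rewrite /avg dagmxM dagmx_sc -vstate_mulmxl // -vstate_mulmxr // !mulmxA.
by rewrite mxE.
Qed.

(* Slicing the first leg of delta by the vector state of pA turns the form of Y
   into the form of avg Y; it is positive because it is a sum of values of
   delta of a positive element at the vectors tH x y. *)
Lemma bounded_form_avg Y c : bounded_form Y c -> bounded_form (avg pA xs u Y) c.
Proof.
move=> Yc v; apply: (rep_positive fB) => y.
set k := c * _; set w := u *m scmx A v.
have dw i x : pT (delta (w i 0)) (tH x y) =
    \sum_l tH (pA (u i l) x) (pB (w l 0) y).
  have -> : delta (w i 0) = \sum_l \sum_j v j 0 *: t (u i l) (u l j).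
    rewrite exchange_big mxE delta_sum; apply: eq_bigr => j _.
    by rewrite mxE /= -scalerAr mulr1 deltaZ delta_u scaler_sumr.
  rewrite (rep_bigsum fT); apply: eq_bigr => l _.
  rewrite (rep_bigsum fT).
  have -> : pB (w l 0) y = \sum_j v j 0 *: pB (u l j) y.
    rewrite mxE (rep_bigsum fB); apply: eq_bigr => j _.
    by rewrite mxE /= -scalerAr mulr1 (repZ fB).
  rewrite tH_sumr; apply: eq_bigr => j _; by rewrite (repZ fT) pTt.
have -> : ip (pB (qform (avg pA xs u Y) v + k *: 1) y) y =
  \sum_(x <- xs) ip (pT (delta (qform Y v + k *: 1)) (tH x y)) (tH x y).
  rewrite (repD fB) ipDl (repZ fB) (rep1 fB) ipZl.
  have -> : k * ip y y = \sum_(x <- xs) k * (ip x x * ip y y).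
    rewrite -mulr_sumr -mulr_suml; congr (_ * _).
    rewrite -[LHS]mul1r; congr (_ * _); rewrite -[LHS]xs1.
    by apply: eq_bigr => x _; rewrite (rep1 fA).
  have [ipE _] := tHP.
  under [RHS]eq_bigr => x _ do
    rewrite deltaD deltaZ delta1 (repD fT) ipDl (repZ fT) (rep1 fT) ipZl ipE.
  rewrite big_split; congr (_ + _).
  rewrite qformE -/w (rep_bigsum fB) ip_suml.
  under [LHS]eq_bigr => i _ do rewrite (rep_bigsum fB) ip_suml.
  (* Both sides become one fivefold sum: i' and j' index the entries of Y, while i and j are the
     summation indices of the coproduct. *)
  transitivity (\sum_(x <- xs) \sum_i \sum_j \sum_i' \sum_j'
    Y i' j' * ip (pA (u j' j) x) (pA (u i' i) x) * ip (pB (w j 0) y) (pB (w i 0) y)).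
    rewrite [RHS]exchange_big /=; apply: eq_bigr => i _.
    rewrite [RHS]exchange_big /=; apply: eq_bigr => j _.
    rewrite (repZ fB) ipZl (repM fB) (rep_star fB) starK.
    have -> : avg pA xs u Y i j = \sum_(x <- xs) \sum_i' \sum_j'
        Y i' j' * ip (pA (u j' j) x) (pA (u i' i) x).
      transitivity (\sum_j' \sum_i' \sum_(x <- xs)
        Y i' j' * ip (pA (u j' j) x) (pA (u i' i) x)).
        rewrite mxE mxE (vstate_sum fA); apply: eq_bigr => j' _.
        rewrite mxE mulr_suml (vstate_sum fA); apply: eq_bigr => i' _.
        rewrite !mxE /= -scalerAr mulr1 -scalerAl (vstateZ fA) (vstate_starM fA).
        by rewrite mulr_sumr.
      rewrite exchange_big [RHS]exchange_big; apply: eq_bigr => i' _.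
      by rewrite [RHS]exchange_big.
    rewrite mulr_suml; apply: eq_bigr => x _.
    rewrite mulr_suml; apply: eq_bigr => i' _.
    by rewrite mulr_suml.
  apply: eq_bigr => x _; rewrite qformE -/w delta_sum (rep_bigsum fT) ip_suml.
  under [RHS]eq_bigr => i' _ do rewrite delta_sum (rep_bigsum fT) ip_suml.
  transitivity (\sum_i \sum_i' \sum_j' \sum_j
    Y i' j' * ip (pA (u j' j) x) (pA (u i' i) x) * ip (pB (w j 0) y) (pB (w i 0) y)).
    apply: eq_bigr => i _; rewrite exchange_big; apply: eq_bigr => i' _.
    by rewrite exchange_big.
  rewrite exchange_big; apply: eq_bigr => i' _.
  rewrite exchange_big; apply: eq_bigr => j' _.
  rewrite deltaZ deltaM delta_star (repZ fT) ipZl (repM fT) (rep_star fT) starK.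
  rewrite !dw ip_sumr mulr_sumr; apply: eq_bigr => i _.
  rewrite ip_suml mulr_sumr; apply: eq_bigr => j _.
  by rewrite ipE mulrA.
apply: sumr_ge0 => x _; apply: (positive_rep fT); have [s ->] := Yc v.
by exists (delta s); rewrite deltaM delta_star.
Qed.
End Slices.

(** * Finitely many vectors separating a finite-dimensional space *)

Section SeparatingVectors.
Variables (R : realType) (A : cstarType R) (H : hilbertType R) (p : A -> H -> H).
Hypothesis pf : faithful_rep p.
Local Notation C := R[i].

(** Generators are peeled off one at a time, to suit the induction in [exists_separating]. *)
Fixpoint lin_span (E : seq A) (a : A) : Prop :=
  if E is e :: E' then exists c : C, lin_span E' (a - c *: e) else a = 0.

Lemma lin_span_lin E c a b : lin_span E a -> lin_span E b -> lin_span E (c *: a + b).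
Proof.
elim: E c a b => [|e E IH] c a b /= => [-> ->|[ca ha] [cb hb]].
  by rewrite scaler0 addr0.
exists (c * ca + cb).
have -> : c *: a + b - (c * ca + cb) *: e = c *: (a - ca *: e) + (b - cb *: e).
  by rewrite scalerDl scalerBr scalerA opprD addrACA.
exact: IH.
Qed.

Lemma lin_span0 E : lin_span E 0.
Proof. by elim: E => //= e E IH; exists 0; rewrite scale0r subr0. Qed.

Lemma lin_spanZ E c a : lin_span E a -> lin_span E (c *: a).
Proof. by move=> h; rewrite -[_ *: _]addr0; apply: lin_span_lin => //; apply: lin_span0. Qed.

Lemma lin_spanB E a b : lin_span E a -> lin_span E b -> lin_span E (a - b).
Proof. by move=> ha hb; rewrite addrC -scaleN1r; apply: lin_span_lin. Qed.

Lemma lin_span_sum E I (r : seq I) (F : I -> A) :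
  (forall i, lin_span E (F i)) -> lin_span E (\sum_(i <- r) F i).
Proof.
move=> h; elim/big_rec: _ => [|i x _ hx]; first exact: lin_span0.
by rewrite -[F i]scale1r; apply: lin_span_lin.
Qed.

Lemma lin_span_mem (E : seq A) a : a \in E -> lin_span E a.
Proof.
elim: E => //= e E IH; rewrite inE => /predU1P[->|/IH h].
  by exists 1; rewrite scale1r subrr; apply: lin_span0.
by exists 0; rewrite scale0r subr0.
Qed.

Definition separating (xs : seq H) E :=
  forall a, lin_span E a -> (forall x, x \in xs -> p a x = 0) -> a = 0.

(** If xs kills some a <> 0 in the larger span, then a has a nonzero e-coordinate by induction, so
    all elements of that span killed by xs are multiples of a. One more vector, not killed by a, is
    enough. *)
Lemma exists_separating E : exists xs, separating xs E.
Proof.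
elim: E => [|e E [xs IH]]; first by exists [::].
have [[a [[ca ha] [ka a0]]]|none] := pselect (exists a, lin_span (e :: E) a /\
    ((forall x, x \in xs -> p a x = 0) /\ a <> 0)); last first.
  exists xs => a ha ka; apply: contrapT => a0.
  by apply: none; exists a.
have [xi xi0] : exists xi, p a xi <> 0.
  apply/not_existsP => h; apply: a0; apply: (rep_inj pf) => x.
  by rewrite (rep0 pf); apply: contrapT => /h.
have ca0 : ca != 0.
  apply/eqP => c0; apply: a0; apply: IH => //.
  by move: ha; rewrite c0 scale0r subr0.
exists (xi :: xs) => b [cb hb] kb.
have bE : b = (cb / ca) *: a.
  apply/eqP; rewrite -subr_eq0; apply/eqP/IH.
    have -> : b - (cb / ca) *: a = (b - cb *: e) - (cb / ca) *: (a - ca *: e).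
      by rewrite scalerBr scalerA divfK // opprB subrKA.
    by apply: lin_spanB => //; apply: lin_spanZ.
  move=> x xx; rewrite (repD pf) (repN pf) (repZ pf) ka // kb ?inE ?xx ?orbT //.
  by rewrite scaler0 subr0.
have := kb xi; rewrite inE eqxx bE (repZ pf) => /(_ isT)/eqP.
by rewrite scaler_eq0 => /orP[/eqP->|/eqP//]; rewrite scale0r.
Qed.

(** As 1 is in E, the vectors cannot all vanish, so they can be rescaled to total mass 1 without
    losing separation. *)
Lemma exists_separating_state E : 1 \in E ->
  exists2 xs, vstate p xs 1 = 1 & separating xs E.
Proof.
move=> E1; have [xs hxs] := exists_separating E.
pose k := vstate p xs 1.
have kE : k = \sum_(x <- xs) ip x x by apply: eq_bigr => x _; rewrite (rep1 pf).
have k0 : 0 < k.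
  rewrite lt_def kE sumr_ge0 ?andbT => [|x _]; last exact: ip_ge0.
  apply/eqP => /eqP; rewrite psumr_eq0 => [/allP h|x _]; last exact: ip_ge0.
  have /eqP := oner_neq0 A; apply; apply: hxs; first exact: lin_span_mem.
  by move=> x /h /eqP; rewrite (rep1 pf); apply: ip_eq0.
have s0 : sqrtC k != 0 by rewrite sqrtC_eq0 gt_eqF.
exists [seq (sqrtC k)^-1 *: x | x <- xs].
  rewrite /vstate big_map.
  under eq_bigr => x _ do rewrite (rep1 pf) ipZl ipZr mulrA.
  rewrite -mulr_sumr -kE -normCK ger0_norm ?invr_ge0 ?sqrtC_ge0 ?ltW //.
  by rewrite exprVn sqrtCK mulVf ?gt_eqF.
move=> a ha ka; apply: hxs => // x xx.
have := ka ((sqrtC k)^-1 *: x); rewrite map_f // => /(_ isT).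
rewrite (repZv pf) => /eqP; rewrite scaler_eq0 invr_eq0 (negPf s0) /=.
by move/eqP.
Qed.
End SeparatingVectors.

Lemma ler_sqr_sqrtC (F : numClosedFieldType) (a S : F) :
  0 <= a -> 0 <= S -> (a ^+ 2 <= S) = (a <= sqrtC S).
Proof.
by move=> a0 S0; rewrite -[a in RHS](sqrCK a0) ler_sqrtC // nnegrE exprn_ge0.
Qed.

Lemma ler_sqr_mul_sqrtC (F : numClosedFieldType) (a b S : F) :
  0 <= a -> 0 <= b -> 0 <= S -> a <= b * sqrtC S -> a ^+ 2 <= b ^+ 2 * S.
Proof.
move=> a0 b0 S0 h; rewrite ler_sqr_sqrtC ?mulr_ge0 ?exprn_ge0 //.
by rewrite sqrtCM ?nnegrE ?exprn_ge0 // sqrCK.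
Qed.

(** * Upper and lower bounds for u^* u *)

Section OperatorBounds.
Variables (R : realType) (A : cstarType R) (K : hilbertType R) (p : A -> K -> K).
Hypothesis pf : faithful_rep p.
Local Notation C := R[i].

Lemma rep_mx_bound m n (u : 'M[A]_(m, n)) : exists2 M : C, 0 <= M &
  forall (x : 'I_n -> K) (S : C), 0 <= S -> (forall j, `|x j| ^+ 2 <= S) ->
  forall i, `|\sum_j p (u i j) (x j)| ^+ 2 <= M ^+ 2 * S.
Proof.
(* The bound given by [rep_bound] is an arbitrary complex number; its modulus is a nonnegative
   bound. *)
have h i j : exists M : C, 0 <= M /\ forall x, `|p (u i j) x| <= M * `|x|.
  have [M hM] := rep_bound pf (u i j); exists `|M|; split=> // x.
  rewrite -[`|x| in leRHS]normr_id -normrM.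
  by rewrite [leRHS]ger0_norm // (le_trans _ (hM x)).
have [f hf] := choice (fun ij : 'I_m * 'I_n => h ij.1 ij.2).
have f0 : 0 <= \sum_i \sum_j f (i, j).
  by apply: sumr_ge0 => i _; apply: sumr_ge0 => j _; case: (hf (i, j)).
exists (\sum_i \sum_j f (i, j)) => // x S S0 xS i.
apply: (@ler_sqr_mul_sqrtC C) => //.
have {}xS j : `|x j| <= sqrtC S by rewrite -ler_sqr_sqrtC.
 apply: (le_trans (ler_norm_sum _ _ _)).
rewrite (bigD1 i) //= mulrDl -[leLHS]addr0; apply: lerD.
  rewrite mulr_suml; apply: ler_sum => j _; have [fi0 fx] := hf (i, j).
  by apply: (le_trans (fx _)); rewrite ler_wpM2l.
apply: mulr_ge0; rewrite ?sqrtC_ge0 //; apply: sumr_ge0 => i' _.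
by apply: sumr_ge0 => j _; case: (hf (i', j)).
Qed.

Lemma norm_cV_sq n (v : 'cV[C]_n) : (adjmx v *m v) 0 0 = \sum_i `|v i 0| ^+ 2.
Proof. by rewrite mxE; apply: eq_bigr => i _; rewrite !mxE -normCKC. Qed.

Variables (n : nat) (u u' : 'M[A]_n).
Hypothesis u'u : u' *m u = 1%:M.

Let rep_qform1 v y : ip (p (qform u 1%:M v) y) y =
  \sum_i `|p ((u *m scmx A v) i 0) y| ^+ 2.
Proof.
rewrite /qform scmx1 mulmx1 mxE (rep_bigsum pf) ip_suml; apply: eq_bigr => i _.
by rewrite !mxE (repM pf) (rep_star pf) starK ip_norm.
Qed.

Let qformN v : qform u (- 1%:M) v = - qform u 1%:M v.
Proof. by rewrite /qform /scmx map_mxN mulmxN mulNmx mxE. Qed.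

Lemma bounded_form_upper : exists2 c : C, 0 <= c & bounded_form u (- 1%:M) c.
Proof.
have [M M0 hM] := rep_mx_bound u.
exists (n%:R * M ^+ 2); first by rewrite mulr_ge0 ?exprn_ge0.
move=> v; apply: (rep_positive pf) => y.
rewrite qformN (repD pf) (repN pf) (repZ pf) (rep1 pf) ipDl ipNl ipZl.
rewrite addrC subr_ge0 rep_qform1.
set s : C := (_ *m _) 0 0; have s0 : 0 <= s.
  by rewrite /s norm_cV_sq sumr_ge0 // => i _; rewrite exprn_ge0.
rewrite -mulrA -mulrA mulr_natl -[n in leRHS]card_ord -sumr_const.
apply: ler_sum => i _.
have -> : p ((u *m scmx A v) i 0) y = \sum_j p (u i j) (v j 0 *: y).
  rewrite mxE (rep_bigsum pf); apply: eq_bigr => j _.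
  by rewrite mxE /= -scalerAr mulr1 (repZ pf) (repZv pf).
have h : forall j, `|v j 0 *: y| ^+ 2 <= s * ip y y.
  move=> j; rewrite normrZ exprMn ip_norm ler_wpM2r ?exprn_ge0 // /s norm_cV_sq.
  by rewrite (bigD1 j) //= lerDl sumr_ge0 // => i' _; rewrite exprn_ge0.
by have := hM _ _ _ h i; apply; rewrite mulr_ge0 ?ip_ge0.
Qed.

(** Writing v = u' (u v), a bound on u' prevents u v from being small. *)
Lemma bounded_form_lower : exists2 c : C, 0 < c & bounded_form u 1%:M (- c).
Proof.
have [M M0 hM] := rep_mx_bound u'.
(* The summand 1 keeps k invertible even when n or M vanishes. *)
pose k := n%:R * M ^+ 2 + 1.
have k0 : 0 < k by rewrite ltr_wpDl // mulr_ge0 ?exprn_ge0.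
exists k^-1; first by rewrite invr_gt0.
move=> v; apply: (rep_positive pf) => y.
rewrite (repD pf) (repZ pf) (rep1 pf) ipDl ipZl mulNr mulNr subr_ge0.
rewrite -mulrA ler_pdivrMl // rep_qform1 norm_cV_sq.
set w := u *m scmx A v; set S : C := \sum_i `|p _ y| ^+ 2.
have S0 : 0 <= S by rewrite sumr_ge0 // => i _; rewrite exprn_ge0.
rewrite /k mulrDl mul1r -[leLHS]addr0; apply: lerD => //.
rewrite -mulrA mulr_natl -[n in leRHS]card_ord -sumr_const mulr_suml.
apply: ler_sum => i _.
have h : forall j, `|p (w j 0) y| ^+ 2 <= S.
  by move=> j; rewrite /S (bigD1 j) //= lerDl sumr_ge0 // => i' _; rewrite exprn_ge0.
have := hM _ _ S0 h i.
have -> : \sum_j p (u' i j) (p (w j 0) y) = v i 0 *: y.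
  under eq_bigr => j _ do rewrite -(repM pf).
  rewrite -(rep_bigsum pf); have <- : (u' *m w) i 0 = \sum_j u' i j * w j 0.
    by rewrite mxE.
  by rewrite /w mulmxA u'u mul1mx mxE /= (repZ pf) (rep1 pf).
by rewrite normrZ exprMn ip_norm.
Qed.
End OperatorBounds.

(** This presents Y |-> v^* Y v as a linear functional of [mxvec Y], the shape that
    [fixed_point_of_bounded_orbit] expects. *)
Lemma vec_quad (R : realType) n (Y : 'M[R[i]]_n) (v : 'cV[R[i]]_n) :
  (mxvec Y *m (mxvec ((adjmx v)^T *m v^T))^T) 0 0 = (adjmx v *m Y *m v) 0 0.
Proof.
transitivity (((mxvec Y *m (mxvec ((adjmx v)^T *m v^T))^T)^T : 'M[R[i]]_1) 0 0).
  by rewrite [RHS]mxE.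
by rewrite trmx_mul trmxK mxvec_dotmul trmxK.
Qed.

Section Unitarization.
Variables (R : realType) (A T : cstarType R) (t : A -> A -> T).
Variables (H K L : hilbertType R) (tH : H -> K -> L).
Variables (pA : A -> H -> H) (pB : A -> K -> K) (pT : T -> L -> L).
Hypotheses (tHP : hilbert_tensor tH).
Hypotheses (fA : faithful_rep pA) (fB : faithful_rep pB) (fT : faithful_rep pT).
Hypothesis pTt : forall a b x y, pT (t a b) (tH x y) = tH (pA a x) (pB b y).
Variables (delta : A -> T) (deltaP : star_hom delta).
Local Notation C := R[i].

Variable xs : seq H.
Hypothesis xs1 : vstate pA xs 1 = 1.

Lemma invariant_form n (u u' : 'M[A]_n) : u' *m u = 1%:M ->
  (forall i j, delta (u i j) = \sum_k t (u i k) (u k j)) ->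
  exists2 Q : 'M[C]_n, Q \in unitmx &
    avg pA xs u (adjmx Q *m Q) = adjmx Q *m Q.
Proof.
move=> u'u du.
have [lo lo0 hlo] := bounded_form_lower fB u'u.
have [hi hi0 hhi] := bounded_form_upper fB u.
pose avgu : {linear 'M[C]_n -> 'M[C]_n} := HB.pack (avg pA xs u)
  (GRing.isLinear.Build C 'M[C]_n 'M[C]_n _ (avg pA xs u) (@avg_linear _ _ _ _ fA xs n u)).
pose orb k := iter k avgu 1%:M.
have step := bounded_form_avg tHP fA fB fT pTt deltaP du xs1.
have orb_lo k : bounded_form u (orb k) (- lo) by elim: k => //= k; apply: step.
have orb_hi k : bounded_form u (- orb k) hi.
  by elim: k => //= k IH; rewrite /orb /= -[avg _ _ _ _]/(avgu _) -raddfN; apply: step.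
have quad_ge Y c (v : 'cV[C]_n) : bounded_form u Y c ->
    0 <= (adjmx v *m avg pA xs u Y *m v) 0 0 + c * (adjmx v *m v) 0 0.
  move=> h; rewrite (avg_quad fA) -[c * _]mulr1 -[X in _ * X]xs1.
  by rewrite -(vstateZ fA) -(vstateD fA); apply: (vstate_ge0 fA).
pose f (v : 'cV[C]_n) := (mxvec ((adjmx v)^T *m v^T))^T.
have sep (z : 'rV[C]_(n * n)) : (forall v, z *m f v = 0) -> z = 0.
  move=> hz; apply: (can_inj vec_mxK); rewrite linear0.
  apply: adj_quad_eq0 => v; have := hz v => /matrixP /(_ 0 0).
  rewrite -{1}[z]vec_mxK /f vec_quad => h.
  by apply/matrixP => i j; rewrite !ord1 h !mxE.
(* The forms start at 1, but a numerical bound arises only after applying the state, which costs one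
   more averaging; the numerical orbit therefore starts at [avgu 1%:M]. *)
have bnd k (v : 'cV[C]_n) : lo * (adjmx v *m v) 0 0 <=
    (mxvec (avgu 1%:M) *m lin_mx avgu ^+ k *m f v) 0 0 <= hi * (adjmx v *m v) 0 0.
  have -> : mxvec (avgu 1%:M) *m lin_mx avgu ^+ k = mxvec (avgu (orb k)).
    elim: k => [|k IH]; first by rewrite expr0 mulmx1.
    by rewrite exprSr -mulmxE mulmxA IH mul_vec_lin.
  rewrite /f vec_quad -[X in X && _]subr_ge0 -[X in _ && X]subr_ge0.
  have := quad_ge _ _ v (orb_lo k); rewrite mulNr => ->.
  have := quad_ge _ _ v (orb_hi k); rewrite (raddfN avgu (orb k) : avg _ _ _ _ = _).
  rewrite mulmxN mulNmx mxE addrC.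
  by move=> ->.
have [b [bM bv]] := fixed_point_of_bounded_orbit sep bnd.
have bE : avgu (vec_mx b) = vec_mx b.
  by apply: (can_inj mxvecK); rewrite -mul_vec_lin vec_mxK.
have [v v0|Q Qu QE] := @posdef_factor R n (vec_mx b); last by exists Q; rewrite // -QE.
apply: lt_le_trans (_ : lo * (adjmx v *m v) 0 0 <= _); last first.
  by have := bv v; rewrite -[b in X in X -> _]vec_mxK vec_quad.
rewrite mulr_gt0 // norm_cV_sq lt_def sumr_ge0 ?andbT => [|i _]; last exact: exprn_ge0.
apply: contra v0; rewrite psumr_eq0 => [/allP h|i _]; last exact: exprn_ge0.
apply/eqP/colP => i; have := h i (mem_index_enum _); rewrite expf_eq0 /= normr_eq0 mxE.
by move/eqP.
Qed.

(* With B = Q^* Q invariant in mean and d = s z - z, expanding d^* B d gives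
   mean 0; as the state is faithful on the span of E, Q d = 0. *)
Lemma mean_fixed_fixed n (s s' : 'M[A]_n) E (z : 'cV[C]_n) : s' *m s = 1%:M ->
  (forall i j, delta (s i j) = \sum_k t (s i k) (s k j)) ->
  separating pA xs E -> 1 \in E -> (forall i j, s i j \in E) ->
  map_mx (vstate pA xs) s *m z = z -> s *m scmx A z = scmx A z.
Proof.
move=> s's ds sepE E1 Es sz.
have [Q Qu QE] := invariant_form s's ds.
pose d := s *m scmx A z - scmx A z.
pose phi m k (X : 'M[A]_(m, k)) := map_mx (vstate pA xs) X.
have szz : phi _ _ (s *m scmx A z) = z by rewrite /phi vstate_mulmxr.
have dd : phi _ _ (dagmx (scmx A Q *m d) *m (scmx A Q *m d)) = 0.
  rewrite dagmxM dagmx_sc mulmxA -[in X in phi _ _ X](mulmxA (dagmx d)) -scmxM.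
  move: (adjmx Q *m Q) QE => B QE.
  have e1 : phi _ _ (dagmx (s *m scmx A z) *m scmx A B *m (s *m scmx A z)) =
      adjmx z *m B *m z.
    rewrite dagmxM dagmx_sc -!mulmxA /phi vstate_mulmxl // !mulmxA vstate_mulmxr //.
    by rewrite -[in RHS]QE /avg !mulmxA.
  have e2 : phi _ _ (scmx A (adjmx z) *m scmx A B *m (s *m scmx A z)) =
      adjmx z *m B *m z.
    by rewrite -scmxM /phi vstate_mulmxl // -/(phi _ _ _) szz.
  have e3 : phi _ _ (dagmx (s *m scmx A z) *m scmx A B *m scmx A z) =
      adjmx z *m B *m z.
    rewrite -mulmxA -scmxM /phi vstate_mulmxr // vstate_dagmx //.
    by rewrite -/(phi _ _ _) szz !mulmxA.
  have e4 : phi _ _ (scmx A (adjmx z) *m scmx A B *m scmx A z) =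
      adjmx z *m B *m z.
    by rewrite -!scmxM /phi vstate_scmx // xs1 scale1r.
  rewrite /d dagmxB dagmx_sc 2!mulmxBl !mulmxBr opprB /phi.
  rewrite !vstateD_mx // !vstateN_mx // -!/(phi _ _ _).
  rewrite e1 e2 e3 e4; move: (adjmx z *m B *m z : 'M[C]_1) => q.
  by rewrite -[q - q]/(q - q : 'M[C]_1) !subrr addr0.
have Qd i j : lin_span E ((scmx A Q *m d) i j).
  rewrite mxE; apply: lin_span_sum => k; rewrite mxE /= -scalerAl mul1r.
  apply: lin_spanZ; rewrite !mxE; apply: lin_spanB.
    apply: lin_span_sum => l; rewrite mxE /= -scalerAr mulr1.
    by apply/lin_spanZ/lin_span_mem.
  exact/lin_spanZ/lin_span_mem.
have Qd0 : scmx A Q *m d = 0.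
  apply/matrixP => i j; rewrite [RHS]mxE; apply: sepE => // x xx.
  apply: ip_eq0; move/matrixP/(_ j j): dd.
  rewrite mxE mxE (vstate_sum fA) [RHS]mxE => /eqP.
  rewrite psumr_eq0 => [|k _]; last first.
    rewrite mxE mxE (vstate_starM fA); apply: sumr_ge0 => y _; exact: ip_ge0.
  move/allP/(_ i (mem_index_enum _)); rewrite /= mxE mxE (vstate_starM fA).
  rewrite psumr_eq0 => [|y _]; last exact: ip_ge0.
  by move/allP/(_ x xx)/eqP.
have : d = 0.
  have := congr1 (mulmx (scmx A (invmx Q))) Qd0.
  by rewrite mulmxA -scmxM mulVmx // scmx1 mul1mx mulmx0.
by move/eqP; rewrite subr_eq0 => /eqP.
Qed.
End Unitarization.

(** * Representations *)

Section ScalarTensors.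
Variables (R : realType) (A : cstarType R).
Local Notation C := R[i].

(** The rule (M (x) N)(M' (x) N') = M M' (x) N N' fails in general over a noncommutative algebra. It
    survives when one side is scalar, which is what intertwiners need. *)
Lemma tensmx_scmxr m n k m' n' k' (M : 'M[A]_(m, n)) (N : 'M[A]_(m', n'))
    (X : 'M[C]_(n, k)) (Y : 'M[C]_(n', k')) :
  (M *t N) *m scmx A (X *t Y) = (M *m scmx A X) *t (N *m scmx A Y).
Proof.
apply/matrixP => i j.
case: (mxtens_indexP i) => i1 i2; case: (mxtens_indexP j) => j1 j2.
rewrite !mxE !mxtens_indexK mulr_sum; apply: eq_bigr => l _.
case: (mxtens_indexP l) => l1 l2; rewrite !mxE !mxtens_indexK /=.
by rewrite -!scalerAr -!scalerAl !mulr1 scalerA mulrC.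
Qed.

Lemma tensmx_scmxl m n k m' n' k' (X : 'M[C]_(m, n)) (Y : 'M[C]_(m', n'))
    (M : 'M[A]_(n, k)) (N : 'M[A]_(n', k')) :
  scmx A (X *t Y) *m (M *t N) = (scmx A X *m M) *t (scmx A Y *m N).
Proof.
apply/matrixP => i j.
case: (mxtens_indexP i) => i1 i2; case: (mxtens_indexP j) => j1 j2.
rewrite !mxE !mxtens_indexK mulr_sum; apply: eq_bigr => l _.
case: (mxtens_indexP l) => l1 l2; rewrite !mxE !mxtens_indexK /=.
by rewrite -!scalerAl !mul1r -scalerAr scalerA mulrC.
Qed.

Lemma tensmx11 (S : pzRingType) m n : (1%:M : 'M[S]_m) *t (1%:M : 'M[S]_n) = 1%:M.
Proof.
apply/matrixP => i j.
case: (mxtens_indexP i) => i1 i2; case: (mxtens_indexP j) => j1 j2.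
rewrite tensmxE !mxE -natrM mulnb; congr (_%:R).
by rewrite (can_eq (@mxtens_indexK m n)) xpair_eqE.
Qed.

Lemma scmx_block m1 m2 n1 n2 (a : 'M[C]_(m1, n1)) (b : 'M[C]_(m1, n2))
    (c : 'M[C]_(m2, n1)) (d : 'M[C]_(m2, n2)) :
  scmx A (block_mx a b c d) = block_mx (scmx A a) (scmx A b) (scmx A c) (scmx A d).
Proof. exact: map_block_mx. Qed.

Lemma scmx_scalarC m n (k : C) (X : 'M[A]_(m, n)) :
  scmx A k%:M *m X = X *m scmx A k%:M.
Proof.
apply/matrixP => i j; rewrite !mxE (bigD1 i) //= [RHS](bigD1 j) //=.
rewrite !big1 ?addr0 => [|l lj|l li].
- by rewrite !mxE !eqxx /= -scalerAr -scalerAl mulr1 mul1r.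
- by rewrite !mxE (negPf lj) /= scale0r mulr0.
- by rewrite !mxE eq_sym (negPf li) /= scale0r mul0r.
Qed.

Lemma scmx_row m n1 n2 (a : 'M[C]_(m, n1)) (b : 'M[C]_(m, n2)) :
  scmx A (row_mx a b) = row_mx (scmx A a) (scmx A b).
Proof. exact: map_row_mx. Qed.

Lemma scmx_col m1 m2 n (a : 'M[C]_(m1, n)) (b : 'M[C]_(m2, n)) :
  scmx A (col_mx a b) = col_mx (scmx A a) (scmx A b).
Proof. exact: map_col_mx. Qed.
End ScalarTensors.

(** * Intertwiners and the lemma of Schur *)

Section Representations.
Variables (R : realType) (G : cmqg R).
Local Notation C := R[i].
Implicit Types r s : sqmx G.

Lemma rep_equiv_sym r s : rep_equiv r s -> rep_equiv s r.
Proof.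
move=> [T [T' [TT' T'T h]]]; exists T', T; split=> //.
have := congr1 (fun X => scmx _ T' *m X *m scmx _ T') h.
by rewrite !mulmxA -scmxM T'T scmx1 mul1mx -!mulmxA -scmxM TT' scmx1 mulmx1.
Qed.

Lemma rep_equiv_refl r : rep_equiv r r.
Proof. by exists 1%:M, 1%:M; rewrite !mulmx1 scmx1 mulmx1 mul1mx. Qed.

Lemma rep_equiv_trans r s t : rep_equiv r s -> rep_equiv s t -> rep_equiv r t.
Proof.
move=> [T [T' [TT' T'T h]]] [S [S' [SS' S'S h']]]; exists (T *m S), (S' *m T').
split.
- by rewrite mulmxA -(mulmxA T) SS' mulmx1.
- by rewrite mulmxA -(mulmxA S') T'T mulmx1.
- by rewrite scmxM mulmxA h -!mulmxA h'.
Qed.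

Lemma rep_equiv_tensor r s r' s' : rep_equiv r s -> rep_equiv r' s' ->
  rep_equiv (rep_tensor r r') (rep_tensor s s').
Proof.
move=> [T [T' [TT' T'T h]]] [S [S' [SS' S'S h']]].
exists (T *t S), (T' *t S'); split => /=.
- by rewrite tensmx_mul TT' SS' tensmx11.
- by rewrite tensmx_mul T'T S'S tensmx11.
- by rewrite tensmx_scmxr tensmx_scmxl h h'.
Qed.

Lemma rep_equiv_add r s r' s' : rep_equiv r s -> rep_equiv r' s' ->
  rep_equiv (rep_add r r') (rep_add s s').
Proof.
move=> [T [T' [TT' T'T h]]] [S [S' [SS' S'S h']]].
exists (block_mx T 0 0 S), (block_mx T' 0 0 S'); split => /=;
  rewrite ?scmx_block ?scmx0 !mulmx_block !mulmx0 !mul0mx !addr0 !add0r.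
- by rewrite TT' SS' -scalar_mx_block.
- by rewrite T'T S'S -scalar_mx_block.
- by rewrite h h'.
Qed.

Lemma rep_sum1 r : rep_equiv (rep_sum [:: r]) r.
Proof.
apply: rep_equiv_sym; exists (row_mx 1%:M 0), (col_mx 1%:M 0); split => /=.
- by rewrite mul_row_col mul0mx addr0 mulmx1.
- rewrite mul_col_row mulmx1 !mul0mx mulmx0 scalar_mx_block.
  by congr block_mx; apply/matrixP => -[].
- rewrite /scmx map_row_mx !map_mx0 map_mx1 mul_row_block mulmx0 mul1mx.
  by rewrite mul_mx_row !mulmx0 !addr0 mulmx1.
Qed.

Lemma rep_sum2 r s : rep_equiv (rep_sum [:: r; s]) (rep_add r s).
Proof. exact: rep_equiv_add (rep_equiv_refl r) (rep_sum1 s). Qed.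

(** With a generalized inverse S of T, the idempotent T S has the image of T and 1 - S T has its
    kernel as image. Both are invariant, and irreducibility leaves only the trivial cases. *)
Lemma irreducible_intertwiner_inv r s (T : 'M[C]_(sqdim r, sqdim s)) :
  rep_irreducible r -> rep_irreducible s ->
  r *m scmx _ T = scmx _ T *m s ->
  T = 0 \/ exists S, T *m S = 1%:M /\ S *m T = 1%:M.
Proof.
move=> [_ _ irr] [_ _ irs] h.
have [S TST] : exists S, T *m S *m T = T by exists (pinvmx T); apply: mulmxKpV.
have hP : (T *m S) *m (T *m S) = T *m S by rewrite mulmxA TST.
have rTS : r *m scmx _ (T *m S) = scmx _ T *m s *m scmx _ S.
  by rewrite scmxM mulmxA h.
have hI : scmx _ (T *m S) *m (r *m scmx _ (T *m S)) = r *m scmx _ (T *m S).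
  by rewrite rTS !mulmxA -scmxM TST.
have [TS0|TS1] := irr _ hP hI; first by left; rewrite -TST TS0 mul0mx.
have TQ : T *m (1%:M - S *m T) = 0 by rewrite mulmxBr mulmx1 mulmxA TST subrr.
have hQ : (1%:M - S *m T) *m (1%:M - S *m T) = 1%:M - S *m T.
  by rewrite mulmxBl mul1mx -mulmxA TQ mulmx0 subr0.
have hJ : scmx (qalg G) (1%:M - S *m T) *m (s *m scmx _ (1%:M - S *m T)) =
    s *m scmx _ (1%:M - S *m T).
  rewrite {1}scmxB scmx1 mulmxBl mul1mx scmxM -mulmxA (mulmxA _ s) -h -mulmxA.
  by rewrite -scmxM TQ scmx0 !mulmx0 subr0.
have [/eqP|/eqP] := irs _ hQ hJ.
  by rewrite subr_eq0 => /eqP ST1; right; exists S.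
rewrite -subr_eq0 addrAC subrr add0r oppr_eq0 => /eqP ST0.
by left; rewrite -TST -mulmxA ST0 mulmx0.
Qed.

Lemma irreducible_intertwiner r s (T : 'M[C]_(sqdim r, sqdim s)) :
  rep_irreducible r -> rep_irreducible s ->
  r *m scmx _ T = scmx _ T *m s -> T = 0 \/ rep_equiv r s.
Proof.
move=> irr irs h.
have [->|[S [TS ST]]] := irreducible_intertwiner_inv irr irs h; first by left.
by right; exists T, S.
Qed.

Lemma schur_scalar r (T : 'M[C]_(sqdim r)) :
  rep_irreducible r -> r *m scmx _ T = scmx _ T *m r -> exists c, T = c%:M.
Proof.
move=> irr h; have [_ d0 _] := irr.
have [a /eigenvalueP[v vT v0]] := eigenvalue_closed T d0.
exists a.
have hZ : r *m scmx _ (T - a%:M) = scmx _ (T - a%:M) *m r.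
  rewrite scmxB mulmxBl mulmxBr h; congr (_ - _).
  by rewrite scmx_scalarC.
have [/eqP|[ZS]] := irreducible_intertwiner_inv irr irr hZ.
  by rewrite subr_eq0 => /eqP.
move=> [ZS1 _]; case/eqP: v0.
by rewrite -[v]mulmx1 -ZS1 mulmxA mulmxBr mul_mx_scalar vT subrr mul0mx.
Qed.

End Representations.

(** * Elementary tensors in the minimal tensor product *)

Section MinimalTensor.
Variables (R : realType) (A B T : cstarType R) (t : A -> B -> T).
Hypothesis tP : min_tensor t.
Local Notation C := R[i].

Lemma hilbert_tensor_sep (H K L : hilbertType R) (tH : H -> K -> L) z :
  hilbert_tensor tH -> (forall x y, ip z (tH x y) = 0) -> z = 0.
Proof.
move=> [_ dense] z0; apply/eqP; rewrite -normr_eq0; apply/eqP.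
have lt_e (e : C) : 0 < e -> `|z| <= e.
  move=> e0; have [s hs] := dense z e e0; apply: le_trans (ltW hs).
  set w := \sum_(q <- s) _ in hs *.
  have zw : ip z w = 0 by rewrite ip_sumr big1.
  have wz : ip w z = 0 by rewrite ip_conj zw rmorph0.
  rewrite -(ler_pXn2r (n := 2)) ?nnegrE // -!ip_norm ipBl !ipBr zw wz.
  by rewrite subr0 sub0r opprK lerDl ip_ge0.
apply/eqP; rewrite normr_eq0; apply: contraT => z1.
have z2 : 0 < `|z| by rewrite normr_gt0.
have := lt_e _ (divr_gt0 z2 (ltr0Sn C 1)).
by rewrite ler_pdivlMr // mulr_natr mulr2n -[leRHS]addr0 lerD2l (lt_geF z2).
Qed.

Lemma min_tensor_lin c a a' d b b' :
  t (c *: a + a') (d *: b + b') =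
    (c * d) *: t a b + c *: t a b' + d *: t a' b + t a' b'.
Proof.
have [[H [K [L [tH [pA [pB [pT [tHP fA fB fT pTt]]]]]]]] _] := tP.
have [ipE _] := tHP.
apply/eqP; rewrite -subr_eq0; set Z := (X in X == 0); apply/eqP.
(* [pT] is known on elementary tensors only. Replacing Z by its adjoint lets Z be moved across the
   inner product onto an elementary tensor, so no continuity argument is needed. *)
apply: (can_inj starK); rewrite raddf0; apply: (rep_inj fT) => z.
rewrite (rep0 fT); apply: (hilbert_tensor_sep tHP) => x y.
rewrite (rep_star fT) starK ip_conj; have -> : pT Z (tH x y) = 0; last by rewrite ip0l rmorph0.
apply: (hilbert_tensor_sep tHP) => x' y'.
rewrite /Z (repD fT) (repN fT) !(repD fT) !(repZ fT) !pTt.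
rewrite ipBl !ipDl !ipZl !ipE (repD fA) (repZ fA) (repD fB) (repZ fB) !ipDl !ipZl.
ring.
Qed.

Lemma min_tensorDl a a' b : t (a + a') b = t a b + t a' b.
Proof.
have := min_tensor_lin 1 a a' 0 0 b.
by rewrite mulr0 !scale0r !scale1r !add0r addr0.
Qed.

Lemma min_tensorDr a b b' : t a (b + b') = t a b + t a b'.
Proof.
have := min_tensor_lin 0 0 a 1 b b'.
by rewrite mul0r !scale0r !scale1r !add0r.
Qed.

Lemma min_tensor0l b : t 0 b = 0.
Proof. by apply: (addrI (t 0 b)); rewrite -min_tensorDl !addr0. Qed.

Lemma min_tensor0r a : t a 0 = 0.
Proof. by apply: (addrI (t a 0)); rewrite -min_tensorDr !addr0. Qed.

Lemma min_tensorZl c a b : t (c *: a) b = c *: t a b.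
Proof.
have := min_tensor_lin c a 0 0 b b.
by rewrite mulr0 !scale0r !add0r min_tensor0l !addr0.
Qed.

Lemma min_tensorZr d a b : t a (d *: b) = d *: t a b.
Proof.
have := min_tensor_lin 0 a a d b 0.
by rewrite mul0r !scale0r !add0r min_tensor0r !addr0.
Qed.

Lemma min_tensor_suml I (r : seq I) (F : I -> A) b :
  t (\sum_(i <- r) F i) b = \sum_(i <- r) t (F i) b.
Proof.
apply: (big_morph (fun a => t a b)) => [x y|]; first exact: min_tensorDl.
exact: min_tensor0l.
Qed.

Lemma min_tensor_sumr I (r : seq I) (F : I -> B) a :
  t a (\sum_(i <- r) F i) = \sum_(i <- r) t a (F i).
Proof.
apply: (big_morph (t a)) => [x y|]; first exact: min_tensorDr.
exact: min_tensor0r.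
Qed.

(* Injectivity of the algebraic tensor product into T: the coefficients b
   satisfy every linear equation m that all relations between the a satisfy. *)
Lemma min_tensor_sum_eq0 n (a : 'I_n -> A) (b : 'I_n -> B) (m : 'I_n -> C) :
  \sum_l t (a l) (b l) = 0 ->
  (forall c : 'I_n -> C, \sum_l c l *: a l = 0 -> \sum_l m l * c l = 0) ->
  \sum_l m l *: b l = 0.
Proof.
have [[H [K [L [tH [pA [pB [pT [tHP fA fB fT pTt]]]]]]]] _] := tP.
have [ipE _] := tHP.
move=> tab hm; apply: (rep_inj fB) => y; rewrite (rep0 fB).
apply: ip_sep => y'; rewrite ip0l (rep_bigsum fB) ip_suml.
under eq_bigr => l _ do rewrite (repZ fB) ipZl.
apply: hm; apply: (rep_inj fA) => x; rewrite (rep0 fA).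
apply: ip_sep => x'; rewrite ip0l (rep_bigsum fA) ip_suml.
transitivity (ip (pT (\sum_l t (a l) (b l)) (tH x y)) (tH x' y')).
  rewrite (rep_bigsum fT) ip_suml; apply: eq_bigr => l _.
  by rewrite (repZ fA) ipZl pTt ipE mulrC.
by rewrite tab (rep0 fT) ip0l.
Qed.
End MinimalTensor.

Section StarHom.
Variables (R : realType) (A B : cstarType R) (S : set A) (f : A -> B).
Hypotheses (SP : star_subalg S) (fP : star_hom_on S f).
Local Notation C := R[i].

Lemma star_subalg1 : S 1. Proof. by have [] := SP. Qed.
Lemma star_subalg0 : S 0.
Proof.
have [S1 Sl _ _] := SP; have := Sl (-1) 1 1 S1 S1.
by rewrite scaleN1r addNr.
Qed.
Lemma star_subalgZ c a : S a -> S (c *: a).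
Proof. by have [_ Sl _ _] := SP => Sa; rewrite -[_ *: _]addr0; apply: Sl star_subalg0. Qed.
Lemma star_subalgD a b : S a -> S b -> S (a + b).
Proof. by have [_ Sl _ _] := SP => Sa Sb; rewrite -[a]scale1r; apply: Sl. Qed.
Lemma star_subalgM a b : S a -> S b -> S (a * b).
Proof. by have [_ _ SM _] := SP; apply: SM. Qed.
Lemma star_subalgJ a : S a -> S (star a).
Proof. by have [_ _ _ SJ] := SP; apply: SJ. Qed.
Lemma star_subalg_sum I (r : seq I) (F : I -> A) :
  (forall i, S (F i)) -> S (\sum_(i <- r) F i).
Proof.
move=> h; elim/big_rec: _ => [|i x _ Sx]; first exact: star_subalg0.
exact: star_subalgD.
Qed.

Lemma star_hom1 : f 1 = 1. Proof. by have [] := fP. Qed.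
Lemma star_hom0 : f 0 = 0.
Proof.
have [f1 fl _ _] := fP; have := fl (-1) 1 1 star_subalg1 star_subalg1.
by rewrite f1 !scaleN1r !addNr.
Qed.
Lemma star_homZ c a : S a -> f (c *: a) = c *: f a.
Proof.
have [_ fl _ _] := fP => Sa; rewrite -[c *: a]addr0 fl //; last exact: star_subalg0.
by rewrite star_hom0 addr0.
Qed.
Lemma star_homD a b : S a -> S b -> f (a + b) = f a + f b.
Proof.
by have [_ fl _ _] := fP => Sa Sb; rewrite -[a in LHS]scale1r fl // scale1r.
Qed.
Lemma star_homM a b : S a -> S b -> f (a * b) = f a * f b.
Proof. by have [_ _ fM _] := fP; apply: fM. Qed.
Lemma star_homJ a : S a -> f (star a) = star (f a).
Proof. by have [_ _ _ fJ] := fP; apply: fJ. Qed.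
Lemma star_hom_sum I (r : seq I) (F : I -> A) :
  (forall i, S (F i)) -> f (\sum_(i <- r) F i) = \sum_(i <- r) f (F i).
Proof.
move=> h; elim: r => [|i r IH]; first by rewrite !big_nil star_hom0.
by rewrite !big_cons star_homD ?IH //; apply: star_subalg_sum.
Qed.

Lemma star_hom_mulmx m n k (M : 'M[A]_(m, n)) (N : 'M[A]_(n, k)) :
  (forall i j, S (M i j)) -> (forall i j, S (N i j)) ->
  map_mx f (M *m N) = map_mx f M *m map_mx f N.
Proof.
move=> SM SN; apply/matrixP => i j; rewrite !mxE star_hom_sum => [|l].
  by apply: eq_bigr => l _; rewrite !mxE star_homM.
exact: star_subalgM.
Qed.

Lemma star_hom_scmx m n (X : 'M[C]_(m, n)) : map_mx f (scmx A X) = scmx B X.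
Proof.
by apply/matrixP => i j; rewrite !mxE /= star_homZ ?star_hom1 //; apply: star_subalg1.
Qed.

Lemma star_hom_dagmx m n (M : 'M[A]_(m, n)) : (forall i j, S (M i j)) ->
  map_mx f (dagmx M) = dagmx (map_mx f M).
Proof. by move=> SM; apply/matrixP => i j; rewrite !mxE star_homJ. Qed.

Lemma star_subalg_mulmx m n k (M : 'M[A]_(m, n)) (N : 'M[A]_(n, k)) :
  (forall i j, S (M i j)) -> (forall i j, S (N i j)) ->
  forall i j, S ((M *m N) i j).
Proof.
move=> SM SN i j; rewrite mxE; apply: star_subalg_sum => l.
exact: star_subalgM.
Qed.

Lemma star_subalg_scmx m n (X : 'M[C]_(m, n)) i j : S (scmx A X i j).
Proof. by rewrite mxE; apply/star_subalgZ/star_subalg1. Qed.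
End StarHom.

Lemma star_subalgT (R : realType) (A : cstarType R) : star_subalg (@setT A).
Proof. by []. Qed.

Section EquivalentRepresentations.
Variables (R : realType) (G : cmqg R).
Local Notation C := R[i].
Local Notation A := (qalg G).
Implicit Types r s : sqmx G.

Let dsub := @star_subalgT R A.

Lemma qdelta_linear_mx m n k l (X : 'M[C]_(m, n)) (M : 'M[A]_(n, k)) (Y : 'M[C]_(k, l)) i j :
  qdelta ((scmx A X *m M *m scmx A Y) i j) =
  \sum_p \sum_q (X i p * Y q j) *: qdelta (M p q).
Proof.
rewrite mxE (star_hom_sum dsub (qdelta_hom G)) // exchange_big; apply: eq_bigr => q _.
rewrite mxE mulr_suml (star_hom_sum dsub (qdelta_hom G)) //; apply: eq_bigr => p _.
rewrite !mxE /= -scalerAl mul1r -scalerAr mulr1 scalerA mulrC.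
by rewrite (star_homZ dsub (qdelta_hom G)).
Qed.

Lemma rep_equiv_is_rep r s : rep_equiv r s -> is_rep r -> is_rep s.
Proof.
move=> [T [T' [TT' T'T h]]] [[r' [rr' r'r]] dr].
have sE : s = scmx A T' *m r *m scmx A T :> 'M[A]_(sqdim s).
  by rewrite -mulmxA h mulmxA -scmxM T'T scmx1 mul1mx.
split.
  exists (scmx A T' *m r' *m scmx A T); rewrite sE.
  have TT'1 : scmx A T *m scmx A T' = 1%:M by rewrite -scmxM TT' scmx1.
  have T'T1 : scmx A T' *m scmx A T = 1%:M by rewrite -scmxM T'T scmx1.
  split.
    rewrite !mulmxA -(mulmxA (scmx A T' *m r)) TT'1 mulmx1.
    by rewrite -(mulmxA (scmx A T') r) rr' mulmx1.
  rewrite !mulmxA -(mulmxA (scmx A T' *m r')) TT'1 mulmx1.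
  by rewrite -(mulmxA (scmx A T') r') r'r mulmx1.
move=> i j; rewrite {1}sE qdelta_linear_mx.
have tP := qtimes_min G.
pose F p q l := (T' i p * T q j) *: qtimes (r p l) (r l q).
transitivity (\sum_l \sum_p \sum_q F p q l).
  rewrite [RHS]exchange_big; apply: eq_bigr => p _.
  rewrite [RHS]exchange_big; apply: eq_bigr => q _.
  by rewrite dr scaler_sumr.
(* T T' = 1 is inserted between the two legs: the middle index splits into a and b, and l becomes
   the summation index for the entries of s. *)
transitivity (\sum_a \sum_b \sum_l (T a l * T' l b) *:
    qtimes ((scmx A T' *m r) i a) ((r *m scmx A T) b j)).
  transitivity (\sum_a qtimes ((scmx A T' *m r) i a) ((r *m scmx A T) a j)).
    apply: eq_bigr => a _; rewrite !mxE (min_tensor_suml tP); apply: eq_bigr => p _.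
    rewrite (min_tensor_sumr tP); apply: eq_bigr => q _.
    rewrite !mxE /= -scalerAl mul1r -scalerAr mulr1.
    by rewrite (min_tensorZl tP) (min_tensorZr tP) scalerA.
  apply: eq_bigr => a _; rewrite (bigD1 a) //= [X in _ = _ + X]big1 ?addr0 => [|b ab].
    rewrite -scaler_suml; have /matrixP/(_ a a) := TT'.
    by rewrite !mxE eqxx => ->; rewrite scale1r.
  rewrite -scaler_suml; have /matrixP/(_ a b) := TT'.
  by rewrite !mxE eq_sym (negPf ab) => ->; rewrite scale0r.
under eq_bigr => a _ do rewrite exchange_big.
rewrite exchange_big; apply: eq_bigr => l _; rewrite sE.
have -> : (scmx A T' *m r *m scmx A T) i l =
    \sum_a T a l *: (scmx A T' *m r) i a.
  by rewrite mxE; apply: eq_bigr => a _; rewrite [scmx A T _ _]mxE /= -scalerAr mulr1.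
have -> : (scmx A T' *m r *m scmx A T) l j =
    \sum_b T' l b *: (r *m scmx A T) b j.
  rewrite -mulmxA mxE; apply: eq_bigr => a _.
  by rewrite [scmx A T' _ _]mxE /= -scalerAl mul1r.
rewrite (min_tensor_suml tP); apply: eq_bigr => a _.
rewrite (min_tensor_sumr tP); apply: eq_bigr => b _.
by rewrite (min_tensorZl tP) (min_tensorZr tP) scalerA.
Qed.

Lemma rep_equiv_irreducible r s :
  rep_equiv r s -> rep_irreducible r -> rep_irreducible s.
Proof.
move=> rs [rr r0 irr]; have sr := rep_equiv_is_rep rs rr.
have [T [T' [TT' T'T h]]] := rs.
have [T0 [T0' [_ _ h']]] := rep_equiv_sym rs.
split=> //.
  rewrite lt0n; apply/eqP => s0.
  have : (1%:M : 'M[C]_(sqdim r)) = 0.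
    rewrite -TT'; apply/matrixP => i j; rewrite !mxE big1 // => k _.
    by case: (k) => m hm; exfalso; move: hm; rewrite s0.
  move/matrixP/(_ (Ordinal r0) (Ordinal r0)); rewrite !mxE eqxx => /eqP.
  by rewrite oner_eq0.
move=> P PP hP.
have T'1 : scmx A T' *m r = s *m scmx A T'.
  have := congr1 (fun X => scmx A T' *m X *m scmx A T') h.
  rewrite !mulmxA -scmxM T'T scmx1 mul1mx => <-.
  by rewrite -(mulmxA _ (scmx A T)) -scmxM TT' scmx1 mulmx1.
have [||TPT|TPT] := irr (T *m P *m T').
- rewrite !mulmxA -(mulmxA (T *m P)) T'T mulmx1 -(mulmxA T) PP //.
- have E : r *m scmx A (T *m P *m T') = scmx A T *m (s *m scmx A P) *m scmx A T'.
    by rewrite !scmxM !mulmxA h.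
  rewrite E -{2}hP !scmxM !mulmxA -(mulmxA (scmx A T *m scmx A P)) -(scmxM _ T' T) T'T.
  by rewrite scmx1 mulmx1.
- left; have := congr1 (fun X => T' *m X *m T) TPT.
  by rewrite !mulmxA T'T mul1mx -mulmxA T'T mulmx1 mulmx0 mul0mx.
- right; have := congr1 (fun X => T' *m X *m T) TPT.
  by rewrite !mulmxA T'T mul1mx -mulmxA T'T mulmx1 mulmx1 T'T.
Qed.
End EquivalentRepresentations.

Lemma unitmx_of_cols (F : fieldType) n (M : 'M[F]_n) :
  (forall z : 'cV_n, M *m z = 0 -> z = 0) -> M \in unitmx.
Proof.
move=> h; rewrite -unitmx_tr -row_free_unit; apply: inj_row_free => v hv.
apply: (can_inj trmxK); rewrite trmx0; apply: h.
by rewrite -[M]trmxK -trmx_mul hv trmx0.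
Qed.

Section InvariantForm.
Variables (R : realType) (G : cmqg R).
Local Notation C := R[i].
Local Notation A := (qalg G).
Implicit Types u s : sqmx G.

(** The entries are listed in the index order of the Kronecker product, so that this row can be
    multiplied by \bar u (x) u. *)
Let row_of n (B : 'M[C]_n) : 'rV[C]_(n * n) :=
  \row_k B (mxtens_unindex k).1 (mxtens_unindex k).2.

Lemma row_bar_tensor n (u : 'M[A]_n) (B : 'M[C]_n) i j :
  (scmx A (row_of B) *m (barmx u *t u)) 0 (mxtens_index (i, j)) =
  (dagmx u *m scmx A B *m u) i j.
Proof.
rewrite mxE [RHS]mxE.
under [RHS]eq_bigr => q _ do rewrite mxE mulr_suml.
rewrite exchange_big pair_big /= (reindex (@mxtens_index n n)) /=; last first.
  by exists (@mxtens_unindex n n) => k _; rewrite ?mxtens_indexK ?mxtens_unindexK.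
apply: eq_bigr => -[p q] _ /=.
rewrite tensmxE !mxE !mxtens_indexK /=.
by rewrite -scalerAl mul1r -!scalerAr mulr1 scalerAl.
Qed.

(* A form B invariant in mean is a row vector fixed by the mean of
   bar u (x) u ~ 1 (+) s.  Since the mean of s has no fixed vector, it has no
   fixed covector either, so B lives on the trivial summand. *)
Lemma exists_invariant_form u s : is_rep u -> is_rep s ->
  (forall z, s *m scmx A z = scmx A z -> z = 0 :> 'cV[C]_(sqdim s)) ->
  rep_equiv (rep_tensor (rep_bar u) u) (rep_add (rep_one G) s) ->
  exists2 Q : 'M[C]_(sqdim u), Q \in unitmx &
    dagmx u *m scmx A (adjmx Q *m Q) *m u = scmx A (adjmx Q *m Q).
Proof.
move=> [[u' [_ u'u]] du] [[s' [_ s's]] ds] nofix [X [X' [XX' X'X hX]]].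
have [[H [K [L [tH [pA [pB [pT [tHP fA fB fT pTt]]]]]]]] _] := qtimes_min G.
(* 1 serves to normalize the state; the entries of s are where [mean_fixed_fixed] needs it to be
   faithful. *)
pose E := 1 :: [seq s k.1 k.2 | k : 'I_(sqdim s) * 'I_(sqdim s)].
have [xs xs1 sepE] := exists_separating_state fA (mem_head _ _ : 1 \in E).
have Es i j : s i j \in E.
  by rewrite inE; apply/orP; right; apply/mapP; exists (i, j); rewrite ?mem_enum.
have [Q Qu QE] := invariant_form tHP fA fB fT pTt (qdelta_hom G) xs1 u'u du.
exists Q => //; move: (adjmx Q *m Q) QE => B BE {Q Qu}.
pose phi m k (M : 'M[A]_(m, k)) := map_mx (vstate pA xs) M.
have phis : phi _ _ s - 1%:M \in unitmx.
  apply: unitmx_of_cols => z; rewrite mulmxBl mul1mx => /eqP.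
  rewrite subr_eq0 => /eqP hz; apply: nofix.
  exact: (mean_fixed_fixed tHP fA fB fT pTt (qdelta_hom G) xs1 s's ds sepE
    (mem_head _ _) Es hz).
pose b := row_of B.
have bphi : b *m phi _ _ (barmx u *t u) = b.
  rewrite /phi -(vstate_mulmxl fA); apply/rowP => k.
  case: (mxtens_indexP k) => i j; rewrite mxE row_bar_tensor.
  by rewrite [RHS]mxE mxtens_indexK /= -[in RHS]BE [RHS]mxE.
pose c := b *m X.
have cphi : c *m phi _ _ (block_mx 1%:M 0 0 s) = c.
  rewrite /c -mulmxA /phi -(vstate_mulmxl fA) -[in LHS]hX (vstate_mulmxr fA) mulmxA.
  by rewrite -/(phi _ _ _) bphi.
have cR : rsubmx c = 0.
  have : rsubmx c *m (phi _ _ s - 1%:M) = 0.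
    rewrite mulmxBr mulmx1; apply/eqP; rewrite subr_eq0; apply/eqP.
    rewrite -[c in RHS]cphi -[c in RHS]hsubmxK /phi map_block_mx.
    have phi0 m k : map_mx (vstate pA xs) (0 : 'M[A]_(m, k)) = 0.
      by apply/matrixP => i j; rewrite !mxE vstate0.
    by rewrite !phi0 mul_row_block row_mxKr mulmx0 add0r.
  by move=> h; rewrite -[rsubmx c](mulmxK phis) h mul0mx.
have cfix : scmx A c *m block_mx 1%:M 0 0 s = scmx A c.
  rewrite -[c]hsubmxK cR /scmx map_row_mx map_mx0 mul_row_block.
  by rewrite mulmx1 !mul0mx !mulmx0 !addr0.
have bfix : scmx A b *m (barmx u *t u) = scmx A b.
  have -> : barmx u *t u = scmx A X *m block_mx 1%:M 0 0 s *m scmx A X'.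
    by rewrite -[X in X *m _]hX -mulmxA -scmxM XX' scmx1 mulmx1.
  rewrite !mulmxA -scmxM cfix -scmxM /c -mulmxA XX' mulmx1 //.
apply/matrixP => i j; rewrite -row_bar_tensor -/b bfix !mxE.
by rewrite mxtens_indexK.
Qed.
End InvariantForm.

(** * Transfer of coefficients between algebras *)

Section DirectSums.
Variables (R : realType) (G : cmqg R) (r : NN -> sqmx G).
Local Notation C := R[i].
Local Notation A := (qalg G).
Hypothesis r_irr : forall x, rep_irreducible (r x).
Hypothesis r_distinct : forall x y, rep_equiv (r x) (r y) -> x = y.

Fixpoint bdim (xs : seq NN) : nat :=
  if xs is x :: xs' then (sqdim (r x) + bdim xs')%N else 0%N.

(** The algebra is a parameter while the sizes depend on the words alone: one scalar matrix can thus
    be tested as an intertwiner over A and over D. *)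
Fixpoint bsum (S : cstarType R) (M : forall x, 'M[S]_(sqdim (r x))) xs : 'M[S]_(bdim xs) :=
  if xs is x :: xs' then block_mx (M x) 0 0 (bsum M xs') else 0.

Local Notation rho := (bsum (fun x => sqval (r x))).

(** Complete reducibility, where the invariant subspace is the image of K; the first two clauses
    make e an idempotent with that image. By irreducibility of [r x], the top block of K is zero or
    onto, and the induction runs on the remaining blocks. *)
Lemma invariant_summand xs k (K : 'M[C]_(bdim xs, k)) (Z : 'M[A]_k) :
  rho xs *m scmx A K = scmx A K *m Z ->
  exists e L, [/\ e = K *m L, e *m K = K & rho xs *m scmx A e = scmx A e *m rho xs].
Proof.
elim: xs k K Z => [|x xs IH] k /= K Z.
  by move=> _; exists 0, 0; split; apply/matrixP => -[].
rewrite -[K]vsubmxK; move: (usubmx K) (dsubmx K) => K1 K' {K}.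
rewrite scmx_col mul_block_col mul_col_mx !mul0mx addr0 add0r.
move=> /eq_col_mx[h1 h'].
have [_ _ irr] := r_irr x.
have [S0 KSK] : exists S0, K1 *m S0 *m K1 = K1 by exists (pinvmx K1); apply: mulmxKpV.
have [K10|K1S] : K1 = 0 \/ K1 *m S0 = 1%:M.
  have hP : (K1 *m S0) *m (K1 *m S0) = K1 *m S0 by rewrite mulmxA KSK.
  have [|P0|] := irr _ hP; last by right.
    have -> : r x *m scmx A (K1 *m S0) = scmx A K1 *m (Z *m scmx A S0).
      by rewrite scmxM !mulmxA h1.
    by rewrite mulmxA -scmxM KSK.
  by left; rewrite -KSK P0 mul0mx.
- have [e' [L' [eE eK er]]] := IH _ _ _ h'.
  exists (block_mx 0 0 0 e'), (row_mx 0 L'); split.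
  + by rewrite K10 mul_col_row !mul0mx mulmx0 -eE.
  + by rewrite K10 mul_block_col !mul0mx !add0r eK.
  + rewrite scmx_block !scmx0 !mulmx_block !mulmx0 !mul0mx.
    by rewrite !addr0 !add0r er.
(* N projects onto the kernel of K1, so K' N spans the lower parts of those vectors of the subspace
   whose upper part is 0. *)
pose N : 'M[C]_k := 1%:M - S0 *m K1.
have [N' N'E] : exists N', N' = N by exists N.
have K1N : K1 *m N' = 0 by rewrite N'E mulmxBr mulmx1 mulmxA KSK subrr.
have NZN : Z *m scmx A N' = scmx A N' *m (Z *m scmx A N').
  have z0 : scmx A K1 *m Z *m scmx A N' = 0 by rewrite -h1 -mulmxA -scmxM K1N scmx0 mulmx0.
  rewrite {2}N'E scmxB scmx1 mulmxBl mul1mx scmxM -mulmxA (mulmxA (scmx A K1)) z0.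
  by rewrite mulmx0 subr0.
have hN : rho xs *m scmx A (K' *m N') = scmx A (K' *m N') *m (Z *m scmx A N').
  by rewrite scmxM mulmxA h' -[in RHS]mulmxA -NZN mulmxA.
have [e' [L' [eE eK er]]] := IH _ _ _ hN.
(* Modulo the smaller subspace just split off, the lower part of a vector is a function of its upper
   part. T is that function, and 1 - e' picks the representative in the complement. *)
have [T TE] : exists T, T = (1%:M - e') *m K' *m S0 by exists ((1%:M - e') *m K' *m S0).
have eKN : (1%:M - e') *m (K' *m N') = 0 by rewrite mulmxBl mul1mx eK subrr.
have eKN' : (1%:M - e') *m K' *m N' = 0 by rewrite -mulmxA.
have rT : rho xs *m scmx A T = scmx A T *m r x.
  have -> : rho xs *m scmx A T = scmx A (1%:M - e') *m (scmx A K' *m Z *m scmx A S0).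
    rewrite TE !scmxM -h' !mulmxA; congr (_ *m _ *m _).
    by rewrite scmxB scmx1 mulmxBl mulmxBr mulmx1 mul1mx er.
  have ZS : Z *m scmx A S0 = scmx A N' *m (Z *m scmx A S0) + scmx A S0 *m r x.
    rewrite N'E scmxB scmx1 mulmxBl mul1mx scmxM.
    have -> : scmx A S0 *m scmx A K1 *m (Z *m scmx A S0) = scmx A S0 *m r x.
      by rewrite -mulmxA (mulmxA (scmx A K1)) -h1 -mulmxA -scmxM K1S scmx1 mulmx1.
    by rewrite subrK.
  rewrite -mulmxA ZS mulmxDr [_ *m (_ + _)]mulmxDr !mulmxA -!scmxM eKN'.
  by rewrite scmx0 !mul0mx add0r TE.
exists (block_mx 1%:M 0 T e'), (row_mx (S0 - N' *m L' *m K' *m S0) (N' *m L')); split.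
- rewrite mul_col_row !mulmxBr !mulmxA K1S K1N !mul0mx subr0; congr block_mx => //.
  by rewrite -eE TE !mulmxBl mul1mx.
- rewrite mul_block_col mul1mx mul0mx addr0; congr col_mx.
  have -> : T *m K1 = (1%:M - e') *m K'.
    have -> : T *m K1 = (1%:M - e') *m K' - (1%:M - e') *m (K' *m N').
      have -> : K' *m N' = K' - K' *m S0 *m K1 by rewrite N'E mulmxBr mulmx1 mulmxA.
      by rewrite [_ *m (K' - _)]mulmxBr subKr TE !mulmxA.
    by rewrite eKN subr0.
  by rewrite mulmxBl mul1mx subrK.
- rewrite scmx_block scmx0 scmx1 !mulmx_block !mulmx0 !mul0mx !mulmx1 !mul1mx.
  by rewrite !addr0 !add0r rT er.
Qed.

Variables (D : cstarType R) (rh : forall x, 'M[D]_(sqdim (r x))).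
Local Notation rhoh := (bsum rh).

(** No condition on [rh] is needed: by Schur the intertwiner is 0 or a scalar, and these commute
    with everything. *)
Lemma intertwiner_transfer_irr x y (T : 'M[C]_(sqdim (r x), sqdim (r y))) :
  r x *m scmx A T = scmx A T *m r y -> rh x *m scmx D T = scmx D T *m rh y.
Proof.
move=> h; have [xy|xy] := eqVneq x y.
  subst y; have [c ->] := schur_scalar (r_irr x) h.
  by rewrite scmx_scalarC.
have [->|/r_distinct e] := irreducible_intertwiner (r_irr x) (r_irr y) h.
  by rewrite !scmx0 mulmx0 mul0mx.
by rewrite e eqxx in xy.
Qed.

Lemma intertwiner_transfer xs ys (T : 'M[C]_(bdim xs, bdim ys)) :
  rho xs *m scmx A T = scmx A T *m rho ys -> rhoh xs *m scmx D T = scmx D T *m rhoh ys.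
Proof.
elim: ys xs T => [|y ys IHy] xs /= T.
  by move=> _; apply/matrixP => i [].
rewrite -[T]hsubmxK !scmx_row !mul_mx_row !mul_row_block !mulmx0 !addr0 !add0r.
move=> /eq_row_mx[h /IHy h']; congr row_mx; last exact: h'.
move: (lsubmx T) h => {IHy h'}T h.
elim: xs T h => [|x xs IHx] /= T; first by move=> _; apply/matrixP => -[].
rewrite -[T]vsubmxK !scmx_col !mul_block_col !mul0mx !addr0 !add0r !mul_col_mx.
move=> /eq_col_mx[h /IHx h']; congr col_mx; last exact: h'.
exact: intertwiner_transfer_irr.
Qed.

Lemma rho_invertible xs : exists M, rho xs *m M = 1%:M.
Proof.
elim: xs => [|x xs [M IH]] /=; first by exists 0; apply/matrixP => -[].
have [[[m [hm _]] _] _ _] := r_irr x.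
exists (block_mx m 0 0 M).
by rewrite mulmx_block !mulmx0 !mul0mx !addr0 !add0r hm IH -scalar_mx_block.
Qed.

Lemma rho_delta xs i j :
  qdelta (rho xs i j) = \sum_l qtimes (rho xs i l) (rho xs l j).
Proof.
have tP := qtimes_min G.
have d0 : qdelta (0 : A) = 0 by exact: (star_hom0 (@star_subalgT R A) (qdelta_hom G)).
elim: xs i j => [|x xs IH] /= i j; first by case: i.
have [[_ dr] _ _] := r_irr x.
rewrite sumr_add; case: (split_ordP i) => i' ->; case: (split_ordP j) => j' ->.
- rewrite block_mxEul dr [X in _ = _ + X]big1 ?addr0 => [|l _]; last first.
    by rewrite block_mxEur [X in qtimes X _]mxE (min_tensor0l tP).
  by apply: eq_bigr => l _; rewrite !block_mxEul.
- rewrite block_mxEur mxE d0 !big1 ?addr0 // => l _.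
    by rewrite !block_mxEur [X in qtimes X _]mxE (min_tensor0l tP).
  by rewrite block_mxEul block_mxEur [X in qtimes _ X]mxE (min_tensor0r tP).
- rewrite block_mxEdl mxE d0 !big1 ?addr0 // => l _.
    by rewrite block_mxEdr block_mxEdl [X in qtimes _ X]mxE (min_tensor0r tP).
  by rewrite !block_mxEdl [X in qtimes X _]mxE (min_tensor0l tP).
- rewrite block_mxEdr IH [X in _ = X + _]big1 ?add0r => [|l _]; last first.
    by rewrite block_mxEdl [X in qtimes X _]mxE (min_tensor0l tP).
  by apply: eq_bigr => l _; rewrite !block_mxEdr.
Qed.

(** The scalar vectors killed by a form a subspace of C^n although the entries of a lie in A; K, a
    projection onto it, comes from a solution of maximal rank. *)
Lemma scalar_kernel n (a : 'rV[A]_n) : exists2 K : 'M[C]_n,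
  a *m scmx A K = 0 &
  forall k (V : 'M[C]_(n, k)), a *m scmx A V = 0 -> K *m V = V.
Proof.
pose P k := `[< exists2 K : 'M[C]_n, a *m scmx A K = 0 & \rank K = k >].
have exP : exists k, P k.
  by exists 0%N; apply/asboolP; exists 0; rewrite ?scmx0 ?mulmx0 ?mxrank0.
have bdP k : P k -> (k <= n)%N.
  by move=> /asboolP[K _ <-]; apply: rank_leq_row.
case: (ex_maxnP exP bdP) => d /asboolP[K0 aK0 rK0] dmax.
have [S KSK] : exists S, K0 *m S *m K0 = K0 by exists (pinvmx K0); apply: mulmxKpV.
exists (K0 *m S) => [|k V aV]; first by rewrite scmxM mulmxA aK0 mul0mx.
have [Y WE] : exists Y, (K0^T + V^T)%MS = Y *m col_mx K0^T V^T.
  by apply/submxP; rewrite addsmxE.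
have aW : a *m scmx A ((K0^T + V^T)%MS)^T = 0.
  rewrite WE trmx_mul tr_col_mx !trmxK scmxM mulmxA scmx_row mul_mx_row.
  by rewrite aK0 aV row_mx0 mul0mx.
have : (V^T <= K0^T)%MS.
  have [le_r] := mxrank_leqif_sup (addsmxSl K0^T V^T).
  have -> : \rank K0^T == \rank (K0^T + V^T)%MS.
    rewrite eqn_leq le_r mxrank_tr rK0 dmax //.
    by apply/asboolP; exists ((K0^T + V^T)%MS)^T => //; rewrite mxrank_tr.
  by move=> /esym; apply: submx_trans; apply: addsmxSr.
move=> /submxP[Z /(congr1 trmx)]; rewrite trmx_mul !trmxK => ->.
by rewrite mulmxA KSK.
Qed.

(* This plays the role of the linear independence of the coefficients of
   inequivalent irreducible representations: the kernel K of f rho is invariant,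
   hence the image of an idempotent intertwiner e, and f e = 0. *)
Lemma coefficient_transfer xs (f : 'rV[C]_(bdim xs)) (v : 'cV[C]_(bdim xs)) :
  scmx A f *m rho xs *m scmx A v = 0 -> scmx D f *m rhoh xs *m scmx D v = 0.
Proof.
move=> fv0.
have [K aK Kmax] := scalar_kernel (scmx A f *m rho xs).
have tP := qtimes_min G.
(* Invariance of the kernel: delta applied to f rho K = 0 gives a vanishing sum of tensors of f rho
   and rho K. The relations among the entries of f rho are the vectors fixed by K, so the rows of 1
   - K annihilate rho K. *)
have rK0 : scmx A (1%:M - K) *m (rho xs *m scmx A K) = 0.
  apply/matrixP => i j; rewrite [RHS]mxE mxE.
  transitivity (\sum_l (1%:M - K) i l *: (rho xs *m scmx A K) l j).
    by apply: eq_bigr => l _; rewrite [scmx _ _ i l]mxE /= -scalerAl mul1r.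
  apply: (min_tensor_sum_eq0 tP (a := fun l => (scmx A f *m rho xs) 0 l)) => [|c hc].
    transitivity (qdelta ((scmx A f *m rho xs *m scmx A K) 0 j)); last first.
      by rewrite aK mxE; exact: (star_hom0 (@star_subalgT R A) (qdelta_hom G)).
    rewrite qdelta_linear_mx.
    transitivity (\sum_l \sum_p \sum_q (f 0 p * K q j) *:
        qtimes (rho xs p l) (rho xs l q)).
      apply: eq_bigr => l _; rewrite !mxE (min_tensor_suml tP); apply: eq_bigr => p _.
      rewrite (min_tensor_sumr tP); apply: eq_bigr => q _.
      rewrite !mxE /= -scalerAl mul1r -scalerAr mulr1.
      by rewrite (min_tensorZl tP) (min_tensorZr tP) scalerA.
    rewrite exchange_big; apply: eq_bigr => p _.
    rewrite exchange_big; apply: eq_bigr => q _.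
    by rewrite rho_delta scaler_sumr.
  pose cv : 'cV[C]_(bdim xs) := \col_l c l.
  have : K *m cv = cv.
    apply: Kmax; apply/matrixP => i' j'; rewrite [i']ord1 [j']ord1 [RHS]mxE -[RHS]hc.
    rewrite mxE; apply: eq_bigr => l _.
    by rewrite [scmx A cv l 0]mxE /= -scalerAr mulr1 mxE.
  move=> Kcv; transitivity (((1%:M - K) *m cv) i 0).
    by rewrite [RHS]mxE; apply: eq_bigr => l _; rewrite [cv l 0]mxE.
  by rewrite mulmxBl mul1mx Kcv subrr mxE.
have rK : rho xs *m scmx A K = scmx A K *m (rho xs *m scmx A K).
  apply/eqP; rewrite -subr_eq0; apply/eqP; rewrite -[RHS]rK0.
  by rewrite scmxB scmx1 mulmxBl mul1mx.
have [e [L [eE eK er]]] := invariant_summand rK.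
(* f rho e = 0 because e = K L; then e is moved across rho, and rho is cancelled. *)
have fe : f *m e = 0.
  have [M hM] := rho_invertible xs.
  apply: (@scmx_inj R A); rewrite scmx0 -[LHS]mulmx1 -hM mulmxA scmxM.
  by rewrite -(mulmxA (scmx A f)) -er mulmxA eE scmxM mulmxA aK !mul0mx.
have ve : e *m v = v.
  by have Kv := Kmax _ v fv0; rewrite -[in LHS]Kv mulmxA eK.
have eh := intertwiner_transfer er.
rewrite -ve scmxM mulmxA -(mulmxA (scmx D f)) eh mulmxA -scmxM fe.
by rewrite scmx0 !mul0mx.
Qed.
End DirectSums.

Lemma exchange_big4 (V : nmodType) (I J K L : finType) (F : I -> J -> K -> L -> V) :
  \sum_i \sum_j \sum_k \sum_l F i j k l = \sum_k \sum_l \sum_i \sum_j F i j k l.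
Proof.
transitivity (\sum_i \sum_k \sum_j \sum_l F i j k l).
  by apply: eq_bigr => i _; rewrite exchange_big.
rewrite exchange_big; apply: eq_bigr => k _; rewrite [RHS]exchange_big.
by apply: eq_bigr => i _; rewrite exchange_big.
Qed.

(** * Frobenius reciprocity *)

Section Frobenius.
Variables (R : realType) (n : nat).
Local Notation C := R[i].

(** In diagrams, [cup_mate] is (J (x) 1)(1 (x) cup), and [cap_mate] is (1 (x) cap)(I (x) 1): the
    matrices cup and cap encode a vector in C^n (x) C^n and a form on it. *)
Definition cup_mate m p (J : 'M[C]_(m, p * n)) (cup : 'M[C]_n) : 'M[C]_(m * n, p) :=
  \matrix_(k, b) \sum_q J (mxtens_unindex k).1 (mxtens_index (b, q)) *
                        cup q (mxtens_unindex k).2.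

Definition cap_mate m p (I : 'M[C]_(p * n, m)) (cap : 'M[C]_n) : 'M[C]_(p, m * n) :=
  \matrix_(b, k) \sum_q cap q (mxtens_unindex k).2 *
                        I (mxtens_index (b, q)) (mxtens_unindex k).1.

Lemma cup_mate_eq0 m p (J : 'M[C]_(m, p * n)) (cup : 'M[C]_n) :
  cup \in unitmx -> cup_mate J cup = 0 -> J = 0.
Proof.
move=> cu J0.
have h a b : \row_q J a (mxtens_index (b, q)) *m cup = 0.
  apply/rowP => l; have /matrixP/(_ (mxtens_index (a, l)) b) := J0.
  rewrite !mxE mxtens_indexK /= => e; rewrite -[RHS]e.
  by apply: eq_bigr => q _; rewrite mxE.
apply/matrixP => a k; case: (mxtens_indexP k) => b q.
have := congr1 (fun X => (X *m invmx cup) 0 q) (h a b).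
by rewrite mulmxK // mul0mx !mxE.
Qed.

Lemma cap_mate_eq0 m p (I : 'M[C]_(p * n, m)) (cap : 'M[C]_n) :
  cap \in unitmx -> cap_mate I cap = 0 -> I = 0.
Proof.
move=> cu I0.
have h a b : \row_q I (mxtens_index (b, q)) a *m cap = 0.
  apply/rowP => l; have /matrixP/(_ b (mxtens_index (a, l))) := I0.
  rewrite !mxE mxtens_indexK /= => e; rewrite -[RHS]e.
  by apply: eq_bigr => q _; rewrite mxE mulrC.
apply/matrixP => k a; case: (mxtens_indexP k) => b q.
have := congr1 (fun X => (X *m invmx cap) 0 q) (h a b).
by rewrite mulmxK // mul0mx !mxE.
Qed.

Variables (S : cstarType R).

Lemma sum_mxtens m p (F : 'I_(m * p) -> S) :
  \sum_k F k = \sum_a \sum_b F (mxtens_index (a, b)).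
Proof.
rewrite pair_big (reindex (@mxtens_index m p)) /=; first by apply: eq_bigr => -[].
by exists (@mxtens_unindex m p) => k _; rewrite ?mxtens_indexK ?mxtens_unindexK.
Qed.

(** The factor L2 stands immediately to the right of L1 in every product, so the relation for cup
    applies without commuting entries. *)
Lemma cup_mate_intertwiner m p (J : 'M[C]_(m, p * n)) cup
    (X : 'M[S]_m) (Y : 'M[S]_p) (L1 L2 : 'M[S]_n) :
  X *m scmx S J = scmx S J *m (Y *t L1) ->
  L1 *m scmx S cup *m L2^T = scmx S cup ->
  (X *t L2) *m scmx S (cup_mate J cup) = scmx S (cup_mate J cup) *m Y.
Proof.
move=> XJ cupE; apply/matrixP => k b; case: (mxtens_indexP k) => a l.
rewrite !mxE sum_mxtens.
transitivity (\sum_l' \sum_q cup q l' *: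
    ((X *m scmx S J) a (mxtens_index (b, q)) * L2 l l')).
  rewrite exchange_big; apply: eq_bigr => l' _.
  under [RHS]eq_bigr => q _ do rewrite mxE mulr_suml scaler_sumr.
  rewrite [RHS]exchange_big; apply: eq_bigr => a' _.
  rewrite tensmxE !mxE mxtens_indexK /= -scalerAr mulr1 scaler_suml.
  apply: eq_bigr => q _.
  by rewrite !mxE /= -scalerAr mulr1 -scalerAl scalerA mulrC.
transitivity (\sum_b' \sum_q' J a (mxtens_index (b', q')) *:
    (Y b' b * (L1 *m scmx S cup *m L2^T) q' l)).
  transitivity (\sum_l' \sum_q \sum_b' \sum_q'
      J a (mxtens_index (b', q')) *: (Y b' b * (L1 q' q * scmx S cup q l' * L2 l l'))).
    apply: eq_bigr => l' _; apply: eq_bigr => q _.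
    rewrite XJ mxE sum_mxtens mulr_suml scaler_sumr; apply: eq_bigr => b' _.
    rewrite mulr_suml scaler_sumr; apply: eq_bigr => q' _.
    rewrite tensmxE !mxE /= -!scalerAl mul1r -!scalerAr -!scalerAl mulr1 -scalerAr.
    by rewrite !scalerA mulrC mulrA.
  transitivity (\sum_b' \sum_q' \sum_l' \sum_q
      J a (mxtens_index (b', q')) *: (Y b' b * (L1 q' q * scmx S cup q l' * L2 l l'))).
    exact: exchange_big4.
  apply: eq_bigr => b' _; apply: eq_bigr => q' _.
  rewrite mxE mulr_sumr scaler_sumr; apply: eq_bigr => l' _.
  by rewrite mxE [L2^T _ _]mxE mulr_suml mulr_sumr scaler_sumr.
apply: eq_bigr => b' _; rewrite cupE mxE mxE mxtens_indexK /= scaler_suml mulr_suml.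
apply: eq_bigr => q' _.
by rewrite mxE /= -scalerAr mulr1 scalerA -scalerAl mul1r.
Qed.

Lemma cap_mate_intertwiner m p (I : 'M[C]_(p * n, m)) cap
    (X : 'M[S]_m) (Y : 'M[S]_p) (L1 L2 : 'M[S]_n) :
  (Y *t L1) *m scmx S I = scmx S I *m X ->
  L1^T *m scmx S cap *m L2 = scmx S cap ->
  scmx S (cap_mate I cap) *m (X *t L2) = Y *m scmx S (cap_mate I cap).
Proof.
move=> IX capE; apply/matrixP => b k; case: (mxtens_indexP k) => a l.
rewrite !mxE sum_mxtens.
transitivity (\sum_l' \sum_q cap q l' *:
    ((scmx S I *m X) (mxtens_index (b, q)) a * L2 l' l)).
  rewrite exchange_big; apply: eq_bigr => l' _.
  under [RHS]eq_bigr => q _ do rewrite mxE mulr_suml scaler_sumr.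
  rewrite [RHS]exchange_big; apply: eq_bigr => a' _.
  rewrite tensmxE !mxE mxtens_indexK /= -scalerAl mul1r scaler_suml.
  apply: eq_bigr => q _.
  by rewrite !mxE /= -!scalerAl mul1r scalerA.
transitivity (\sum_b' \sum_q' I (mxtens_index (b', q')) a *:
    (Y b b' * (L1^T *m scmx S cap *m L2) q' l)).
  transitivity (\sum_l' \sum_q \sum_b' \sum_q'
      I (mxtens_index (b', q')) a *: (Y b b' * (L1 q q' * scmx S cap q l' * L2 l' l))).
    apply: eq_bigr => l' _; apply: eq_bigr => q _.
    rewrite -IX mxE sum_mxtens mulr_suml scaler_sumr; apply: eq_bigr => b' _.
    rewrite mulr_suml scaler_sumr; apply: eq_bigr => q' _.
    rewrite tensmxE !mxE /= -!scalerAr -!scalerAl !mulr1 -scalerAr.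
    by rewrite !scalerA mulrC mulrA.
  rewrite exchange_big4; apply: eq_bigr => b' _; apply: eq_bigr => q' _.
  rewrite mxE mulr_sumr scaler_sumr; apply: eq_bigr => l' _.
  rewrite mxE mulr_suml mulr_sumr scaler_sumr; apply: eq_bigr => q _.
  by rewrite [L1^T _ _]mxE.
apply: eq_bigr => b' _; rewrite capE [scmx S (cap_mate I cap) _ _]mxE mxE mxtens_indexK /=.
rewrite scaler_suml mulr_sumr.
apply: eq_bigr => q' _.
by rewrite mxE /= -scalerAr mulr1 -scalerAr mulr1 scalerA mulrC.
Qed.
End Frobenius.

(** * Transfer of the irreducible representations along the fusion rules *)

Section Transfer.
Variables (R : realType) (G : cmqg R) (r : NN -> sqmx G) (n : nat).
Variable D : cstarType R.
Local Notation C := R[i].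
Local Notation A := (qalg G).
Variables (LG : bool -> 'M[A]_n) (LD : bool -> 'M[D]_n).
Variables (cup cap : bool -> 'M[C]_n).

(* Words are reversed here, so that the head of s is the letter tensored last. *)
Hypothesis r_irr : forall s, rep_irreducible (r s).
Hypothesis r_distinct : forall s s', rep_equiv (r s) (r s') -> s = s'.
Hypothesis fusion_free : forall s c, ohead s != Some (~~ c) ->
  rep_equiv (rep_tensor (r s) (Sqmx (LG c))) (r (c :: s)).
Hypothesis fusion_cancel : forall s c,
  rep_equiv (rep_tensor (r (~~ c :: s)) (Sqmx (LG c))) (rep_add (r (c :: ~~ c :: s)) (r s)).
Hypotheses (cup_unit : forall c, cup c \in unitmx) (cap_unit : forall c, cap c \in unitmx).
Hypothesis cupG : forall c, LG (~~ c) *m scmx A (cup c) *m (LG c)^T = scmx A (cup c).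
Hypothesis capG : forall c, (LG (~~ c))^T *m scmx A (cap c) *m LG c = scmx A (cap c).
Hypothesis cupD : forall c, LD (~~ c) *m scmx D (cup c) *m (LD c)^T = scmx D (cup c).
Hypothesis capD : forall c, (LD (~~ c))^T *m scmx D (cap c) *m LD c = scmx D (cap c).

Local Notation d s := (sqdim (r s)).

(** Either r (c :: s) is the whole of r s (x) L c, or c cancels the last letter of the word and
    exactly one copy of r s0 remains. *)
Definition complement s c (I : 'M[C]_(d s * n, d (c :: s))) J :=
  I *m J = 1%:M \/
  exists s0 (I' : 'M[C]_(d s * n, d s0)) J', [/\ s = ~~ c :: s0,
    I *m J + I' *m J' = 1%:M, J' *m I' = 1%:M,
    (r s *t LG c) *m scmx A I' = scmx A I' *m r s0 &
    scmx A J' *m (r s *t LG c) = r s0 *m scmx A J'].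

Lemma exists_inclusion s c : exists (IJ : 'M[C]_(d s * n, d (c :: s)) *
    'M[C]_(d (c :: s), d s * n)),
  [/\ IJ.2 *m IJ.1 = 1%:M, (r s *t LG c) *m scmx A IJ.1 = scmx A IJ.1 *m r (c :: s),
      scmx A IJ.2 *m (r s *t LG c) = r (c :: s) *m scmx A IJ.2 &
      complement IJ.1 IJ.2].
Proof.
have [hs|] := eqVneq (ohead s) (Some (~~ c)); last first.
  move=> /fusion_free [I [J [IJ JI h]]].
  exists (I, J); split=> //=; last by left.
  have := congr1 (fun X => scmx A J *m X *m scmx A J) h.
  rewrite !mulmxA -scmxM JI scmx1 mul1mx => <-.
  by rewrite -mulmxA -scmxM IJ scmx1 mulmx1.
case: s hs => //= _ s [->].
have [T [T' [TT' T'T h]]] : exists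
    (T : 'M[C]_(d (~~ c :: s) * n, d (c :: ~~ c :: s) + d s))
    (T' : 'M[C]_(d (c :: ~~ c :: s) + d s, d (~~ c :: s) * n)),
    [/\ T *m T' = 1%:M, T' *m T = 1%:M &
      (r (~~ c :: s) *t LG c) *m scmx A T =
      scmx A T *m block_mx (r (c :: ~~ c :: s)) 0 0 (r s)] := fusion_cancel s c.
have h' : scmx A T' *m (r (~~ c :: s) *t LG c) =
    block_mx (r (c :: ~~ c :: s)) 0 0 (r s) *m scmx A T'.
  have := congr1 (fun X => scmx A T' *m X *m scmx A T') h.
  rewrite !mulmxA -scmxM T'T scmx1 mul1mx => <-.
  by rewrite -mulmxA -scmxM TT' scmx1 mulmx1.
move: TT' T'T h h'; rewrite -[T]hsubmxK -[T']vsubmxK.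
move: (lsubmx T) (rsubmx T) (usubmx T') (dsubmx T') => I I' J J'.
rewrite mul_row_col mul_col_row scalar_mx_block => IJ1 /eq_block_mx[JI _ _ J'I'].
rewrite scmx_row scmx_col mul_mx_row mul_row_block !mulmx0 addr0 add0r.
move=> /eq_row_mx[hI hI'].
rewrite mul_col_mx mul_block_col !mul0mx addr0 add0r => /eq_col_mx[hJ hJ'].
exists (I, J); split=> //=; right.
by exists s, I', J'.
Qed.

Definition incl s c := (projT1 (cid (exists_inclusion s c))).1.
Definition proj s c := (projT1 (cid (exists_inclusion s c))).2.

Lemma inclP s c : [/\ proj s c *m incl s c = 1%:M,
  (r s *t LG c) *m scmx A (incl s c) = scmx A (incl s c) *m r (c :: s),
  scmx A (proj s c) *m (r s *t LG c) = r (c :: s) *m scmx A (proj s c) &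
  complement (incl s c) (proj s c)].
Proof. exact: projT2 (cid (exists_inclusion s c)). Qed.

(** The product with a letter over D is compressed by the scalar matrices found over A. That these
    matrices still intertwine over D is [transfer_intertwiner]. *)
Fixpoint transfer s : 'M[D]_(d s) :=
  if s is c :: s' then
    scmx D (proj s' c) *m (transfer s' *t LD c) *m scmx D (incl s' c)
  else 1%:M.

(* Frobenius reciprocity: the copy of r s0 in r (~~ c :: s0) (x) L c is
   obtained, up to scalars, by bending the inclusion of r (~~ c :: s0) in
   r s0 (x) L (~~ c), and the bent maps also intertwine over D. *)
Lemma transfer_complement s0 c (I' : 'M[C]_(d (~~ c :: s0) * n, d s0)) J' :
  incl (~~ c :: s0) c *m proj (~~ c :: s0) c + I' *m J' = 1%:M ->
  J' *m I' = 1%:M ->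
  (r (~~ c :: s0) *t LG c) *m scmx A I' = scmx A I' *m r s0 ->
  scmx A J' *m (r (~~ c :: s0) *t LG c) = r s0 *m scmx A J' ->
  (transfer s0 *t LD (~~ c)) *m scmx D (incl s0 (~~ c)) =
    scmx D (incl s0 (~~ c)) *m transfer (~~ c :: s0) ->
  scmx D (proj s0 (~~ c)) *m (transfer s0 *t LD (~~ c)) =
    transfer (~~ c :: s0) *m scmx D (proj s0 (~~ c)) ->
  (transfer (~~ c :: s0) *t LD c) *m scmx D I' = scmx D I' *m transfer s0 /\
  scmx D J' *m (transfer (~~ c :: s0) *t LD c) = transfer s0 *m scmx D J'.
Proof.
set s := ~~ c :: s0 => IJ1 J'I' rI' rJ' tI tJ.
have [J0I0 rI0 rJ0 _] := inclP s0 (~~ c).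
have [JI rI rJ _] := inclP s c.
pose a := cup_mate (proj s0 (~~ c)) (cup c).
pose b := cap_mate (incl s0 (~~ c)) (cap c).
have aG : (r s *t LG c) *m scmx A a = scmx A a *m r s0.
  by apply: cup_mate_intertwiner (cupG c); rewrite rJ0.
have bG : scmx A b *m (r s *t LG c) = r s0 *m scmx A b.
  by apply: cap_mate_intertwiner (capG c); rewrite rI0.
have aD : (transfer s *t LD c) *m scmx D a = scmx D a *m transfer s0.
  by apply: cup_mate_intertwiner (cupD c); rewrite tJ.
have bD : scmx D b *m (transfer s *t LD c) = transfer s0 *m scmx D b.
  by apply: cap_mate_intertwiner (capD c); rewrite tI.
have ds : (0 < d s)%N by have [_ ] := r_irr s.
have nz (F : 'M[C]_(d s)) : F = 1%:M -> F <> 0.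
  move=> -> /matrixP/(_ (Ordinal ds) (Ordinal ds)); rewrite !mxE eqxx => /eqP.
  by rewrite oner_eq0.
have a0 : a <> 0.
  by move=> /(cup_mate_eq0 (cup_unit c)) e; apply: nz J0I0 _; rewrite e mul0mx.
have b0 : b <> 0.
  by move=> /(cap_mate_eq0 (cap_unit c)) e; apply: nz J0I0 _; rewrite e mulmx0.
(* Since c :: s is two letters longer than s0, the two irreducibles are inequivalent; this confines
   a and b to the summand r s0. *)
have neq : c :: s <> s0.
  by move=> /(congr1 size) /= e; have := ltnn (size s0); rewrite -{2}e /= ltnS leqnSn.
have Ja0 : proj s c *m a = 0.
  have hJa : r (c :: s) *m scmx A (proj s c *m a) = scmx A (proj s c *m a) *m r s0.
    by rewrite scmxM -[RHS]mulmxA -aG !mulmxA rJ.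
  by have [//|/r_distinct//] := irreducible_intertwiner (r_irr _) (r_irr _) hJa.
have bI0 : b *m incl s c = 0.
  have hbI : r s0 *m scmx A (b *m incl s c) = scmx A (b *m incl s c) *m r (c :: s).
    by rewrite scmxM mulmxA -bG -[LHS]mulmxA rI mulmxA.
  have [//|/r_distinct e] := irreducible_intertwiner (r_irr _) (r_irr _) hbI.
  by case: neq.
have [la laE] : exists la, J' *m a = la%:M.
  apply: (schur_scalar (r_irr s0)).
  by rewrite scmxM -[RHS]mulmxA -aG !mulmxA rJ'.
have [mu muE] : exists mu, b *m I' = mu%:M.
  apply: (schur_scalar (r_irr s0)).
  by rewrite scmxM mulmxA -bG -[LHS]mulmxA rI' mulmxA.
have aE : a = la *: I'.
  by rewrite -[a]mul1mx -IJ1 mulmxDl -!mulmxA Ja0 laE mulmx0 add0r mul_mx_scalar.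
have bE : b = mu *: J'.
  by rewrite -[b]mulmx1 -IJ1 mulmxDr !mulmxA bI0 muE mul0mx add0r mul_scalar_mx.
have la0 : la != 0 by apply/eqP => e; apply: a0; rewrite aE e scale0r.
have mu0 : mu != 0 by apply/eqP => e; apply: b0; rewrite bE e scale0r.
split.
- have -> : I' = a *m la^-1%:M by rewrite aE mul_mx_scalar scalerA mulVf ?scale1r.
  by rewrite scmxM mulmxA aD -!mulmxA scmx_scalarC.
- have -> : J' = mu^-1%:M *m b by rewrite bE mul_scalar_mx scalerA mulVf ?scale1r.
  by rewrite scmxM -mulmxA bD [RHS]mulmxA -[X in _ = X *m _]scmx_scalarC mulmxA.
Qed.

Lemma transfer_intertwiner_of_comm s c (E := incl s c *m proj s c)
    (X := transfer s *t LD c) :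
  X *m scmx D E = scmx D E *m X ->
  X *m scmx D (incl s c) = scmx D (incl s c) *m transfer (c :: s) /\
  scmx D (proj s c) *m X = transfer (c :: s) *m scmx D (proj s c).
Proof.
move=> XE; have [JI _ _ _] := inclP s c => /=; rewrite -/X.
have EI : E *m incl s c = incl s c by rewrite -mulmxA JI mulmx1.
have JE : proj s c *m E = proj s c by rewrite mulmxA JI mul1mx.
split.
  by rewrite -{1}EI (scmxM D E) [LHS]mulmxA XE /E scmxM -!mulmxA.
by rewrite -{1}JE (scmxM D _ E) -[LHS]mulmxA -XE /E scmxM !mulmxA.
Qed.

(** Over D, the induction hypothesis controls only the complementary summand I' J', through
    [transfer_complement]. The projection E = 1 - I' J' then commutes as well. *)
Lemma transfer_intertwiner s c :
  (transfer s *t LD c) *m scmx D (incl s c) = scmx D (incl s c) *m transfer (c :: s) /\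
  scmx D (proj s c) *m (transfer s *t LD c) = transfer (c :: s) *m scmx D (proj s c).
Proof.
elim: s c => [|c' s0 IH] c; apply: transfer_intertwiner_of_comm.
  have [_ _ _ [->|[s1 [I' [J' [//]]]]]] := inclP [::] c.
  by rewrite scmx1 mulmx1 mul1mx.
have [_ _ _ [->|[s1 [I' [J' [[e1 e2]]]]]]] := inclP (c' :: s0) c.
  by rewrite scmx1 mulmx1 mul1mx.
subst c' s1 => IJ1 J'I' rI' rJ'.
have [tI' tJ'] := transfer_complement IJ1 J'I' rI' rJ' (IH (~~ c)).1 (IH (~~ c)).2.
have -> : incl (~~ c :: s0) c *m proj (~~ c :: s0) c = 1%:M - I' *m J'.
  by rewrite -IJ1 addrK.
rewrite scmxB scmx1 mulmxBl mulmxBr mulmx1 mul1mx scmxM mulmxA tI'.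
by rewrite -!mulmxA tJ'.
Qed.

Definition summand s := {x : NN & ('M[C]_(d s * n, d x) * 'M[C]_(d x, d s * n))%type}.

(** The point is that one list of scalar matrices decomposes the product over both algebras. *)
Lemma transfer_fusion s c : exists l : seq (summand s),
  r s *t LG c = \sum_(q <- l)
    scmx A (projT2 q).1 *m r (projT1 q) *m scmx A (projT2 q).2 /\
  transfer s *t LD c = \sum_(q <- l)
    scmx D (projT2 q).1 *m transfer (projT1 q) *m scmx D (projT2 q).2.
Proof.
have [JI rI rJ compl] := inclP s c.
have [tI tJ] := transfer_intertwiner s c.
pose q0 : summand s := existT _ (c :: s) (incl s c, proj s c).
case: compl => [IJ1|[s1 [I' [J' [e IJ1 J'I' rI' rJ']]]]].
  exists [:: q0]; rewrite !big_seq1 /= -rI -tI.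
  by rewrite -!mulmxA -!scmxM IJ1 !scmx1 !mulmx1.
pose q1 : summand s := existT _ s1 (I', J').
exists [:: q0; q1]; rewrite !big_cons !big_nil !addr0 /= -rI -tI -rI'.
have tI' : (transfer s *t LD c) *m scmx D I' = scmx D I' *m transfer s1.
  subst s; have [tI1 tJ1] := transfer_intertwiner s1 (~~ c).
  by have [] := transfer_complement IJ1 J'I' rI' rJ' tI1 tJ1.
rewrite -tI' -!mulmxA -!scmxM -!mulmxDr -!scmxD IJ1.
by rewrite !scmx1 !mulmx1.
Qed.
End Transfer.

(* Once shown to be functional, this relation is the graph of the *-morphism
   sending v to w. *)
Inductive gen_pair (R : realType) (A D : cstarType R) n (v : 'M[A]_n) (w : 'M[D]_n) :
    A -> D -> Prop :=
| GenPairGen i j : gen_pair v w (v i j) (w i j)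
| GenPair1 : gen_pair v w 1 1
| GenPairLin (c : R[i]) a b a' b' : gen_pair v w a b -> gen_pair v w a' b' ->
    gen_pair v w (c *: a + a') (c *: b + b')
| GenPairM a b a' b' : gen_pair v w a b -> gen_pair v w a' b' ->
    gen_pair v w (a * a') (b * b')
| GenPairJ a b : gen_pair v w a b -> gen_pair v w (star a) (star b).

(** * Corresponding coefficients over the two algebras *)

Section CoefficientPairs.
Variables (R : realType) (G : cmqg R) (r : NN -> sqmx G) (n : nat).
Variables (D : cstarType R) (rh : forall s, 'M[D]_(sqdim (r s))).
Local Notation C := R[i].
Local Notation A := (qalg G).
Variables (LG : bool -> 'M[A]_n) (LD : bool -> 'M[D]_n).
Local Notation d s := (sqdim (r s)).
Hypothesis r_irr : forall s, rep_irreducible (r s).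
Hypothesis r_distinct : forall s s', rep_equiv (r s) (r s') -> s = s'.
Hypotheses (r_nil : sqval (r [::]) = 1%:M) (rh_nil : rh [::] = 1%:M).
Hypothesis fusion : forall s c, exists l : seq (summand r n s),
  r s *t LG c = \sum_(q <- l)
    scmx A (projT2 q).1 *m r (projT1 q) *m scmx A (projT2 q).2 /\
  rh s *t LD c = \sum_(q <- l)
    scmx D (projT2 q).1 *m rh (projT1 q) *m scmx D (projT2 q).2.
Hypotheses (LG_false : LG false = barmx (LG true)) (LD_false : LD false = barmx (LD true)).

Definition coefficient (S : cstarType R) (M : forall s, 'M[S]_(d s)) s
  (f : 'rV[C]_(d s)) (v : 'cV[C]_(d s)) : S := (scmx S f *m M s *m scmx S v) 0 0.

(** This relation contains [gen_pair], and its functionality is accessible through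
    [coefficient_transfer]. *)
Definition coef_pair (a : A) (b : D) : Prop :=
  exists l : seq {s : NN & ('rV[C]_(d s) * 'cV[C]_(d s))%type},
    a = \sum_(q <- l) coefficient (fun s => sqval (r s)) (projT2 q).1 (projT2 q).2 /\
    b = \sum_(q <- l) coefficient rh (projT2 q).1 (projT2 q).2.

Lemma coef_pair_coefficient s f v :
  coef_pair (@coefficient A (fun s => sqval (r s)) s f v) (@coefficient D rh s f v).
Proof. by exists [:: existT _ s (f, v)]; rewrite !big_seq1. Qed.

Lemma coef_pair0 : coef_pair 0 0.
Proof. by exists [::]; rewrite !big_nil. Qed.

Lemma coef_pairD a b a' b' : coef_pair a b -> coef_pair a' b' -> coef_pair (a + a') (b + b').
Proof.
by move=> [l [-> ->]] [l' [-> ->]]; exists (l ++ l'); rewrite !big_cat.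
Qed.

Lemma coef_pair_sum I (l : seq I) (F : I -> A) (H : I -> D) :
  (forall i, coef_pair (F i) (H i)) -> coef_pair (\sum_(i <- l) F i) (\sum_(i <- l) H i).
Proof.
move=> h; elim: l => [|i l IH]; first by rewrite !big_nil; apply: coef_pair0.
by rewrite !big_cons; apply: coef_pairD.
Qed.

Lemma coefficientZ (S : cstarType R) (M : forall s, 'M[S]_(d s)) s c f v :
  coefficient M (c *: f) v = c *: coefficient M (s := s) f v.
Proof.
rewrite /coefficient -mul_scalar_mx scmxM -!mulmxA mxE big_ord1.
by rewrite !mxE mulr1n /= -scalerAl mul1r.
Qed.

Lemma coef_pairZ c a b : coef_pair a b -> coef_pair (c *: a) (c *: b).
Proof.
move=> [l [-> ->]]; rewrite !scaler_sumr; apply: coef_pair_sum => q.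
by rewrite -!coefficientZ; apply: coef_pair_coefficient.
Qed.

Lemma coef_pair1 : coef_pair 1 1.
Proof.
have [_ d0 _] := r_irr [::]; pose i := Ordinal d0.
have cE (S : cstarType R) (M : forall s, 'M[S]_(d s)) : M [::] = 1%:M ->
    coefficient M (delta_mx 0 i) (delta_mx i 0) = 1.
  move=> M1; rewrite /coefficient M1 mulmx1 -scmxM mul_delta_mx.
  by rewrite !mxE /= scale1r.
have := coef_pair_coefficient (delta_mx 0 i) (delta_mx i 0).
by rewrite (cE _ _ r_nil) (cE _ _ rh_nil).
Qed.

Lemma coefficient_mul (S : cstarType R) (M : forall s, 'M[S]_(d s)) (L : 'M[S]_n) s f v k l :
  coefficient M f v * L k l =
  (scmx S (f *t (delta_mx 0 k : 'rV[C]_n)) *m (M s *t L) *m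
   scmx S (v *t (delta_mx l 0 : 'cV[C]_n))) 0 0.
Proof.
rewrite tensmx_scmxl tensmx_scmxr.
have -> : (0 : 'I_(1 * 1)) = mxtens_index (0 : 'I_1, 0 : 'I_1) by rewrite [RHS]ord1.
rewrite tensmxE; congr (_ * _).
by rewrite /scmx !map_delta_mx -rowE -colE !mxE.
Qed.

Lemma coef_pair_mul a b c k l :
  coef_pair a b -> coef_pair (a * LG c k l) (b * LD c k l).
Proof.
move=> [t [-> ->]]; rewrite !mulr_suml; apply: coef_pair_sum => -[s [f v]] /=.
have [q [hG hD]] := fusion s c.
rewrite !coefficient_mul hG hD !mulmx_sumr !mulmx_suml !summxE.
apply: coef_pair_sum => -[x [I J]] /=.
rewrite !mulmxA -!scmxM -!mulmxA -!scmxM !mulmxA.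
exact: coef_pair_coefficient.
Qed.

Lemma coef_pair_bsum a b : coef_pair a b -> exists xs
    (f : 'rV[C]_(bdim r xs)) (v : 'cV[C]_(bdim r xs)),
  a = (scmx A f *m bsum (fun s => sqval (r s)) xs *m scmx A v) 0 0 /\
  b = (scmx D f *m bsum rh xs *m scmx D v) 0 0.
Proof.
move=> [l [-> ->]]; elim: l => [|[s [f v]] l [xs [F [V [IHa IHb]]]]].
  by exists [::], 0, 0; rewrite !big_nil /= !mulmx0 !mul0mx !mxE.
exists (s :: xs), (row_mx f F), (col_mx v V).
rewrite !big_cons IHa IHb /= !scmx_row !scmx_col !mul_row_block !mulmx0 !addr0 !add0r.
rewrite !mul_row_col.
have eD (S : cstarType R) (X Y : 'M[S]_1) : (X + Y) 0 0 = X 0 0 + Y 0 0 by rewrite mxE.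
by rewrite !eD.
Qed.

Lemma coef_pair_inj b : coef_pair 0 b -> b = 0.
Proof.
move=> /coef_pair_bsum[xs [f [v [e ->]]]].
rewrite (coefficient_transfer r_irr r_distinct rh) ?mxE //.
by apply/matrixP => i j; rewrite !ord1 -e mxE.
Qed.

Local Notation paired := (gen_pair (LG true) (LD true)).

Lemma gen_pair_coef a b : paired a b -> coef_pair a b.
Proof.
(* [coef_pair] is stable under right multiplication by the entries of the letters. Quantifying over
   (x, y), and treating a together with its adjoint, lets the induction pass through products and
   the star. *)
suff h : paired a b -> forall x y, coef_pair x y ->
    coef_pair (x * a) (y * b) /\ coef_pair (x * star a) (y * star b).
  by move=> /h/(_ _ _ coef_pair1)[]; rewrite !mul1r.
elim=> {a b} [i j||c a b a' b' _ IH _ IH'|a b a' b' _ IH _ IH'|a b _ IH] x y xy.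
- split; first exact: coef_pair_mul.
  have := coef_pair_mul false i j xy.
  by rewrite LG_false LD_false !mxE.
- by rewrite !star1 !mulr1.
- rewrite !starD !starZ !mulrDr -!scalerAr.
  have [h1 h2] := IH _ _ xy; have [h1' h2'] := IH' _ _ xy.
  by split; apply: coef_pairD => //; apply: coef_pairZ.
- split; first by rewrite !mulrA; apply: (IH' _ _ (IH _ _ xy).1).1.
  by rewrite !starM !mulrA; apply: (IH _ _ (IH' _ _ xy).2).2.
- by rewrite !starK; split; [apply: (IH _ _ xy).2|apply: (IH _ _ xy).1].
Qed.

Lemma gen_pair_inj a b b' : paired a b -> paired a b' -> b = b'.
Proof.
move=> h h'; have := gen_pair_coef (GenPairLin (-1) h' h).
rewrite !scaleN1r addNr => /coef_pair_inj /eqP.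
by rewrite addrC subr_eq0 => /eqP.
Qed.
End CoefficientPairs.

(** * Fusion rules and universality *)

(** The bar of g is a prefix of a one-letter word: either g is empty, or it is the opposite letter,
    which must end the left word. *)
Lemma fusion_letterE s c (t : NN * NN * NN) : (t \in fusion (rev s) [:: c]) =
  (t == (rev s, [:: c], [::])) ||
  (if s is c' :: s' then (c' == ~~ c) && (t == (rev s', [::], [:: c'])) else false).
Proof.
case: t => -[a b] g; rewrite mem_fusion /word_mul /word_bar.
apply/andP/orP => [[/eqP e1 /eqP e2]|].
  case: g e1 e2 => [|g0 [|g1 g]] e1 e2.
  - by left; move: e1 e2; rewrite cats0 => -> /= <-.
  - move: e2; rewrite /= => -[-> <-]; right.
    have -> : s = g0 :: rev a by rewrite -[s]revK e1 rev_cat.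
    by rewrite /= negbK revK !eqxx.
  - have := congr1 size e2; rewrite size_cat size_rev /= addSn addSn.
    by [].
move=> [/eqP[-> -> ->]|]; first by rewrite cats0 /= !eqxx.
case: s => // c' s /andP[/eqP-> /eqP[-> -> ->]].
by rewrite rev_cons -cats1 /= negbK !eqxx.
Qed.

Lemma fusion_letter_free s c : ohead s != Some (~~ c) ->
  fusion (rev s) [:: c] = [:: (rev s, [:: c], [::])].
Proof.
move=> hs; apply/perm_small_eq => //; apply: uniq_perm => //; first exact: fusion_uniq.
move=> t; rewrite fusion_letterE inE; case: s hs => [|c' s] /=; first by rewrite orbF.
by rewrite (inj_eq Some_inj) => /negPf ->; rewrite orbF.
Qed.

Lemma fusion_letter_cancel s c :
  perm_eq (fusion (rev (~~ c :: s)) [:: c])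
    [:: (rev (~~ c :: s), [:: c], [::]); (rev s, [::], [:: ~~ c])].
Proof.
apply: uniq_perm; first exact: fusion_uniq.
  by rewrite /= andbT inE !xpair_eqE !andbF.
by move=> t; rewrite fusion_letterE !inE eqxx.
Qed.

Lemma perm_eq_pair (T : eqType) (l : seq T) x y :
  perm_eq l [:: x; y] -> l = [:: x; y] \/ l = [:: y; x].
Proof.
move=> lxy; have := perm_size lxy.
case: l lxy => [|a [|b [|]]] //= lxy _.
have := perm_mem lxy a; rewrite !inE eqxx /= => /esym/orP[/eqP ax|/eqP ay]; subst a.
  by left; move: lxy; rewrite perm_cons => /perm_small_eq-> .
right; move: lxy; rewrite perm_sym -[[:: x; y]]/([:: x] ++ [:: y]) perm_catC.
by rewrite perm_sym perm_cons => /perm_small_eq->.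
Qed.

(** * Duality morphisms from the relations of A_u(F) *)

Section AuRelations.
Variables (R : realType).
Local Notation C := R[i].

Definition letter (S : cstarType R) n (w : 'M[S]_n) (c : bool) : 'M[S]_n :=
  if c then w else barmx w.

(** Put z = F \bar w F^-1. The caps come from w^* w = 1 (case [true]) and z^* z = 1 (case [false]),
    the cups from z z^* = 1 (case [true]) and w w^* = 1 (case [false]), after clearing the outer
    factors F. *)
Definition letter_cap n (F : 'M[C]_n) (c : bool) : 'M[C]_n :=
  if c then 1%:M else adjmx F *m F.

Definition letter_cup n (F : 'M[C]_n) (c : bool) : 'M[C]_n :=
  if c then invmx F *m adjmx (invmx F) else 1%:M.

Lemma adjmx_unit n (F : 'M[C]_n) : F \in unitmx -> adjmx F \in unitmx.
Proof. by move=> Fu; rewrite /adjmx unitmx_tr map_unitmx. Qed.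

Lemma letter_cap_unit n (F : 'M[C]_n) c : F \in unitmx -> letter_cap F c \in unitmx.
Proof.
by case: c => Fu /=; rewrite ?unitmx1 // unitmx_mul adjmx_unit.
Qed.

Lemma letter_cup_unit n (F : 'M[C]_n) c : F \in unitmx -> letter_cup F c \in unitmx.
Proof.
by case: c => Fu /=; rewrite ?unitmx1 // unitmx_mul adjmx_unit unitmx_inv Fu.
Qed.

Variables (S : cstarType R) (n : nat) (F : 'M[C]_n) (w : 'M[S]_n).
Hypotheses (Fu : F \in unitmx) (wF : Au_relations F w).

Lemma barmxK : barmx (barmx w) = w.
Proof. by apply/matrixP => i j; rewrite !mxE starK. Qed.

Let FiF : scmx S (invmx F) *m scmx S F = 1%:M.
Proof. by rewrite -scmxM mulVmx // scmx1. Qed.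
Let aFiF : scmx S (adjmx F) *m scmx S (adjmx (invmx F)) = 1%:M.
Proof. by rewrite -scmxM -adjmxM mulVmx // adjmx1 scmx1. Qed.
Let dagz : dagmx (scmx S F *m barmx w *m scmx S (invmx F)) =
  scmx S (adjmx (invmx F)) *m w^T *m scmx S (adjmx F).
Proof.
rewrite !dagmxM !dagmx_sc mulmxA; congr (_ *m _ *m _).
by rewrite /dagmx -/(barmx _) barmxK.
Qed.

Lemma letter_capE c : (letter w (~~ c))^T *m scmx S (letter_cap F c) *m letter w c =
  scmx S (letter_cap F c).
Proof.
have [[ww' w'w] [zz' z'z]] := wF.
case: c => /=; first by rewrite scmx1 mulmx1.
rewrite -/(dagmx _) dagz in z'z.
have := congr1 (fun X => scmx S (adjmx F) *m X *m scmx S F) z'z.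
rewrite mulmx1 -[RHS]scmxM => h; rewrite -[RHS]h.
rewrite !mulmxA aFiF mul1mx -[RHS]mulmxA FiF mulmx1 scmxM.
by rewrite !mulmxA.
Qed.

Lemma letter_cupE c : letter w (~~ c) *m scmx S (letter_cup F c) *m (letter w c)^T =
  scmx S (letter_cup F c).
Proof.
have [[ww' w'w] [zz' z'z]] := wF.
case: c => /=; last by rewrite scmx1 mulmx1.
rewrite -/(dagmx _) dagz in zz'.
have := congr1 (fun X => scmx S (invmx F) *m X *m scmx S (adjmx (invmx F))) zz'.
rewrite mulmx1 -[RHS]scmxM => h; rewrite -[RHS]h.
rewrite !mulmxA FiF mul1mx -[RHS]mulmxA aFiF mulmx1 scmxM.
by rewrite !mulmxA.
Qed.
End AuRelations.

Lemma unitary_conj (R : realType) (A : cstarType R) n (u u' : 'M[A]_n) (Q : 'M[R[i]]_n) :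
  u *m u' = 1%:M -> Q \in unitmx ->
  dagmx u *m scmx A (adjmx Q *m Q) *m u = scmx A (adjmx Q *m Q) ->
  unitary_matrix (scmx A Q *m u *m scmx A (invmx Q)).
Proof.
move=> uu' Qu uQ; set v := _ *m _.
have vv : dagmx v *m v = 1%:M.
  rewrite /v !dagmxM !dagmx_sc.
  transitivity (scmx A (adjmx (invmx Q)) *m
      (dagmx u *m scmx A (adjmx Q *m Q) *m u) *m scmx A (invmx Q)).
    by rewrite scmxM !mulmxA.
  rewrite uQ scmxM mulmxA -scmxM -mulmxA -scmxM -adjmxM mulmxV // adjmx1 scmx1.
  by rewrite mulmx1.
(* Over A a left inverse need not be a right inverse; the right inverse of u gives one for v, and it
   must equal [dagmx v]. *)
have [x vx] : exists x, v *m x = 1%:M.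
  exists (scmx A Q *m u' *m scmx A (invmx Q)).
  rewrite /v !mulmxA -(mulmxA _ (scmx A (invmx Q))) -scmxM mulVmx // scmx1 mulmx1.
  by rewrite -(mulmxA (scmx A Q)) uu' mulmx1 -scmxM mulmxV // scmx1.
split; last exact: vv.
rewrite -/(dagmx v); suff -> : dagmx v = x by [].
by rewrite -[LHS]mulmx1 -vx mulmxA vv mul1mx.
Qed.

Lemma gen_star_subalg (R : realType) (A : cstarType R) (X : set A) :
  star_subalg (gen_star_alg X).
Proof.
split.
- by move=> M [[M1 _ _ _] _].
- by move=> c a b ha hb M MX; have [[_ Ml _ _] _] := MX; apply: Ml; [apply: ha|apply: hb].
- by move=> a b ha hb M MX; have [[_ _ MM _] _] := MX; apply: MM; [apply: ha|apply: hb].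
- by move=> a ha M MX; have [[_ _ _ MJ] _] := MX; apply: MJ; apply: ha.
Qed.

Lemma gen_star_alg_sub (R : realType) (A : cstarType R) (X : set A) a :
  X a -> gen_star_alg X a.
Proof. by move=> Xa M [_ XM]; apply: XM. Qed.

Lemma gen_star_alg_min (R : realType) (A : cstarType R) (X M : set A) :
  star_subalg M -> (forall a, X a -> M a) -> forall a, gen_star_alg X a -> M a.
Proof. by move=> MP XM a; apply. Qed.

Section FusionRules.
Variables (R : realType) (G : cmqg R) (r : NN -> sqmx G).
Local Notation C := R[i].
Local Notation A := (qalg G).
Hypothesis r_irr : forall x, rep_irreducible (r x).
Hypothesis r_distinct : forall x y, rep_equiv (r x) (r y) -> x = y.
Hypothesis r_e : rep_equiv (r word_e) (rep_one G).
Hypothesis r_fusion : forall x y, rep_equiv (rep_tensor (r x) (r y))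
  (rep_sum [seq r (word_mul t.1.1 t.1.2) | t <- fusion x y]).

Lemma rep_addC (s t : sqmx G) : rep_equiv (rep_add s t) (rep_add t s).
Proof.
exists (block_mx 0 1%:M 1%:M 0), (block_mx 0 1%:M 1%:M 0); split => /=;
  rewrite ?scmx_block ?scmx0 ?scmx1 !mulmx_block
    ?(mulmx0, mul0mx, mulmx1, mul1mx, addr0, add0r) //.
- by rewrite -scalar_mx_block.
- by rewrite -scalar_mx_block.
Qed.

Lemma tensor_letter_free s c : ohead s != Some (~~ c) ->
  rep_equiv (rep_tensor (r (rev s)) (r [:: c])) (r (rev (c :: s))).
Proof.
move=> hs; have := r_fusion (rev s) [:: c].
rewrite fusion_letter_free //= /word_mul /= cats1 -rev_cons => h.
exact: rep_equiv_trans h (rep_sum1 _).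
Qed.

Lemma tensor_letter_cancel s c :
  rep_equiv (rep_tensor (r (rev (~~ c :: s))) (r [:: c]))
    (rep_add (r (rev (c :: ~~ c :: s))) (r (rev s))).
Proof.
have h := r_fusion (rev (~~ c :: s)) [:: c].
apply: rep_equiv_trans h _.
have [->|->] := perm_eq_pair (fusion_letter_cancel s c);
  rewrite /= /word_mul /= cats1 cats0 -rev_cons.
  exact: rep_sum2.
exact: rep_equiv_trans (rep_sum2 _ _) (rep_addC _ _).
Qed.

Lemma no_fixed_vector x (z : 'cV[C]_(sqdim (r x))) : x <> word_e ->
  r x *m scmx A z = scmx A z -> z = 0.
Proof.
move=> xe hz; have irr1 := rep_equiv_irreducible r_e (r_irr word_e).
have hz1 : r x *m scmx A z = scmx A z *m rep_one G by rewrite mulmx1.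
have [//|h] := irreducible_intertwiner (r_irr x) irr1 hz1.
by case: xe; apply: r_distinct; apply: rep_equiv_trans h (rep_equiv_sym r_e).
Qed.

Lemma rep_nil : sqval (r [::]) = 1%:M.
Proof.
have [T [T' [TT' _ /= h]]] := r_e.
rewrite mulmx1 in h.
by rewrite -[LHS]mulmx1 -(scmx1 A) -TT' scmxM mulmxA h.
Qed.

(** Here r [:: ~~ c; c] is the nontrivial summand of \bar u (x) u. The letter is left free so that
    the result serves both u and \bar u. *)
Lemma letter_unitarization c (u : sqmx G) :
  rep_equiv (r [:: ~~ c]) (rep_bar u) -> rep_equiv (r [:: c]) u ->
  exists2 Q : 'M[C]_(sqdim u), Q \in unitmx &
    dagmx u *m scmx A (adjmx Q *m Q) *m u = scmx A (adjmx Q *m Q).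
Proof.
move=> hb hu.
have is_rep_r x : is_rep (r x) by have [] := r_irr x.
apply: (@exists_invariant_form _ _ u (r [:: ~~ c; c])).
- exact: rep_equiv_is_rep hu _.
- exact: is_rep_r.
- by move=> z; apply: no_fixed_vector.
apply: rep_equiv_trans (rep_equiv_tensor (rep_equiv_sym hb) (rep_equiv_sym hu)) _.
have h := tensor_letter_cancel [::] c; apply: rep_equiv_trans h _.
apply: rep_equiv_trans (rep_addC _ _) _.
exact: rep_equiv_add r_e (rep_equiv_refl _).
Qed.
End FusionRules.

(** * Choice of the matrix F *)

Section Conjugation.
Variables (R : realType) (A : cstarType R) (n : nat).
Local Notation C := R[i].

Lemma barmx_conj (u : 'M[A]_n) (P Q : 'M[C]_n) :
  barmx (scmx A P *m u *m scmx A Q) =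
  scmx A (map_mx Num.conj P) *m barmx u *m scmx A (map_mx Num.conj Q).
Proof.
apply/matrixP => i j; rewrite !mxE raddf_sum; apply: eq_bigr => l _.
rewrite !mxE /= -!scalerAr !mulr1 starZ raddf_sum; congr (_ *: _).
apply: eq_bigr => k _.
by rewrite !mxE /= -!scalerAl !mul1r starZ.
Qed.

(** For v = Q u Q^-1 the choice F = Q2 conj(Q)^-1 gives F \bar v F^-1 = Q2 \bar u Q2^-1, which is
    unitary because Q2^* Q2 is invariant under \bar u. *)
Lemma exists_Au_relations (u u' u'' : 'M[A]_n) (Q Q2 : 'M[C]_n) :
  u *m u' = 1%:M -> barmx u *m u'' = 1%:M -> Q \in unitmx -> Q2 \in unitmx ->
  dagmx u *m scmx A (adjmx Q *m Q) *m u = scmx A (adjmx Q *m Q) ->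
  dagmx (barmx u) *m scmx A (adjmx Q2 *m Q2) *m barmx u = scmx A (adjmx Q2 *m Q2) ->
  exists2 F : 'M[C]_n, F \in unitmx & Au_relations F (scmx A Q *m u *m scmx A (invmx Q)).
Proof.
move=> uu' uu'' Qu Q2u uQ uQ2.
have Qcu : map_mx Num.conj Q \in unitmx by rewrite map_unitmx.
have [F Fu FQ] : exists2 F, F \in unitmx & F *m map_mx Num.conj Q = Q2.
  exists (Q2 *m invmx (map_mx Num.conj Q)); last exact: mulmxKV.
  by rewrite unitmx_mul Q2u unitmx_inv.
exists F => //; split; first exact: unitary_conj uu' Qu uQ.
have QF : map_mx Num.conj (invmx Q) *m invmx F = invmx Q2.
  rewrite -[LHS](mulmxK Q2u) -{1}FQ map_invmx !mulmxA mulmxKV //.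
  by rewrite mulVmx // mul1mx.
rewrite barmx_conj !mulmxA -scmxM FQ -mulmxA -scmxM QF.
exact: unitary_conj uu'' Q2u uQ2.
Qed.
End Conjugation.

Lemma rep_equiv_conj (R : realType) (G : cmqg R) n (u : 'M[qalg G]_n) (Q : 'M[R[i]]_n) :
  Q \in unitmx ->
  rep_equiv (Sqmx u) (Sqmx (scmx (qalg G) Q *m u *m scmx _ (invmx Q))).
Proof.
move=> Qu; exists (invmx Q), Q; rewrite mulVmx // mulmxV //; split=> //=.
by rewrite !mulmxA -scmxM mulVmx // scmx1 mul1mx.
Qed.

Section Assembly.
Variables (R : realType) (G : cmqg R) (r : NN -> sqmx G).
Local Notation C := R[i].
Local Notation A := (qalg G).
Hypothesis r_irr : forall x, rep_irreducible (r x).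
Hypothesis r_distinct : forall x y, rep_equiv (r x) (r y) -> x = y.
Hypothesis r_e : rep_equiv (r word_e) (rep_one G).
Hypothesis r_fusion : forall x y, rep_equiv (rep_tensor (r x) (r y))
  (rep_sum [seq r (word_mul t.1.1 t.1.2) | t <- fusion x y]).
Variables (n : nat) (F : 'M[C]_n) (v : 'M[A]_n).
Hypotheses (Fu : F \in unitmx) (vF : Au_relations F v).
Hypothesis r_letter : forall c, rep_equiv (r [:: c]) (Sqmx (letter v c)).

Lemma gen_pair_functional (D : cstarType R) (w : 'M[D]_n) a b b' :
  Au_relations F w -> gen_pair v w a b ->
  gen_pair v w a b' -> b = b'.
Proof.
move=> wF.
(* The transfer adds letters at the head of a list, whereas tensoring on the right adds them at the
   end of the word. *)
pose r' s := r (rev s).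
have irr' s : rep_irreducible (r' s) := r_irr (rev s).
have dist' s t : rep_equiv (r' s) (r' t) -> s = t.
  by move=> /r_distinct /(can_inj revK).
have tens s c : rep_equiv (rep_tensor (r' s) (Sqmx (letter v c)))
    (rep_tensor (r' s) (r [:: c])).
  exact: rep_equiv_tensor (rep_equiv_refl _) (rep_equiv_sym (r_letter c)).
have free s c : ohead s != Some (~~ c) ->
    rep_equiv (rep_tensor (r' s) (Sqmx (letter v c))) (r' (c :: s)).
  by move=> hs; apply: rep_equiv_trans (tens s c) _; apply: tensor_letter_free.
have cancel s c : rep_equiv (rep_tensor (r' (~~ c :: s)) (Sqmx (letter v c)))
    (rep_add (r' (c :: ~~ c :: s)) (r' s)).
  by apply: rep_equiv_trans (tens _ c) _; apply: tensor_letter_cancel.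
have fus := transfer_fusion irr' dist' free cancel
  (fun c => letter_cup_unit c Fu) (fun c => letter_cap_unit c Fu)
  (letter_cupE Fu vF) (letter_capE Fu vF) (letter_cupE Fu wF) (letter_capE Fu wF).
by apply: (gen_pair_inj irr' dist' (rep_nil r_e) _ fus).
Qed.
End Assembly.

Section GeneratedPairs.
Variables (R : realType) (A D : cstarType R) (n : nat).
Variables (v : 'M[A]_n) (w : 'M[D]_n).
Local Notation C := R[i].
Local Notation paired := (gen_pair v w).

Hypothesis paired_functional : forall a b b', paired a b -> paired a b' -> b = b'.

Lemma gen_pair_star_hom (S : set A) :
  star_subalg S -> (forall a, S a -> exists b, paired a b) ->
  exists2 phi : A -> D, star_hom_on S phi & forall a, S a -> paired a (phi a).
Proof.
move=> [S1 Sl SM SJ] Sp.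
pose phi a := if pselect (exists b, paired a b) is left e then projT1 (cid e) else 0.
have phiP a : S a -> paired a (phi a).
  move=> /Sp ea; rewrite /phi; case: pselect => // e.
  exact: projT2 (cid e).
exists phi => //; split.
- exact: paired_functional (phiP _ S1) (GenPair1 _ _).
- move=> c a b Sa Sb; apply: paired_functional (phiP _ (Sl c a b Sa Sb)) _.
  by apply: GenPairLin; apply: phiP.
- move=> a b Sa Sb; apply: paired_functional (phiP _ (SM a b Sa Sb)) _.
  by apply: GenPairM; apply: phiP.
- move=> a Sa; apply: paired_functional (phiP _ (SJ a Sa)) _.
  by apply: GenPairJ; apply: phiP.
Qed.
End GeneratedPairs.

Lemma gen_pair_total (R : realType) (A D : cstarType R) n (v : 'M[A]_n) (w : 'M[D]_n) a :
  gen_star_alg (entries v) a -> exists b, gen_pair v w a b.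
Proof.
apply: (gen_star_alg_min (M := fun a => exists b, gen_pair v w a b)).
  split.
  - by exists 1; apply: GenPair1.
  - by move=> c x y [x' hx] [y' hy]; exists (c *: x' + y'); apply: GenPairLin.
  - by move=> x y [x' hx] [y' hy]; exists (x' * y'); apply: GenPairM.
  - by move=> x [x' hx]; exists (star x'); apply: GenPairJ.
by move=> x [i [j ->]]; exists (w i j); apply: (GenPairGen v w).
Qed.

Lemma gen_star_alg_conj (R : realType) (A : cstarType R) n (u : 'M[A]_n)
    (P Q : 'M[R[i]]_n) i j :
  gen_star_alg (entries u) ((scmx A P *m u *m scmx A Q) i j).
Proof.
have Su := gen_star_subalg (entries u).
apply: (star_subalg_mulmx Su) => i' j'; last exact: star_subalg_scmx.
apply: (star_subalg_mulmx Su) => i'' j''; first exact: star_subalg_scmx.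
by apply: gen_star_alg_sub; exists i'', j''.
Qed.

Lemma Au_relations_map (R : realType) (A B : cstarType R) (S : set A) (f : A -> B)
    n (F : 'M[R[i]]_n) (v : 'M[A]_n) :
  star_subalg S -> star_hom_on S f -> (forall i j, S (v i j)) ->
  Au_relations F v -> Au_relations F (map_mx f v).
Proof.
move=> SP fP Sv.
have unit_map (x : 'M[A]_n) : (forall i j, S (x i j)) ->
    unitary_matrix x -> unitary_matrix (map_mx f x).
  move=> Sx [xx' x'x].
  have Sd i j : S (dagmx x i j) by rewrite !mxE; apply: star_subalgJ.
  have f1 : map_mx f (1%:M : 'M[A]_n) = 1%:M.
    by rewrite -(scmx1 A) (star_hom_scmx SP fP) scmx1.
  rewrite /unitary_matrix -/(dagmx _) -(star_hom_dagmx fP) //.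
  by rewrite -!(star_hom_mulmx SP fP) // xx' x'x.
have Sb i j : S (barmx v i j) by rewrite mxE; apply: star_subalgJ.
have Ss (M : 'M[R[i]]_n) i j : S (scmx A M i j) by exact: star_subalg_scmx.
have SFb i j : S ((scmx A F *m barmx v) i j) by apply: star_subalg_mulmx.
move=> [h1 h2]; split; first exact: unit_map.
have -> : barmx (map_mx f v) = map_mx f (barmx v).
  by apply/matrixP => i j; rewrite !mxE (star_homJ fP).
rewrite -!(star_hom_scmx SP fP) -!(star_hom_mulmx SP fP) //.
by apply: unit_map => // i j; apply: star_subalg_mulmx.
Qed.

Theorem theorem2 (R : realType) (G : cmqg R) (r : NN -> sqmx G)
    (r_irr : forall x, rep_irreducible (r x))
    (r_exhaust : forall s : sqmx G, rep_irreducible s ->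
       exists x, rep_equiv s (r x))
    (r_distinct : forall x y, rep_equiv (r x) (r y) -> x = y)
    (r_e : rep_equiv (r word_e) (rep_one G))
    (r_alpha : rep_equiv (r word_alpha) (rep_fund G))
    (r_beta : rep_equiv (r word_beta) (rep_bar (rep_fund G)))
    (r_fusion : forall x y,
       rep_equiv (rep_tensor (r x) (r y))
         (rep_sum [seq r (word_mul t.1.1 t.1.2) | t <- fusion x y]))
    (Gfull : cstarType R) (emb : qalg G -> Gfull)
    (Gfull_env : is_enveloping (coef_alg G) emb) :
  exists (n : nat) (F : 'M[R[i]]_n) (A : cstarType R) (v : 'M[A]_n),
    [/\ F \in unitmx, is_Au F v & qg_similar (map_mx emb (qmx G)) v].
Proof.
have [embP emb_dense emb_univ] := Gfull_env.
set u := qmx G; set n := qdim G in u *; pose A := qalg G.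
have SP : star_subalg (coef_alg G) := gen_star_subalg (entries u).
have Su i j : coef_alg G (u i j) by apply: gen_star_alg_sub; exists i, j.
have is_rep_r x : is_rep (r x) by have [] := r_irr x.
have [[u' [uu' _]] _] := rep_equiv_is_rep r_alpha (is_rep_r _).
have [[u'' [uu'' _]] _] := rep_equiv_is_rep r_beta (is_rep_r _).
have [Q Qu uQ] := letter_unitarization (c := true) r_irr
  r_distinct r_e r_fusion r_beta r_alpha.
(* The conjugate of \bar u is u, so the same argument applied to \bar u decomposes u (x) \bar u. *)
have r_alpha' : rep_equiv (r word_alpha) (rep_bar (rep_bar (rep_fund G))).
  by rewrite /rep_bar /= barmxK.
have [Q2 Q2u uQ2] := letter_unitarization (c := false) r_irr
  r_distinct r_e r_fusion r_alpha' r_beta.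
rewrite /= in Q Qu uQ Q2 Q2u uQ2 uu' uu''.
have [F Fu vF] := exists_Au_relations uu' uu'' Qu Q2u uQ uQ2.
set v := scmx A Q *m u *m scmx A (invmx Q) in vF.
have Sv i j : coef_alg G (v i j) by apply: gen_star_alg_conj.
have r_letter c : rep_equiv (r [:: c]) (Sqmx (letter v c)).
  case: c => /=; first by apply: rep_equiv_trans r_alpha (rep_equiv_conj _ Qu).
  apply: rep_equiv_trans r_beta _; rewrite /v barmx_conj map_invmx.
  by apply: rep_equiv_conj; rewrite map_unitmx.
have vE : map_mx emb v = scmx Gfull Q *m map_mx emb u *m scmx Gfull (invmx Q).
  rewrite (star_hom_mulmx SP embP) => [|i j|i j]; last exact: star_subalg_scmx.
    rewrite (star_hom_mulmx SP embP) => // [|i j]; last exact: star_subalg_scmx.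
    by rewrite !(star_hom_scmx SP embP).
  by apply: star_subalg_mulmx => // i' j'; apply: star_subalg_scmx.
have uE : map_mx emb u = scmx Gfull (invmx Q) *m map_mx emb v *m scmx Gfull Q.
  rewrite vE !mulmxA -scmxM mulVmx // scmx1 mul1mx -mulmxA -scmxM mulVmx //.
  by rewrite scmx1 mulmx1.
exists n, F, Gfull, (map_mx emb v); split=> //.
- split; first exact: Au_relations_map SP embP Sv vF.
  + move=> a e e0; have [_ [s Ss <-] hs] := emb_dense a e e0; exists (emb s) => //.
    have Vsub := gen_star_subalg (entries (map_mx emb v)).
    move: s Ss {hs}.
    (* Membership in G_s is carried along because [emb] is known to be a morphism only there. *)
    suff : forall s, coef_alg G s -> coef_alg G s /\
      gen_star_alg (entries (map_mx emb v)) (emb s) by move=> h s /h[].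
    apply: (gen_star_alg_min (M := fun s => coef_alg G s /\
      gen_star_alg (entries (map_mx emb v)) (emb s))); first split.
    * rewrite (star_hom1 embP).
      by split; [apply: (star_subalg1 SP)|apply: (star_subalg1 Vsub)].
    * move=> c x y [Sx hx] [Sy hy]; have Scx := star_subalgZ SP c Sx; split.
        exact: (star_subalgD SP).
      rewrite (star_homD embP) // (star_homZ SP embP) //.
      by apply: (star_subalgD Vsub) => //; apply: (star_subalgZ Vsub).
    * move=> x y [Sx hx] [Sy hy]; rewrite (star_homM embP) //.
      by split; [apply: (star_subalgM SP)|apply: (star_subalgM Vsub)].
    * move=> x [Sx hx]; rewrite (star_homJ embP) //.
      by split; [apply: (star_subalgJ SP)|apply: (star_subalgJ Vsub)].
    move=> x [i [j ->]]; split; first exact: Su.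
    have -> : emb (u i j) = map_mx emb u i j by rewrite mxE.
    by rewrite uE; apply: gen_star_alg_conj.
  + move=> D w wF.
    have func a b b' := gen_pair_functional (a := a) (b := b) (b' := b')
      r_irr r_distinct r_e r_fusion Fu vF r_letter wF.
    have tot a : coef_alg G a -> exists b, gen_pair v w a b.
      move=> Sa; apply: gen_pair_total; move: a Sa.
      apply: (gen_star_alg_min (gen_star_subalg (entries v))).
      move=> x [i [j ->]].
      have -> : qmx G i j = (scmx A (invmx Q) *m v *m scmx A Q) i j.
        rewrite /v !mulmxA -scmxM mulVmx // scmx1 mul1mx -mulmxA -scmxM mulVmx //.
        by rewrite scmx1 mulmx1.
      exact: gen_star_alg_conj.
    have [phi phiP phi_pair] := gen_pair_star_hom func SP tot.
    have [psi psiP psiE] := emb_univ D phi phiP; exists psi => //.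
    apply/matrixP => i j; rewrite [LHS]mxE [X in psi X]mxE psiE //.
    exact: func (phi_pair _ (Sv i j)) (GenPairGen v w i j).
- exists erefl, (invmx Q), id; split=> //.
  + by rewrite unitmx_inv.
  + by exists id.
  + rewrite castmx_id invmxK uE.
    by apply/matrixP => i j; rewrite mxE.
Qed.
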